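(* There exist constants $d_0,\nu_0>0$, depending only on the shear profile $b$, such that the following holds. For every $p>\frac{N+3}{2}$ there is a constant $C=C(b,p)$ such that for every $\nu\in(0,\nu_0)$, every $f_{\rm in}\in C^\infty(\bar\Omega)$ satisfying the boundary conditions (periodic, Dirichlet, or Neumann) and $\int_{\mathbb T} f_{\rm in}(x,y)\,dx=0$ for all $y$, and every $t>0$, the solution $f$ of $$\partial_t f+b(y)\,\partial_x f-\nu\,\partial_{yy}f=0\quad\text{on }\Omega\times(0,\infty),\qquad f(\cdot,0)=f_{\rm in},$$ with periodic, homogeneous Dirichlet, or homogeneous Neumann conditions in $y$, satisfies $$\left\|\exp\!\left(d_0\,\nu^{\frac{N+1}{N+3}}\,|\partial_x|^{\frac1p}\,t\right)f(\cdot,t)\right\|_{L^2(\Omega)}\le C\,\|f_{\rm in}\|_{L^2(\Omega)} .$$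
   Context: $\mathbb T=\mathbb R/\mathbb Z$. $\Omega=\mathbb T\times D$, where either $D=\mathbb T$ (periodic setting) or $D=(0,1)$; when $D=(0,1)$ one imposes either homogeneous Dirichlet conditions ($f=0$ on $\{y=0,1\}$) or homogeneous Neumann conditions ($\partial_y f=0$ on $\{y=0,1\}$). The shear profile $b\in C^\infty(\bar D)$ is real-valued and has precisely $M\ge 0$ critical points $y_1,\dots,y_M$ in $\bar D$ (finitely many). At each critical point $y_i$ there is an integer $N_i\ge1$ with $b^{(k)}(y_i)=0$ for all $1\le k\le N_i$ and $b^{(N_i+1)}(y_i)\ne0$. Set $N=\max_{1\le i\le M}N_i$ if $M\ge1$, and $N=0$ if $M=0$. Solutions: for each $f_{\rm in}\in C^\infty(\bar\Omega)$ satisfying the chosen boundary conditions, ''the solution'' is the unique $f\in C([0,\infty);L^2(\Omega))\cap C^\infty(\bar\Omega\times(0,\infty))$ solving the equation with $f(\cdot,0)=f_{\rm in}$ and the chosen boundary conditions. For a function $m$ on $[0,\infty)$, $m(|\partial_x|)$ denotes the Fourier multiplier in $x\in\mathbb T$ acting on the mode $e^{ikx}$, $k\in2\pi\mathbb Z$, by multiplication by $m(|k|)$. *)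

(* Defs.v *)
From HB Require Import structures.
From mathcomp Require Import all_boot all_order all_algebra.
From mathcomp Require Import complex.
From mathcomp Require Import all_classical all_reals all_analysis.
Set Implicit Arguments.
Unset Strict Implicit.
Unset Printing Implicit Defensive.
Import Order.TTheory GRing.Theory Num.Theory.
Import numFieldNormedType.Exports.
Local Open Scope classical_set_scope.
Local Open Scope ring_scope.
Local Open Scope complex_scope.

(* The circle is R / Z: functions on it are 1-periodic functions on R.  A
   function on the closure of T x D is a total function of (x, y) : R * R of
   which only the values with y in [ydom_closed] matter. *)
Variant ydomain := Circle | UnitInterval.

Variant boundary_condition := Periodic | Dirichlet | Neumann.

Definition ydomain_of (bc : boundary_condition) : ydomain :=
  if bc is Periodic then Circle else UnitInterval.

Section domains.
Context {R : realType}.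
Implicit Types d : ydomain.

Definition ydom d : set R := if d is Circle then setT else `]0, 1[.

Definition ydom_closed d : set R := if d is Circle then setT else `[0, 1].

(* Each point of the closure of D is represented exactly once here. *)
Definition ydom_points d : set R :=
  if d is Circle then `[0, 1[ else `[0, 1].

Definition Omega d : set (R * R) := [set z | ydom d z.2].

Definition Omega_closed d : set (R * R) := [set z | ydom_closed d z.2].

Definition spacetime d : set (R * (R * R)) :=
  [set z | 0 < z.1 /\ Omega d z.2].

Definition spacetime_closed d : set (R * (R * R)) :=
  [set z | 0 < z.1 /\ Omega_closed d z.2].

(* Common fundamental domain, up to a null set, for T x T and T x (0, 1). *)
Definition cell : set (R * R) := `[0, 1] `*` `[0, 1].

End domains.

Section smoothness.
Context {R : realType} {V : normedModType R}.

Definition iter_derive (s : seq V) (f : V -> R) : V -> R :=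
  foldr (fun v g => 'D_v g) f s.

(* For U open with closure A (relative to t > 0 in space-time): f is smooth on
   U, and f and all its derivatives extend continuously from U to A, the
   extension of f itself being f. *)
Definition smooth_up_to (U A : set V) (f : V -> R) :=
  {within A, continuous f} /\
  forall s : seq V,
    (forall z, U z -> differentiable (iter_derive s f) z) /\
    exists2 g : V -> R, {within A, continuous g} &
      forall z, U z -> g z = iter_derive s f z.

Definition csmooth_up_to (U A : set V) (f : V -> R[i]) :=
  smooth_up_to U A (fun z => complex.Re (f z)) /\ smooth_up_to U A (fun z => complex.Im (f z)).

Definition cderive (v : V) (f : V -> R[i]) (z : V) : R[i] :=
  'D_v (fun w => complex.Re (f w)) z +i* 'D_v (fun w => complex.Im (f w)) z.

(* The value at z of the continuous extension of h from U to its closure. *)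
Definition extend_from (U : set V) (h : V -> R) (z : V) : R :=
  lim (h w @[w --> within U (nbhs z)]).

Definition cextend_from (U : set V) (h : V -> R[i]) (z : V) : R[i] :=
  extend_from U (fun w => complex.Re (h w)) z +i* extend_from U (fun w => complex.Im (h w)) z.

End smoothness.

Section shear_profile.
Context {R : realType}.
Variables (d : ydomain) (b : R -> R).

Definition smooth_profile :=
  smooth_up_to (ydom d) (ydom_closed d) b /\
  (d = Circle -> forall y, b (y + 1) = b y).

(* k-th derivative on the closure of D, end points included. *)
Definition profile_derive (k : nat) (y : R) : R :=
  extend_from (ydom d) (derive1n k b) y.

Definition critical_points (M : nat) (y : 'I_M -> R) (n : 'I_M -> nat) :=
  [/\ injective y,
      (forall i, ydom_points d (y i)),
      (forall z, ydom_points d z ->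
         (profile_derive 1 z = 0 <-> exists i, z = y i)) &
      (forall i,
         [/\ (1 <= n i)%N,
             (forall k, (1 <= k <= n i)%N -> profile_derive k (y i) = 0) &
             profile_derive (n i).+1 (y i) != 0])].

End shear_profile.

Section L2.
Context {R : realType}.
Implicit Types f g : R * R -> R[i].

Definition leb : {measure set (measurableTypeR R) -> \bar R} :=
  @lebesgue_measure R.

Definition normc (z : R[i]) : R := ComplexField.Normc.normc z.

Definition L2norm f : \bar R :=
  Lnorm (leb \x leb)%E 2%:E (fun z => (\1_cell z * normc (f z))%:E).

Definition in_L2 f :=
  [/\ measurable_fun (cell : set (measurableTypeR R * measurableTypeR R))
        (fun z => complex.Re (f z)),
      measurable_fun (cell : set (measurableTypeR R * measurableTypeR R))
        (fun z => complex.Im (f z)) &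
      (L2norm f < +oo)%E].

Definition integral_circle (h : R -> R[i]) : R[i] :=
  Rintegral leb `[0, 1] (fun x => complex.Re (h x)) +i*
  Rintegral leb `[0, 1] (fun x => complex.Im (h x)).

Definition expi (a : R) : R[i] := cos a +i* sin a.

Definition freq (n : int) : R := 2 * pi * n%:~R.

Definition fourier_coef f (n : int) (y : R) : R[i] :=
  integral_circle (fun x => f (x, y) * expi (- (freq n * x))).

(* g = m(|d/dx|) f, as elements of L^2. *)
Definition is_fourier_multiplier (m : R -> R) f g :=
  {ae leb, forall y, y \in `[0, 1] -> forall n : int,
     fourier_coef g n y = (m `|freq n|)%:C * fourier_coef f n y}.

End L2.

Section advection_diffusion.
Context {R : realType}.

Definition ex : R * R := (1, 0).

Definition ey : R * R := (0, 1).

Definition satisfies_bc (bc : boundary_condition) (g : R * R -> R[i]) :=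
  match bc with
  | Periodic => forall x y, g (x, y + 1) = g (x, y)
  | Dirichlet => forall x, g (x, 0) = 0 /\ g (x, 1) = 0
  | Neumann =>
      let dy_g := cextend_from (Omega UnitInterval) (cderive ey g) in
      forall x, dy_g (x, 0) = 0 /\ dy_g (x, 1) = 0
  end.

Definition xperiodic (d : ydomain) (g : R * R -> R[i]) :=
  forall x y, ydom_closed d y -> g (x + 1, y) = g (x, y).

Definition initial_datum (bc : boundary_condition) (fin : R * R -> R[i]) :=
  let d := ydomain_of bc in
  [/\ csmooth_up_to (Omega d) (Omega_closed d) fin,
      xperiodic d fin & satisfies_bc bc fin].

Record solution (bc : boundary_condition) (b : R -> R) (nu : R)
    (fin : R * R -> R[i]) (f : R -> R * R -> R[i]) : Prop := Solution {
  sol_in_L2 : forall t : R, 0 <= t -> in_L2 (f t) ;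
  sol_continuous : forall t0 : R, 0 <= t0 ->
    L2norm (fun z => f t z - f t0 z)
      @[t --> within `[0, +oo[ (nbhs t0)] --> 0%E ;
  sol_smooth : csmooth_up_to (spacetime (ydomain_of bc))
    (spacetime_closed (ydomain_of bc)) (fun z : R * (R * R) => f z.1 z.2) ;
  sol_xperiodic : forall t : R, 0 < t -> xperiodic (ydomain_of bc) (f t) ;
  sol_bc : forall t : R, 0 < t -> satisfies_bc bc (f t) ;
  sol_equation : forall (t : R) (z : R * R), 0 < t -> Omega (ydomain_of bc) z ->
    cderive (1 : R) (fun s => f s z) t + (b z.2)%:C * cderive ex (f t) z
      - nu%:C * cderive ey (cderive ey (f t)) z = 0 ;
  (* equality in L^2 *)
  sol_initial : L2norm (fun z => f 0 z - fin z) = 0%E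
}.

End advection_diffusion.

(* Main.v *)
(** Every Fourier mode [c = u + i v] at frequency [k] solves
    [c_t + i k b c = nu c_yy], so that its energy [E = |c|^2] satisfies
    [E' = - 2 nu D] with [D = |c_y|^2].  Choose [l] with [k l^(N+3) = nu] and cut
    [[0, 1]] into tiles of length about [l].  Since the critical points of [b]
    are of order at most [N], each tile contains a segment [[p, q]] of comparable
    length on which [|b'| >= c l^N].  Let [rho] increase from [0] to [2 pi] along
    [[p, q]] with [b], and test [e^(i k b t) c(s + t)] against the bump
    [b' (1 - cos rho)]: the result is constant in [t] up to a viscous error.  At
    [t = 0] it is a mean of [c]; at the time when the phases at [p] and [q] have
    separated by two full turns it vanishes on constants, because the bump has no
    second harmonic.  Thus on the tile [c] is controlled by [c_y] alone, and in
    sum the integral of [E] over times of order [l^2 / nu] is at most a constant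
    times the integral of [l^2 D].  Hence [E] decays at the rate
    [nu / l^2 = nu^((N+1)/(N+3)) k^(2/(N+3))].

    As [1 / p < 2 / (N + 3)] and [k >= 1] for nonzero modes, the multiplier is at
    most the exponential of a small fraction of this rate.  Interpolation with [D]
    makes the modes of the image pointwise summable, so the image is a continuous
    function, and its norm is bounded through Parseval and Bessel by the norm of
    the solution at any small positive time. *)

From HB Require Import structures.
From mathcomp Require Import all_boot all_order all_algebra.
From mathcomp Require Import complex ring lra.
From mathcomp Require Import all_classical all_reals all_analysis.
From mathcomp Require Import measurable_realfun.
Require Import Defs.
Set Implicit Arguments.
Unset Strict Implicit.
Unset Printing Implicit Defensive.
Import Order.TTheory GRing.Theory Num.Theory.
Import numFieldNormedType.Exports.
Local Open Scope classical_set_scope.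
Local Open Scope ring_scope.

(** * Calculus on segments *)

(** The scale [l] balances two times. Where |b'| is of order l^N, phases separate across a length l
    in time 1 / (k l^(N+1)), while diffusion acts in time l^2 / nu; k l^(N+3) = nu makes the two
    equal.

    In the variable [rho] the bump is 1 - cos, with harmonics 0, 1 and -1 only, so two turns is the
    first whole number of turns that misses them. It vanishes at both ends of its segment, so the
    viscous term is integrated by parts inside the tile without boundary terms; the boundary
    conditions in y enter only through the energy identity.

    The obstacle is regularity: the equation holds in the open strip for t > 0, derivatives merely
    extend continuously to the edges, and t = 0 is reached only in L^2. So functions are made
    continuous everywhere by clamping their arguments, derivatives are asked for only in the
    interior, and time is counted from a base time s > 0. The image is built once, from the base
    time t / 2; its norm is then compared, mode by mode, with base times tending to 0. *)

Lemma cts_cst {T V : topologicalType} (k : V) : continuous (fun _ : T => k).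
Proof. by move=> x; exact: cvg_cst. Qed.

Section continuity.
Context {R : realType} {T : topologicalType}.
Implicit Types f g : T -> R.

Lemma ctsD f g : continuous f -> continuous g -> continuous (fun x => f x + g x).
Proof. by move=> cf cg x; apply: cvgD; [exact: cf|exact: cg]. Qed.

Lemma ctsB f g : continuous f -> continuous g -> continuous (fun x => f x - g x).
Proof. by move=> cf cg x; apply: cvgB; [exact: cf|exact: cg]. Qed.

Lemma ctsN f : continuous f -> continuous (fun x => - f x).
Proof. by move=> cf x; apply: cvgN; exact: cf. Qed.

Lemma ctsM f g : continuous f -> continuous g -> continuous (fun x => f x * g x).
Proof. by move=> cf cg x; apply: cvgM; [exact: cf|exact: cg]. Qed.

Lemma cts_comp (h : R -> R) f :
  continuous h -> continuous f -> continuous (fun x => h (f x)).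
Proof. by move=> ch cf x; exact: (cvg_comp f h (cf x) (ch (f x))). Qed.

Lemma ctsX f n : continuous f -> continuous (fun x => f x ^+ n).
Proof. by move=> cf; apply: (@cts_comp (fun y => y ^+ n)) => //; exact: exprn_continuous. Qed.

Lemma cts_norm f : continuous f -> continuous (fun x => `|f x|).
Proof. by move=> cf; apply: (@cts_comp Num.norm) => //; exact: norm_continuous. Qed.

Lemma cts_cos f : continuous f -> continuous (fun x => cos (f x)).
Proof. by move=> cf; apply: cts_comp => //; exact: continuous_cos. Qed.

Lemma cts_sin f : continuous f -> continuous (fun x => sin (f x)).
Proof. by move=> cf; apply: cts_comp => //; exact: continuous_sin. Qed.

End continuity.

Section joint_continuity.
Context {R : realType}.

Definition continuous2 {V : topologicalType} (F : V -> R -> R) :=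
  continuous (fun z : V * R => F z.1 z.2).

Lemma cts_pair {T V : topologicalType} (F : V -> R -> R) (f : T -> V) (g : T -> R) :
  continuous2 F -> continuous f -> continuous g ->
  continuous (fun x => F (f x) (g x)).
Proof.
move=> cF cf cg x.
exact: (cvg_comp (fun x => (f x, g x)) (fun z => F z.1 z.2)
  (cvg_pair (cf x) (cg x)) (cF (f x, g x))).
Qed.

Definition continuous3 (F : R -> R -> R -> R) :=
  continuous (fun z : R * R * R => F z.1.1 z.1.2 z.2).

Lemma cts_triple {T : topologicalType} (F : R -> R -> R -> R) (f g h : T -> R) :
  continuous3 F -> continuous f -> continuous g -> continuous h ->
  continuous (fun x => F (f x) (g x) (h x)).
Proof.
move=> cF cf cg ch x.
exact: (cvg_comp (fun x => (f x, g x, h x)) (fun z => F z.1.1 z.1.2 z.2)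
  (cvg_pair (cvg_pair (cf x) (cg x)) (ch x)) (cF (f x, g x, h x))).
Qed.

Lemma cts_id {T : topologicalType} : continuous (fun x : T => x).
Proof. by move=> x; exact: cvg_id. Qed.

Lemma cts_fst {T V W : topologicalType} (f : T -> V * W) :
  continuous f -> continuous (fun x => (f x).1).
Proof. move=> cf x; exact: (cvg_comp f fst (cf x) (@cvg_fst _ _ _ _ _)). Qed.

Lemma cts_snd {T V W : topologicalType} (f : T -> V * W) :
  continuous f -> continuous (fun x => (f x).2).
Proof. move=> cf x; exact: (cvg_comp f snd (cf x) (@cvg_snd _ _ _ _ _)). Qed.

End joint_continuity.

(** Follows the syntax of the function; the leaves are closed by continuity hypotheses of the
    context, joint ones included. Hence the many [have] steps that only bring such a hypothesis into
    the context. *)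
Ltac cts :=
  lazymatch goal with
  | |- forall x, continuous_at x (fun x => x) => exact: cts_id
  | |- forall x, continuous_at x (fun _ => ?k) => exact: cts_cst
  | |- forall x, continuous_at x (fun x => @?f x + - @?g x) =>
      apply: (@ctsB _ _ f g); cts
  | |- forall x, continuous_at x (fun x => @?f x + @?g x) =>
      apply: (@ctsD _ _ f g); cts
  | |- forall x, continuous_at x (fun x => - @?f x) =>
      apply: (@ctsN _ _ f); cts
  | |- forall x, continuous_at x (fun x => @?f x * @?g x) =>
      apply: (@ctsM _ _ f g); cts
  | |- forall x, continuous_at x (fun x => @?f x ^+ ?n) =>
      apply: (@ctsX _ _ f n); cts
  | |- forall x, continuous_at x (fun x => cos (@?f x)) =>
      apply: (@cts_cos _ _ f); cts
  | |- forall x, continuous_at x (fun x => sin (@?f x)) =>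
      apply: (@cts_sin _ _ f); cts
  | |- forall x, continuous_at x (fun x => `|@?f x|) =>
      apply: (@cts_norm _ _ f); cts
  | |- forall x, continuous_at x (fun x => (@?f x).1) =>
      apply: (@cts_fst _ _ _ f); cts
  | |- forall x, continuous_at x (fun x => (@?f x).2) =>
      apply: (@cts_snd _ _ _ f); cts
  | |- _ => first
    [ match goal with
      | H : forall x, continuous_at x ?h |- forall x, continuous_at x ?h => exact: H
      | H : continuous2 ?F |- forall x, continuous_at x (?F ?t) =>
          apply: (cts_pair (f := fun=> t) (g := fun y => y) H); cts
      | H : continuous2 ?F |- forall x, continuous_at x (fun x => ?F (@?f x) (@?g x)) =>
          apply: (@cts_pair _ _ _ F f g H); cts
      | H : continuous3 ?F |-
          forall x, continuous_at x (?F ?t ?y) =>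
          apply: (cts_triple (f := fun=> t) (g := fun=> y) (h := fun x => x) H); cts
      | H : continuous3 ?F |-
          forall x, continuous_at x (fun x => ?F (@?f x) (@?g x) (@?h x)) =>
          apply: (@cts_triple _ _ F f g h H); cts
      | H : forall x, continuous_at x ?h |-
          forall x, continuous_at x (fun x => ?h (@?f x)) =>
          apply: (@cts_comp _ _ h f H); cts
      end
    | assumption | idtac ]
  end.

Section segment_integral.
Context {R : realType}.
Local Notation mu := (@lebesgue_measure R).
Implicit Types (f g F : R -> R) (a b c : R).

(** For [b < a] the segment is empty and the value is 0, not the opposite of the integral over
    [b, a]; this is why orderings are assumed below. *)
Definition itg a b f : R := \int[mu]_(x in `[a, b]) f x.

Lemma continuous_integrable f a b :
  continuous f -> mu.-integrable `[a, b] (EFin \o f).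
Proof.
move=> cf; apply: continuous_compact_integrable; first exact: segment_compact.
exact: continuous_subspaceT.
Qed.

Lemma continuous_integrable_oo f a b :
  continuous f -> mu.-integrable `]a, b[ (EFin \o f).
Proof.
move=> cf; apply: integrableS (continuous_integrable a b cf) => //.
exact: subset_itv_oo_cc.
Qed.

(** The end points are null, so integrands need to be compared only on the open segment, where
    derivatives are available. *)
Lemma itg_oo f a b : continuous f -> itg a b f = \int[mu]_(x in `]a, b[) f x.
Proof.
move=> cf; rewrite /itg -Rintegral_itv_bndo_bndc; last first.
  apply: integrableS (continuous_integrable a b cf) => //.
  exact: subset_itv_co_cc.
rewrite -Rintegral_itv_obnd_cbnd//; exact: continuous_integrable_oo.
Qed.

Lemma eq_itg f g a b : (forall x, a <= x <= b -> f x = g x) ->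
  itg a b f = itg a b g.
Proof.
move=> fg; apply: eq_Rintegral => x; rewrite inE/= in_itv/= => xab.
exact: fg.
Qed.

Lemma itgD f g a b : continuous f -> continuous g ->
  itg a b (fun x => f x + g x) = itg a b f + itg a b g.
Proof. by move=> cf cg; apply: RintegralD => //; exact: continuous_integrable. Qed.

Lemma itgB f g a b : continuous f -> continuous g ->
  itg a b (fun x => f x - g x) = itg a b f - itg a b g.
Proof. by move=> cf cg; apply: RintegralB => //; exact: continuous_integrable. Qed.

Lemma itgZ k f a b : continuous f -> itg a b (fun x => k * f x) = k * itg a b f.
Proof. by move=> cf; apply: RintegralZl => //; exact: continuous_integrable. Qed.

Lemma le_itg f g a b : continuous f -> continuous g ->
  (forall x, a < x < b -> f x <= g x) -> itg a b f <= itg a b g.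
Proof.
move=> cf cg fg; rewrite !itg_oo//; apply: le_Rintegral => //;
  exact: continuous_integrable_oo.
Qed.

Lemma itg_ge0 f a b : continuous f ->
  (forall x, a < x < b -> 0 <= f x) -> 0 <= itg a b f.
Proof.
move=> cf f0; rewrite itg_oo//; apply: Rintegral_ge0 => x.
by rewrite /= in_itv/=; exact: f0.
Qed.

Lemma le_norm_itg f a b : continuous f ->
  `|itg a b f| <= itg a b (fun x => `|f x|).
Proof. by move=> cf; apply: le_normr_Rintegral => //; exact: continuous_integrable. Qed.

Lemma itg_FTC_within F f a b : a <= b -> {within `[a, b], continuous F} ->
  continuous f ->
  (forall x, a < x < b -> is_derive x 1 F (f x)) -> itg a b f = F b - F a.
Proof.
rewrite le_eqVlt => /predU1P[<- _ _ _|ab cF cf dF].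
  by rewrite subrr /itg set_itv1 Rintegral_set1.
have [_ Fa Fb] := (continuous_within_itvP F ab).1 cF.
rewrite /itg /Rintegral (@continuous_FTC2 _ f F)//.
- exact: continuous_subspaceT.
- by split=> // x; rewrite in_itv/= => /dF[].
- move=> x; rewrite in_itv/= => /dF xF; rewrite derive1E; exact: derive_val.
Qed.

Lemma itg_FTC F f a b : a <= b -> continuous F -> continuous f ->
  (forall x, a < x < b -> is_derive x 1 F (f x)) -> itg a b f = F b - F a.
Proof. by move=> ab cF; apply: itg_FTC_within => //; exact: continuous_subspaceT. Qed.

Lemma itg_cst k a b : a <= b -> itg a b (fun=> k) = k * (b - a).
Proof.
move=> ab; rewrite mulrBr.
apply: (@itg_FTC (fun x => k * x)) => //.
- by cts.
- by cts.
- move=> x _; rewrite -[X in is_derive _ _ _ X](mulr1 k).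
  exact: (@is_deriveZ _ _ _ id k x 1 1 _).
Qed.

Lemma itg_cat f a b c : a <= b -> b <= c -> continuous f ->
  itg a c f = itg a b f + itg b c f.
Proof.
move=> ab bc cf; rewrite /itg.
have := @Rintegral_itvB R f (BLeft a) (BRight c) b (continuous_integrable a c cf) ab bc.
rewrite Rintegral_itv_obnd_cbnd; first by move=> <-; rewrite addrC subrK.
apply: integrableS (continuous_integrable b c cf) => //.
exact: subset_itv_oc_cc.
Qed.

Lemma sub_itg f a b c d : a <= c -> c <= d -> d <= b -> continuous f ->
  (forall x, 0 <= f x) -> itg c d f <= itg a b f.
Proof.
move=> ac cd db cf f0.
rewrite (itg_cat ac (le_trans cd db) cf) (itg_cat cd db cf) addrCA lerDl.
by rewrite addr_ge0// itg_ge0.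
Qed.

Lemma is_derive_itg f a x : continuous f -> a < x ->
  is_derive x 1 (fun z => itg a z f) (f x).
Proof.
move=> cf ax.
have [||dF F'] := @continuous_FTC1_closed R f a x (x + 1) _ _ ax (cf x).
- by rewrite ltrDl.
- exact: continuous_integrable.
- apply: DeriveDef; first exact: dF.
  by rewrite -F' derive1E.
Qed.

Lemma itg_shift f a b c : a <= b -> continuous f ->
  itg a b (fun x => f (x + c)) = itg (a + c) (b + c) f.
Proof.
move=> ab cf; pose F x := itg (a + c - 1) (x + c) f.
have dF x : a <= x -> is_derive x 1 F (f (x + c)).
  move=> ax; rewrite -[X in is_derive _ _ _ X]mulr1.
  apply: (@is_derive1_comp _ (fun z => itg (a + c - 1) z f) (fun x => x + c)).
    by apply: is_derive_itg => //; lra.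
  by apply: is_derive_shift.
have -> : itg a b (fun x => f (x + c)) = F b - F a.
  apply: itg_FTC_within => //.
  - apply: derivable_within_continuous => x; rewrite in_itv/= => /andP[ax _].
    by have [] := dF x ax.
  - by cts.
  - by move=> x /andP[/ltW ax _]; exact: dF.
rewrite /F (@itg_cat f (a + c - 1) (a + c) (b + c))//; last 2 first.
- by rewrite gerBl.
- by rewrite lerD2r.
by rewrite addrAC subrr add0r.
Qed.

(** Cauchy-Schwarz against the constant 1: expand the nonnegative integral of (f - m)^2, where [m]
    is the mean of [f]. *)
Lemma itg_sqr_le f a b : a <= b -> continuous f ->
  itg a b f ^+ 2 <= (b - a) * itg a b (fun x => f x ^+ 2).
Proof.
rewrite le_eqVlt => /predU1P[<- _|ab cf].
  by rewrite /itg set_itv1 !Rintegral_set1 expr0n mulr0.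
have cf2 : continuous (fun x => f x ^+ 2).
  by cts.
set I := itg a b f; pose m := I / (b - a).
have ba0 : b - a != 0 by rewrite subr_eq0 gt_eqF.
have : 0 <= itg a b (fun x => (f x ^+ 2 - 2 * m * f x) + m ^+ 2).
  apply: itg_ge0 => [|x _]; first by cts.
  by rewrite (_ : _ + _ = (f x - m) ^+ 2) ?sqr_ge0//; ring.
rewrite itgD; [|by cts|by cts].
rewrite itgB; [|by cts|by cts].
rewrite itgZ// (itg_cst _ (ltW ab)) -/I => H.
have : 0 <= (b - a) * (itg a b (fun x => f x ^+ 2) - 2 * m * I + m ^+ 2 * (b - a)).
  by rewrite mulr_ge0// subr_ge0 ltW.
have -> : (b - a) * (itg a b (fun x => f x ^+ 2) - 2 * m * I + m ^+ 2 * (b - a)) =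
          (b - a) * itg a b (fun x => f x ^+ 2) - I ^+ 2 by rewrite /m; field.
by rewrite subr_ge0.
Qed.

End segment_integral.

(** * Integrals depending on a parameter *)

Section parametric_integral.
Context {R : realType}.

Lemma cts_section {V : topologicalType} (F : V -> R -> R) t :
  continuous2 F -> continuous (F t).
Proof. move=> cF; exact: (cts_pair (f := fun=> t) (g := fun y => y) cF (@cts_cst _ _ t) (@cts_id _)). Qed.

Lemma cts_sectionl {V : topologicalType} (F : V -> R -> R) y :
  continuous2 F -> continuous (F ^~ y).
Proof. move=> cF; exact: (cts_pair (f := fun t => t) (g := fun=> y) cF (@cts_id _) (@cts_cst _ _ y)). Qed.

(** Tube lemma: compactness of the segment makes joint continuity uniform in the second variable. *)
Lemma near_uniform {V : topologicalType} (F : V -> R -> R) t0 (a b e : R) :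
  continuous2 F -> 0 < e ->
  \forall t \near t0, forall x, a <= x <= b -> `|F t x - F t0 x| < e.
Proof.
move=> cF e0.
have K := (@compact_near_coveringP _ `[a, b]).1 (@segment_compact R a b).
have {K} : \forall t \near t0, `[a, b] `<=` (fun x => `|F t x - F t0 x| < e).
  apply: (K V (nbhs t0) (fun t x => `|F t x - F t0 x| < e)) => x0 _.
  have e20 : 0 < e / 2 by rewrite divr_gt0.
  have /cvgrPdist_lt/(_ _ e20) /= [[A B] /= [At Bx] AB] := cF (t0, x0).
  have /cvgrPdist_lt/(_ _ e20) /= h := cts_section (t := t0) cF (x := x0).
  exists (B `&` [set x | `|F t0 x0 - F t0 x| < e / 2], A) => /=.
    by split => //; exact: filterI.
  move=> [x t] /= [[Bx' h'] At'].
  have := AB (t, x) (conj At' Bx').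
  rewrite /= distrC => h1; rewrite (splitr e).
  by apply: le_lt_trans (ltrD h1 h'); apply: ler_distD.
by apply: filterS => t + x xab; apply; rewrite /= in_itv.
Qed.

Lemma itg_empty (f : R -> R) (a b : R) : b < a -> itg a b f = 0.
Proof.
by move=> ba; rewrite /itg set_itv_ge ?Rintegral_set0//= bnd_simp -ltNge.
Qed.

Lemma cts_itg {V : topologicalType} (F : V -> R -> R) (a b : R) :
  continuous2 F -> continuous (fun t => itg a b (F t)).
Proof.
move=> cF; have [ab|ba] := leP a b; last first.
  rewrite (_ : (fun t => _) = fun=> 0); first exact: cts_cst.
  by apply/funext => t; exact: itg_empty.
move=> t0; apply/cvgrPdist_le => e e0 /=.
(* The [+ 1] keeps the tolerance meaningful when [a = b]. *)
have d0 : 0 < e / (b - a + 1) by rewrite divr_gt0// ltr_wpDl// subr_ge0.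
have cs t : continuous (F t) by exact: cts_section.
near=> t; rewrite -itgB//.
apply: le_trans (le_norm_itg _ _ _) _; first by cts.
apply: (@le_trans _ _ (itg a b (fun=> e / (b - a + 1)))).
  apply: le_itg => [||x /andP[/ltW ax /ltW xb]]; [|exact: cts_cst|].
    by have := cs t; have := cs t0 => ? ?; cts.
  rewrite distrC ltW//; have xab : a <= x <= b by rewrite ax.
  by move: x xab {ax xb}; near: t; exact: near_uniform.
rewrite itg_cst// mulrAC ler_pdivrMr ?ltr_wpDl ?subr_ge0//.
by rewrite ler_pM2l// lerDl.
Unshelve. all: by end_near. Qed.

(** By the mean value theorem in time, each difference quotient equals [F'] at an intermediate time,
    and [near_uniform] compares it with [F' t0] uniformly in y. The derivative is asked for only at
    interior y, where the equation holds. *)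
Lemma is_derive_itg_param (F F' : R -> R -> R) (a b t0 : R) :
  continuous2 F -> continuous2 F' ->
  (\forall t \near t0, forall y, a < y < b -> is_derive (t : R) 1 (F ^~ y) (F' t y)) ->
  is_derive t0 1 (fun t => itg a b (F t)) (itg a b (F' t0)).
Proof.
move=> cF cF' dF.
have [ab|ba] := leP a b; last first.
  rewrite (_ : (fun t => _) = fun=> 0).
    by rewrite itg_empty//; exact: is_derive_cst.
  by apply/funext => t; exact: itg_empty.
have cs t : continuous (F t) by exact: cts_section.
have cs' t : continuous (F' t) by exact: cts_section.
suff H : h^-1 *: (itg a b (F (h *: 1 + t0)) - itg a b (F t0)) @[h --> 0^']
    --> itg a b (F' t0).
  apply: DeriveDef; first by apply/cvg_ex; exists (itg a b (F' t0)).
  exact/cvg_lim.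
apply/cvgrPdist_le => e e0 /=.
have d0 : 0 < e / (b - a + 1) by rewrite divr_gt0// ltr_wpDl// subr_ge0.
have [r /= r0 hr] : \forall t \near t0,
    (forall y, a <= y <= b -> `|F' t y - F' t0 y| < e / (b - a + 1)) /\
    (forall y, a < y < b -> is_derive (t : R) 1 (F ^~ y) (F' t y)).
  by apply: filterS2 (near_uniform t0 a b cF' d0) dF => t ? ?; split.
near=> h.
have h0 : h != 0 by near: h; exact: nbhs_dnbhs_neq.
have hr' : `|h| < r.
  near: h; apply: nbhs_dnbhs; exists r => //= h /=.
  by rewrite sub0r normrN.
rewrite scaler1 -itgB// -[_ *: _]/(h^-1 * _) -itgZ; last first.
  by have := cs t0; have := cs (h + t0) => ? ?; cts.
have cq : continuous (fun x => h^-1 * (F (h + t0) x - F t0 x)).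
  by have := cs t0; have := cs (h + t0) => ? ?; cts.
rewrite -itgB//.
have c't := cs' t0.
apply: le_trans (le_norm_itg _ _ _) _; first by cts.
apply: (@le_trans _ _ (itg a b (fun=> e / (b - a + 1)))); last first.
  rewrite itg_cst// mulrAC ler_pdivrMr ?ltr_wpDl ?subr_ge0//.
  by rewrite ler_pM2l// lerDl.
apply: le_itg => [||y yab]; [by cts|exact: cts_cst|].
have yab' : a <= y <= b by case/andP: yab => /ltW -> /ltW ->.
suff [c ct0 ->] : exists2 c, `|t0 - c| < r &
    h^-1 * (F (h + t0) y - F t0 y) = F' c y.
  by rewrite distrC ltW//; have [H _] := hr c ct0; exact: H.
have cy : continuous (F ^~ y) by exact: cts_sectionl.
have D t : `|t0 - t| < r -> is_derive (t : R) 1 (F ^~ y) (F' t y).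
  by move=> tr; have [_] := hr t tr; exact.
case: (ltrgt0P h) hr' => [hp|hn|hz]; last by rewrite hz eqxx in h0.
- move=> hr'; have [|||c] := @MVT R (F ^~ y) (F' ^~ y) t0 (h + t0).
  + by rewrite ltrDr.
  + by move=> x; rewrite in_itv/= => /andP[x1 x2]; apply: D; rewrite ltr_norml; lra.
  + exact: continuous_subspaceT.
  rewrite in_itv/= => /andP[c1 c2] E; exists c; first by rewrite ltr_norml; lra.
  by rewrite E addrK mulrC mulfK.
- move=> hr'; have [|||c] := @MVT R (F ^~ y) (F' ^~ y) (h + t0) t0.
  + by rewrite gtrDr.
  + by move=> x; rewrite in_itv/= => /andP[x1 x2]; apply: D; rewrite ltr_norml; lra.
  + exact: continuous_subspaceT.
  rewrite in_itv/= => /andP[c1 c2] E; exists c; first by rewrite ltr_norml; lra.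
  by rewrite -opprB E; field.
Unshelve. all: by end_near. Qed.

End parametric_integral.

Section pointwise_derivatives.
Context {R : realType}.
Implicit Types (f g h : R -> R) (x a b k : R).

Lemma der_cst k x : is_derive x 1 (fun=> k) 0.
Proof. exact: is_derive_cst. Qed.

Lemma der_id x : is_derive x 1 (fun y => y) 1.
Proof. exact: is_derive_id. Qed.

Lemma derD f g x a b : is_derive x 1 f a -> is_derive x 1 g b ->
  is_derive x 1 (fun y => f y + g y) (a + b).
Proof. by move=> fa gb; apply: (@is_deriveD _ _ _ f g x 1 a b). Qed.

Lemma derB f g x a b : is_derive x 1 f a -> is_derive x 1 g b ->
  is_derive x 1 (fun y => f y - g y) (a - b).
Proof. by move=> fa gb; apply: (@is_deriveB _ _ _ f g x 1 a b). Qed.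

Lemma derN f x a : is_derive x 1 f a -> is_derive x 1 (fun y => - f y) (- a).
Proof. by move=> fa; apply: (@is_deriveN _ _ _ f x 1 a). Qed.

Lemma derM f g x a b : is_derive x 1 f a -> is_derive x 1 g b ->
  is_derive x 1 (fun y => f y * g y) (f x * b + g x * a).
Proof. by move=> fa gb; apply: (@is_deriveM _ _ f g x 1 a b). Qed.

Lemma der_comp h f x a b : is_derive (f x) 1 h b -> is_derive x 1 f a ->
  is_derive x 1 (fun y => h (f y)) (b * a).
Proof. by move=> hb fa; apply: (@is_derive1_comp _ h f x b a). Qed.

Lemma der_cos f x a : is_derive x 1 f a ->
  is_derive x 1 (fun y => cos (f y)) (- sin (f x) * a).
Proof. by move=> fa; apply: der_comp. Qed.

Lemma der_sin f x a : is_derive x 1 f a ->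
  is_derive x 1 (fun y => sin (f y)) (cos (f x) * a).
Proof. by move=> fa; apply: der_comp. Qed.

Lemma der_sqr f x a : is_derive x 1 f a ->
  is_derive x 1 (fun y => f y ^+ 2) (2 * f x * a).
Proof.
move=> fa; rewrite (_ : 2 * f x * a = f x * a + f x * a); last by ring.
exact: derM.
Qed.

Lemma der_eq f x a b : is_derive x 1 f a -> a = b -> is_derive x 1 f b.
Proof. by move=> ? <-. Qed.

Lemma itg_by_parts (f f' g g' : R -> R) a b : a <= b ->
  continuous f -> continuous g -> continuous f' -> continuous g' ->
  (forall x, a < x < b -> is_derive x 1 f (f' x)) ->
  (forall x, a < x < b -> is_derive x 1 g (g' x)) ->
  itg a b (fun x => f' x * g x) =
  f b * g b - f a * g a - itg a b (fun x => f x * g' x).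
Proof.
move=> ab cf cg cf' cg' df dg.
have <- : itg a b (fun x => f x * g' x + f' x * g x) = f b * g b - f a * g a.
  apply: (@itg_FTC _ (fun x => f x * g x)) => //; [by cts|by cts|].
  by move=> x xab; apply: der_eq (derM (df x xab) (dg x xab)) _; rewrite (mulrC (g x)).
by rewrite itgD; [rewrite addrAC subrr add0r|cts|cts].
Qed.

End pointwise_derivatives.

Ltac der := repeat first
  [ apply: der_cst | apply: der_id | eassumption
  | apply: derD | apply: derB | apply: derN | apply: derM
  | apply: der_cos | apply: der_sin | apply: der_sqr ].

Ltac derive :=
  first [(apply: der_eq; [by der|]) | apply: der_eq]; rewrite /GRing.scale/=.

(** * The bump function attached to a monotone phase *)

Section bump.
Context {R : realType}.
Variables (B B1 B2 : R -> R) (p q K : R).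
Hypotheses (pq : p < q) (cB : continuous B) (cB1 : continuous B1)
  (cB2 : continuous B2).
Hypothesis dB : forall y, p < y < q -> is_derive y 1 B (B1 y).
Hypothesis dB1 : forall y, p < y < q -> is_derive y 1 B1 (B2 y).
Hypothesis B1_gt0 : forall y, p <= y <= q -> 0 < B1 y.
Hypothesis B2_le : forall y, p <= y <= q -> `|B2 y| * (q - p) <= K * B1 y.

Let L := B q - B p.

Lemma bump_MVT : exists2 c, p < c < q & L = B1 c * (q - p).
Proof.
have D x : x \in `]p, q[ -> is_derive x 1 B (B1 x) by rewrite in_itv; exact: dB.
have [c] := @MVT R B B1 p q pq D (continuous_subspaceT cB).
by rewrite in_itv /L => ? ?; exists c.
Qed.

Lemma bump_L_gt0 : 0 < L.
Proof.
have [c /andP[pc cq] ->] := bump_MVT.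
by rewrite mulr_gt0 ?subr_gt0// B1_gt0// !ltW.
Qed.

(** The logarithm of [B1] has derivative B2 / B1, of size at most K / (q - p), so it varies by at
    most [K] over the segment. *)
Lemma bump_harnack y z : p <= y <= q -> p <= z <= q -> B1 y <= expR K * B1 z.
Proof.
move=> Hy Hz; have y0 := B1_gt0 Hy; have z0 := B1_gt0 Hz.
suff H : ln (B1 y) <= K + ln (B1 z).
  rewrite -[leLHS]lnK ?posrE// -[X in _ * X]lnK ?posrE// -expRD ler_expR.
  by rewrite addrC in H; rewrite addrC.
have D x : p < x < q -> is_derive x 1 (fun x => ln (B1 x)) ((B1 x)^-1 * B2 x).
  move=> xpq; have x0 : 0 < B1 x by case/andP: xpq => ? ?; rewrite B1_gt0// !ltW.
  by apply: der_comp; [exact: is_derive1_ln|exact: dB1].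
have bound a b : p <= a -> a < b -> b <= q ->
    `|ln (B1 b) - ln (B1 a)| <= K.
  move=> pa ab bq.
  have D' x : x \in `]a, b[ -> is_derive x 1 (fun x => ln (B1 x)) ((B1 x)^-1 * B2 x).
    by rewrite in_itv/= => /andP[? ?]; apply: D; rewrite (le_lt_trans pa)// (lt_le_trans _ bq).
  have C : {within `[a, b], continuous (fun x => ln (B1 x))}.
    apply: continuous_in_subspaceT => x; rewrite inE/= in_itv/= => /andP[ax xb].
    have B0 : 0 < B1 x by rewrite B1_gt0// (le_trans pa)//= (le_trans xb).
    exact: (@continuous_comp R R R B1 (@ln R) x (cB1 (x := x)) (continuous_ln B0)).
  have [c] := MVT ab D' C.
  rewrite in_itv/= => /andP[ac cb] ->.
  have Hc : p <= c <= q by rewrite (le_trans pa (ltW ac)) (le_trans (ltW cb) bq).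
  have c0 := B1_gt0 Hc.
  rewrite !normrM normfV (gtr0_norm c0) (gtr0_norm (_ : 0 < b - a)) ?subr_gt0//.
  rewrite -mulrA ler_pdivrMl// mulrC (mulrC _ K).
  apply: le_trans (B2_le Hc); rewrite mulrC ler_wpM2l//; lra.
have K0 : 0 <= K.
  by apply: le_trans (bound p q (lexx _) pq (lexx _)).
have [yz|zy|->] := ltgtP y z.
- by have := bound _ _ (proj1 (andP Hy)) yz (proj2 (andP Hz)); rewrite ler_norml; lra.
- by have := bound _ _ (proj1 (andP Hz)) zy (proj2 (andP Hy)); rewrite ler_norml; lra.
- by rewrite lerDr.
Qed.

Let M := expR K / (q - p).

Lemma bump_B1_le y : p <= y <= q -> B1 y / L <= M.
Proof.
move=> Hy; have L0 := bump_L_gt0; rewrite ler_pdivrMr//.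
have [c /andP[pc cq] ->] := bump_MVT.
have Hc : p <= c <= q by rewrite !ltW.
rewrite /M [leRHS](_ : _ = expR K * B1 c); first exact: bump_harnack.
by field; rewrite subr_eq0 gt_eqF.
Qed.

Let rho y := 2 * pi * ((B y - B p) / L).
(** [B1 / L] is the Jacobian of [rho / (2 pi)], so this is the probability density (1 - cos rho) /
    (2 pi) pulled back from the circle; it vanishes at [p] and [q]. *)
Definition bump y := B1 y / L * (1 - cos (rho y)).
Definition dbump y := B2 y / L * (1 - cos (rho y)) +
  B1 y / L * (sin (rho y) * (2 * pi * (B1 y / L))).

Lemma bump_cts : continuous bump.
Proof. by rewrite /bump /rho; cts. Qed.

Lemma dbump_cts : continuous dbump.
Proof. by rewrite /dbump /rho; cts. Qed.

Lemma drho y : p < y < q -> is_derive y 1 rho (2 * pi * (B1 y / L)).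
Proof.
move=> /dB yB; rewrite /rho; derive.
by rewrite /=; ring.
Qed.

Lemma is_derive_bump y : p < y < q -> is_derive y 1 bump (dbump y).
Proof.
move=> H; have h1 := dB1 H; have h2 := drho H.
rewrite /bump; derive.
by rewrite /dbump /=; ring.
Qed.

Lemma bump_ge0 y : p <= y <= q -> 0 <= bump y.
Proof.
by move=> H; rewrite mulr_ge0 ?divr_ge0 ?(ltW bump_L_gt0) ?(ltW (B1_gt0 H)) ?subr_ge0 ?cos_le1.
Qed.

Lemma bump_p : bump p = 0.
Proof. by rewrite /bump /rho subrr mul0r mulr0 cos0 subrr mulr0. Qed.

Lemma rho_q : rho q = 2 * pi.
Proof. by rewrite /rho -/L divff ?mulr1// gt_eqF// bump_L_gt0. Qed.

Lemma cos_2pi : cos (2 * pi) = 1 :> R.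
Proof. by rewrite mulr_natl cos2pi. Qed.

Lemma sin_2pi : sin (2 * pi) = 0 :> R.
Proof. by rewrite mulr_natl sin2pi. Qed.

Lemma bump_q : bump q = 0.
Proof. by rewrite /bump rho_q cos_2pi subrr mulr0. Qed.

Lemma itg_bump : itg p q bump = 1.
Proof.
have L0 : L != 0 by rewrite gt_eqF ?bump_L_gt0.
have pi0 : (pi : R) != 0 by rewrite gt_eqF ?pi_gt0.
have -> : itg p q bump =
    (rho q - sin (rho q)) / (2 * pi) - (rho p - sin (rho p)) / (2 * pi).
  apply: (@itg_FTC _ (fun y => (rho y - sin (rho y)) / (2 * pi))).
  - exact: ltW.
  - by rewrite /rho; cts.
  - exact: bump_cts.
  - move=> y /drho h; derive.
    rewrite /bump; move: (cos _) => c; move: pi0; move: (pi : R) => P P0.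
    by field; rewrite L0 P0.
rewrite rho_q sin_2pi /rho subrr mul0r mulr0 sin0 subrr mul0r !subr0 divff//.
by rewrite mulf_neq0// pnatr_eq0.
Qed.

(* The profile [1 - cos rho] has no Fourier component of order 2. *)
Lemma itg_cos_bump : itg p q (fun y => cos (B y * (4 * pi / L)) * bump y) = 0.
Proof.
have L0 : L != 0 by rewrite gt_eqF ?bump_L_gt0.
have pi0 : (pi : R) != 0 by rewrite gt_eqF ?pi_gt0.
pose al y := B y * (4 * pi / L).
(* [al] moves twice as fast as [rho], so [al + rho] and [al - rho] move at three times and once its
   speed; with the 1/2 of the product formula this gives the denominators 2, 6, 2. *)
pose S y := (sin (al y) / 2 - sin (al y + rho y) / 6 - sin (al y - rho y) / 2)
            / (2 * pi).
(* Over the segment [al] gains exactly two turns, so the primitive takes the same value at both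
   ends. *)
have E : al q = al p + 2 * pi + 2 * pi.
  have Bq : B q = L + B p by rewrite subrK.
  by rewrite /al Bq; move: (pi : R) L0; move: (L : R) => l P l0; field.
have -> : itg p q (fun y => cos (B y * (4 * pi / L)) * bump y) = S q - S p.
  apply: itg_FTC.
  - exact: ltW.
  - by rewrite /S /al /rho; cts.
  - by have := bump_cts => ?; cts.
  - move=> y yI; have h := drho yI; have hB := dB yI.
    rewrite /S /al; derive.
    rewrite /bump -/(al y) cosD cosB; move: (cos (rho y)) (sin (rho y)) => c d.
    move: (cos _) (sin _) => c' d'; move: pi0; move: (pi : R) => P P0.
    by field; rewrite L0 P0.
rewrite /S rho_q E; set a := al p; rewrite /rho subrr mul0r mulr0.
rewrite addr0 subr0 !(sinD, cosD) sinN cosN cos_2pi sin_2pi.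
move: pi0; move: (pi : R) => P P0; move: (cos a) (sin a) => c d.
by field; rewrite P0.
Qed.

Lemma itg_sin_bump : itg p q (fun y => sin (B y * (4 * pi / L)) * bump y) = 0.
Proof.
have L0 : L != 0 by rewrite gt_eqF ?bump_L_gt0.
have pi0 : (pi : R) != 0 by rewrite gt_eqF ?pi_gt0.
pose al y := B y * (4 * pi / L).
pose S y := (cos (al y + rho y) / 6 + cos (al y - rho y) / 2 - cos (al y) / 2)
            / (2 * pi).
have E : al q = al p + 2 * pi + 2 * pi.
  have Bq : B q = L + B p by rewrite subrK.
  by rewrite /al Bq; move: (pi : R) L0; move: (L : R) => l P l0; field.
have -> : itg p q (fun y => sin (B y * (4 * pi / L)) * bump y) = S q - S p.
  apply: itg_FTC.
  - exact: ltW.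
  - by rewrite /S /al /rho; cts.
  - by have := bump_cts => ?; cts.
  - move=> y yI; have h := drho yI; have hB := dB yI.
    rewrite /S /al; derive.
    rewrite /bump -/(al y) sinD sinB; move: (cos (rho y)) (sin (rho y)) => c d.
    move: (cos _) (sin _) => c' d'; move: pi0; move: (pi : R) => P P0.
    by field; rewrite L0 P0.
rewrite /S rho_q E; set a := al p; rewrite /rho subrr mul0r mulr0.
rewrite addr0 subr0 !(sinD, cosD) sinN cosN cos_2pi sin_2pi.
move: pi0; move: (pi : R) => P P0; move: (cos a) (sin a) => c d.
by field; rewrite P0.
Qed.

Lemma bump_le y : p <= y <= q -> bump y <= 2 * M.
Proof.
move=> H; have h := bump_B1_le H.
have h0 : 0 <= B1 y / L by rewrite divr_ge0 ?(ltW bump_L_gt0) ?(ltW (B1_gt0 H)).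
rewrite /bump (mulrC 2); apply: ler_pM => //.
by have := cos_geN1 (rho y); lra.
Qed.

Lemma norm_dbump_le y : p <= y <= q ->
  `|dbump y| <= 2 * K * M / (q - p) + 2 * pi * M ^+ 2.
Proof.
move=> H; have h := bump_B1_le H; have L0 := bump_L_gt0.
have qp0 : 0 < q - p by rewrite subr_gt0.
have h0 : 0 <= B1 y / L by rewrite divr_ge0 ?(ltW L0) ?(ltW (B1_gt0 H)).
have K0 : 0 <= K.
  have := le_trans (mulr_ge0 (normr_ge0 _) (ltW qp0)) (B2_le H).
  by rewrite pmulr_lge0// B1_gt0.
have h2 : `|B2 y / L| <= K * M / (q - p).
  rewrite normrM normfV (gtr0_norm L0) ler_pdivlMr// mulrAC.
  apply: (@le_trans _ _ (K * (B1 y / L))); last by rewrite ler_wpM2l.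
  by rewrite mulrA ler_wpM2r ?invr_ge0 ?(ltW L0)// B2_le.
apply: le_trans (ler_normD _ _) _; apply: lerD.
  rewrite normrM (_ : 2 * K * M / (q - p) = K * M / (q - p) * 2); last by ring.
  apply: ler_pM => //; rewrite ger0_norm ?subr_ge0 ?cos_le1//.
  by have := cos_geN1 (rho y); lra.
have pi0 := @pi_ge0 R.
have h3 : 0 <= 2 * pi * (B1 y / L).
  by apply: mulr_ge0 => //; apply: mulr_ge0.
rewrite normrM (ger0_norm h0) normrM (ger0_norm h3).
have -> : 2 * pi * M ^+ 2 = M * (1 * (2 * pi * M)) by ring.
apply: ler_pM => //; first by apply: mulr_ge0.
apply: ler_pM => //; first exact: sin_max.
by apply: ler_wpM2l => //; apply: mulr_ge0.
Qed.

(** With M = e^K / (q - p) bounding [B1 / L]: 8 pi M^2 from the derivative of the phase, and 2 K M /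
    (q - p) + 2 pi M^2 from the derivative of the bump. *)
Definition twist_bound : R := (10 * pi * expR K ^+ 2 + 2 * K * expR K) / (q - p) ^+ 2.

(** Bounds the y-derivative of cos (B s) or sin (B s) times the bump, up to the time [4 pi / L] of
    two full turns; [w] and [z] stand for the signed sine and cosine. *)
Lemma twisted_bump_le (s : R) (w z : R) y : p <= y <= q -> 0 <= s <= 4 * pi / L ->
  `|w| <= 1 -> `|z| <= 1 ->
  `|w * (B1 y * s) * bump y + z * dbump y| <= twist_bound.
Proof.
move=> H /andP[s0 sT] w1 z1; have L0 := bump_L_gt0.
have qp0 : 0 < q - p by rewrite subr_gt0.
have pi0 := @pi_ge0 R.
apply: le_trans (ler_normD _ _) _.
have -> : twist_bound = (M * (4 * pi)) * (2 * M) + 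
    1 * (2 * K * M / (q - p) + 2 * pi * M ^+ 2).
  by rewrite /twist_bound /M; field; rewrite gt_eqF.
apply: lerD; rewrite normrM; last first.
  by apply: ler_pM => //; exact: norm_dbump_le.
apply: ler_pM => //; last by rewrite ger0_norm ?bump_ge0// bump_le.
rewrite normrM -[leRHS]mul1r; apply: ler_pM => //.
rewrite normrM (ger0_norm s0) (gtr0_norm (B1_gt0 H)).
apply: (@le_trans _ _ (B1 y * (4 * pi / L))).
  by rewrite ler_wpM2l// ltW// B1_gt0.
rewrite mulrA mulrAC ler_wpM2r ?bump_B1_le// mulr_ge0//.
Qed.

End bump.

(** * Decay of a single Fourier mode *)

Lemma near_pos {R : realType} (t : R) : 0 < t -> \forall x \near t, 0 < x.
Proof. by move=> t0; exists t => //= x /=; rewrite ltr_norml => /andP[_]; lra. Qed.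

(* Real and imaginary parts of a solution of [c_t + i B c = nu c_yy]. *)
Record heat_pair {R : realType} (nu : R) (B : R -> R)
    (u uy uyy v vy vyy : R -> R -> R) : Prop := HeatPair {
  hp_cu : continuous2 u ;
  hp_cuy : continuous2 uy ;
  hp_cuyy : continuous2 uyy ;
  hp_cv : continuous2 v ;
  hp_cvy : continuous2 vy ;
  hp_cvyy : continuous2 vyy ;
  hp_uy : forall t y : R, 0 < t -> 0 < y < 1 -> is_derive y 1 (u t) (uy t y) ;
  hp_uyy : forall t y : R, 0 < t -> 0 < y < 1 -> is_derive y 1 (uy t) (uyy t y) ;
  hp_vy : forall t y : R, 0 < t -> 0 < y < 1 -> is_derive y 1 (v t) (vy t y) ;
  hp_vyy : forall t y : R, 0 < t -> 0 < y < 1 -> is_derive y 1 (vy t) (vyy t y) ;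
  hp_ut : forall t y : R, 0 < t -> 0 < y < 1 ->
    is_derive t 1 (u ^~ y) (nu * uyy t y + B y * v t y) ;
  hp_vt : forall t y : R, 0 < t -> 0 < y < 1 ->
    is_derive t 1 (v ^~ y) (nu * vyy t y - B y * u t y) }.

Section heat_pair_symmetries.
Context {R : realType}.
Variables (nu : R) (B : R -> R) (u uy uyy v vy vyy : R -> R -> R).
Hypothesis H : heat_pair nu B u uy uyy v vy vyy.

(** Multiplication of u + i v by -i: an estimate for the first component alone thus also covers the
    second. *)
Lemma heat_pair_rotate : heat_pair nu B v vy vyy
  (fun t y => - u t y) (fun t y => - uy t y) (fun t y => - uyy t y).
Proof.
case: H => c1 c2 c3 c4 c5 c6 h1 h2 h3 h4 h5 h6; split => //.
- by rewrite /continuous2; cts.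
- by rewrite /continuous2; cts.
- by rewrite /continuous2; cts.
- by move=> t y t0 y0; apply: derN; exact: h1.
- by move=> t y t0 y0; apply: derN; exact: h2.
- by move=> t y t0 y0; apply: der_eq (h6 t y t0 y0) _; rewrite mulrN.
- by move=> t y t0 y0; apply: der_eq (derN (h5 t y t0 y0)) _; rewrite opprD mulrN.
Qed.

(** Complex conjugation. It reverses the sign of [B], which reduces decreasing phases to increasing
    ones and negative frequencies to positive ones. *)
Lemma heat_pair_reflect : heat_pair nu (fun y => - B y) u uy uyy
  (fun t y => - v t y) (fun t y => - vy t y) (fun t y => - vyy t y).
Proof.
case: H => c1 c2 c3 c4 c5 c6 h1 h2 h3 h4 h5 h6; split => //.
- by rewrite /continuous2; cts.
- by rewrite /continuous2; cts.
- by rewrite /continuous2; cts.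
- by move=> t y t0 y0; apply: derN; exact: h3.
- by move=> t y t0 y0; apply: derN; exact: h4.
- by move=> t y t0 y0; apply: der_eq (h5 t y t0 y0) _; rewrite mulrNN.
- by move=> t y t0 y0; apply: der_eq (derN (h6 t y t0 y0)) _; ring.
Qed.

End heat_pair_symmetries.

(** * Control of a mode by its derivative on one tile *)

Section tile.
Context {R : realType}.
Variables (nu : R) (B B1 B2 : R -> R) (u uy uyy v vy vyy : R -> R -> R).
Hypotheses (nu_gt0 : 0 < nu) (H : heat_pair nu B u uy uyy v vy vyy).
Variables (p q K P Q : R).
Hypotheses (pq : p < q) (cB : continuous B) (cB1 : continuous B1)
  (cB2 : continuous B2).
Hypothesis dB : forall y, p < y < q -> is_derive y 1 B (B1 y).
Hypothesis dB1 : forall y, p < y < q -> is_derive y 1 B1 (B2 y).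
Hypothesis B1_gt0 : forall y, p <= y <= q -> 0 < B1 y.
Hypothesis B2_le : forall y, p <= y <= q -> `|B2 y| * (q - p) <= K * B1 y.
Hypotheses (P0 : 0 <= P) (Pp : P <= p) (qQ : q <= Q) (Q1 : Q <= 1).

(** At time [T] the phases [B t] at [q] and [p] differ by two turns. [G], defined below, bounds the
    oscillation of [u] and of [v] over the tile [P, Q]. *)
Let T := 4 * pi / (B q - B p).
Let phi := bump B B1 p q.
Let dphi := dbump B B1 B2 p q.
Let G t := itg P Q (fun y => `|uy t y| + `|vy t y|).

Let cu := hp_cu H.
Let cuy := hp_cuy H.
Let cuyy := hp_cuyy H.
Let cv := hp_cv H.
Let cvy := hp_cvy H.
Let cvyy := hp_cvyy H.

Lemma tile_T_gt0 : 0 < T.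
Proof. by rewrite divr_gt0 ?(bump_L_gt0 pq cB dB B1_gt0)// mulr_gt0 ?pi_gt0. Qed.

Lemma tile_G_cts : continuous G.
Proof. by apply: cts_itg; rewrite /continuous2; cts. Qed.

Lemma osc_le (g g' : R -> R) (y z : R) : continuous g -> continuous g' ->
  (forall x : R, 0 < x < 1 -> is_derive x 1 g (g' x)) ->
  P <= y <= Q -> P <= z <= Q -> `|g y - g z| <= itg P Q (fun x => `|g' x|).
Proof.
move=> cg cg' dg.
wlog yz : y z / z <= y.
  move=> W Hy Hz; have [yz|/ltW zy] := leP z y; first exact: W.
  by rewrite distrC; exact: W.
move=> /andP[y1 y2] /andP[z1 z2].
have <- : itg z y g' = g y - g z.
  apply: itg_FTC => // x /andP[x1 x2]; apply: dg.
  by rewrite (le_lt_trans _ x1) ?(lt_le_trans x2)// (le_trans _ z1, le_trans y2).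
apply: le_trans (le_norm_itg _ _ cg') _.
by apply: sub_itg => //; cts.
Qed.

(** With a(t) the real part of the integral of e^(i B (t - s)) c(t) against the bump, u(s, y) splits
    into u(s, y) - a(s), a(s + T) and the increment of [a]: the first two are oscillations of c over
    the tile, the third is purely viscous. *)
Lemma tile_pointwise (s y : R) : 0 < s -> P <= y <= Q ->
  `|u s y| <= G s + G (s + T) +
              nu * twist_bound p q K * itg s (s + T) G.
Proof.
move=> s0 yPQ.
have cphi : continuous phi by exact: bump_cts.
have cdphi : continuous dphi by exact: dbump_cts.
have phi0 z : p <= z <= q -> 0 <= phi z by exact: bump_ge0.
have sub z : p <= z <= q -> P <= z <= Q.
  by move=> /andP[z1 z2]; rewrite (le_trans Pp)//= (le_trans z2).
have sub' z : p < z < q -> 0 < z < 1.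
  by move=> /andP[z1 z2]; rewrite (le_lt_trans (le_trans P0 Pp) z1) (lt_le_trans z2 (le_trans qQ Q1)).
have T0 := tile_T_gt0.
have cG := tile_G_cts.
pose w1 (t z : R) : R := cos (B z * (t - s)) * phi z.
pose w2 (t z : R) : R := sin (B z * (t - s)) * phi z.
pose w1' (t z : R) : R := - sin (B z * (t - s)) * (B1 z * (t - s)) * phi z
                + cos (B z * (t - s)) * dphi z.
pose w2' (t z : R) : R := cos (B z * (t - s)) * (B1 z * (t - s)) * phi z
                + sin (B z * (t - s)) * dphi z.
have cw1 : continuous2 w1 by rewrite /continuous2 /w1; cts.
have cw2 : continuous2 w2 by rewrite /continuous2 /w2; cts.
have cw1' : continuous2 w1' by rewrite /continuous2 /w1'; cts.
have cw2' : continuous2 w2' by rewrite /continuous2 /w2'; cts.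
pose a (t : R) : R := itg p q (fun z => u t z * w1 t z - v t z * w2 t z).
(* The twist undoes the transport: the terms in [B] cancel in the derivative of [a], leaving only
   those in [nu]. *)
pose a' (t : R) : R := itg p q (fun z => nu * (uyy t z * w1 t z - vyy t z * w2 t z)).
have ca : continuous a by apply: cts_itg; rewrite /continuous2; cts.
have ca' : continuous a' by apply: cts_itg; rewrite /continuous2; cts.
have da (t : R) : 0 < t -> is_derive t 1 a (a' t).
  move=> t0; apply: (@is_derive_itg_param R
    (fun t z => u t z * w1 t z - v t z * w2 t z)
    (fun t z => nu * (uyy t z * w1 t z - vyy t z * w2 t z))).
  - by rewrite /continuous2; cts.
  - by rewrite /continuous2; cts.
  - near=> t1; have t10 : 0 < t1 by near: t1; exact: near_pos.
    move=> z /sub' zI.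
    have h1 := hp_ut H t10 zI; have h2 := hp_vt H t10 zI.
    rewrite /w1 /w2; derive; first by ring.
have a'_le (t : R) : s <= t <= s + T -> `|a' t| <= nu * twist_bound p q K * G t.
  move=> /andP[t1 t2]; have t0 : 0 < t by apply: lt_le_trans t1.
  have ibp (g g' w w' : R -> R) : continuous g -> continuous g' ->
      continuous w -> continuous w' ->
      (forall x : R, p < x < q -> is_derive x 1 g (g' x)) ->
      (forall x : R, p < x < q -> is_derive x 1 w (w' x)) ->
      w p = 0 -> w q = 0 ->
      itg p q (fun x => g' x * w x) = - itg p q (fun x => g x * w' x).
    move=> cg cg' cw cw' dg dw wp wq; rewrite (@itg_by_parts _ g _ _ w')//.
      by rewrite wp wq !mulr0 subrr sub0r.
    exact: ltW.
  (* One integration by parts, without boundary terms because the bump vanishes at [p] and [q]; only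
     first derivatives of u and v remain. *)
  have E : a' t = - nu * itg p q (fun z => uy t z * w1' t z - vy t z * w2' t z).
    rewrite /a' itgZ; last by cts.
    rewrite !itgB; [|by cts|by cts|by cts|by cts].
    have -> : itg p q (fun z => uyy t z * w1 t z) = - itg p q (fun z => uy t z * w1' t z).
    apply: (ibp (uy t) (uyy t) (w1 t) (w1' t)).
    - by cts.
    - by cts.
    - by cts.
    - by cts.
    - by move=> z /sub' zI; exact: (hp_uyy H).
    - move=> z zI; have h1 := dB zI; have h2 := is_derive_bump dB dB1 zI.
      by rewrite /w1; derive; rewrite /w1' /dphi /phi; ring.
    - by rewrite /w1 /phi bump_p mulr0.
    - by rewrite /w1 /phi (bump_q pq cB dB B1_gt0)// mulr0.
    have -> : itg p q (fun z => vyy t z * w2 t z) = - itg p q (fun z => vy t z * w2' t z).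
    apply: (ibp (vy t) (vyy t) (w2 t) (w2' t)).
    - by cts.
    - by cts.
    - by cts.
    - by cts.
    - by move=> z /sub' zI; exact: (hp_vyy H).
    - move=> z zI; have h1 := dB zI; have h2 := is_derive_bump dB dB1 zI.
      by rewrite /w2; derive; rewrite /w2' /dphi /phi; ring.
    - by rewrite /w2 /phi bump_p mulr0.
    - by rewrite /w2 /phi (bump_q pq cB dB B1_gt0)// mulr0.
    by ring.
  rewrite E normrM normrN (gtr0_norm nu_gt0) -mulrA ler_pM2l//.
  apply: le_trans (le_norm_itg _ _ _) _; first by cts.
  have tI : 0 <= t - s <= T by lra.
  apply: (@le_trans _ _ (itg p q (fun z => twist_bound p q K * (`|uy t z| + `|vy t z|)))).
    apply: le_itg; [by cts|by cts|move=> z /andP[/ltW z1 /ltW z2]].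
    have zI : p <= z <= q by rewrite z1.
    apply: le_trans (ler_normB _ _) _; rewrite [leRHS]mulrDr; apply: lerD.
      rewrite normrM mulrC ler_wpM2r// /w1' /phi /dphi.
      by apply: (twisted_bump_le pq cB cB1 dB dB1) => //; rewrite ?normrN ?sin_max ?cos_max.
    rewrite normrM mulrC ler_wpM2r// /w1' /phi /dphi.
    by apply: (twisted_bump_le pq cB cB1 dB dB1) => //; rewrite ?normrN ?sin_max ?cos_max.
  have tb0 : 0 <= twist_bound p q K.
    have pI : p <= p <= q by rewrite lexx ltW.
    have := twisted_bump_le pq cB cB1 dB dB1 B1_gt0 B2_le pI tI
              (sin_max 0) (cos_max 0).
    by apply: le_trans; exact: normr_ge0.
  rewrite itgZ; last by cts.
  rewrite ler_wpM2l//; apply: sub_itg => //; first exact: ltW.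
  by cts.
have aT : `|a (s + T)| <= G (s + T).
  have sT0 : 0 < s + T by rewrite addr_gt0.
  have pI : p <= p <= q by rewrite lexx ltW.
  (* After two turns both weights have integral 0, so the values at [p] can be subtracted and only
     oscillation is left. *)
  have -> : a (s + T) = itg p q (fun z => (u (s + T) z - u (s + T) p) * w1 (s + T) z
                              - (v (s + T) z - v (s + T) p) * w2 (s + T) z).
    have z1 : itg p q (w1 (s + T)) = 0.
      rewrite -(itg_cos_bump pq cB cB1 dB B1_gt0); apply: eq_itg => z _.
      by rewrite /w1 addrAC subrr add0r.
    have z2 : itg p q (w2 (s + T)) = 0.
      rewrite -(itg_sin_bump pq cB cB1 dB B1_gt0); apply: eq_itg => z _.
      by rewrite /w2 addrAC subrr add0r.
    transitivity (a (s + T) - (u (s + T) p * itg p q (w1 (s + T)) -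
                                v (s + T) p * itg p q (w2 (s + T)))).
      by rewrite z1 z2 !mulr0 !subr0.
    rewrite -!itgZ; [|by cts|by cts].
    rewrite /a -!itgB; [|by cts|by cts|by cts|by cts].
    by apply: eq_itg => z _; ring.
  apply: le_trans (le_norm_itg _ _ _) _; first by cts.
  rewrite -[leRHS]mulr1 -(itg_bump pq cB cB1 dB B1_gt0) -itgZ//.
  apply: le_itg; [by cts|by cts|move=> z /andP[/ltW z1 /ltW z2]].
  have zI : p <= z <= q by rewrite z1.
  apply: le_trans (ler_normB _ _) _; rewrite /G itgD; [|by cts|by cts].
  rewrite [leRHS]mulrDl; apply: lerD; rewrite normrM; apply: ler_pM => //.
  - by apply: osc_le; [by cts|by cts| |exact: sub|exact: sub] => x; exact: (hp_uy H).
  - rewrite normrM (ger0_norm (phi0 _ zI)) -[leRHS]mul1r ler_wpM2r ?phi0//.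
    exact: cos_max.
  - by apply: osc_le; [by cts|by cts| |exact: sub|exact: sub] => x; exact: (hp_vy H).
  - rewrite normrM (ger0_norm (phi0 _ zI)) -[leRHS]mul1r ler_wpM2r ?phi0//.
    exact: sin_max.
have as_ : `|u s y - a s| <= G s.
  have -> : a s = itg p q (fun z => u s z * phi z).
    by apply: eq_itg => z _; rewrite /w1 /w2 subrr mulr0 cos0 sin0; ring.
  rewrite -[X in `|X - _|]mulr1 -(itg_bump pq cB cB1 dB B1_gt0) -itgZ// -itgB; [|by cts|by cts].
  apply: le_trans (le_norm_itg _ _ _) _; first by cts.
  rewrite -[leRHS]mulr1 -(itg_bump pq cB cB1 dB B1_gt0) -itgZ//.
  apply: le_itg; [by cts|by cts|move=> z /andP[/ltW z1 /ltW z2]].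
  have zI : p <= z <= q by rewrite z1.
  rewrite -/phi -mulrBl normrM (ger0_norm (phi0 _ zI)) ler_wpM2r ?phi0//.
  apply: (@le_trans _ _ (itg P Q (fun x => `|uy s x|))).
    by apply: osc_le; [by cts|by cts| |by []|exact: sub] => x; exact: (hp_uy H).
  apply: le_itg; [by cts|by cts|by move=> x _; rewrite lerDl].
have das : `|a (s + T) - a s| <= nu * twist_bound p q K * itg s (s + T) G.
  have <- : itg s (s + T) a' = a (s + T) - a s.
    apply: itg_FTC => //; first by rewrite lerDl ltW.
    by move=> t /andP[t1 _]; apply: da; exact: lt_trans t1.
  apply: le_trans (le_norm_itg _ _ _) _ => //.
  rewrite -itgZ//; apply: le_itg; [by cts|by cts|move=> t /andP[/ltW t1 /ltW t2]].
  by apply: a'_le; rewrite t1.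
rewrite (_ : u s y = (u s y - a s) + (a (s + T) - (a (s + T) - a s))); last by ring.
apply: le_trans (ler_normD _ _) _; rewrite -addrA; apply: lerD => //.
by apply: le_trans (ler_normB _ _) _; apply: lerD.
Unshelve. all: by end_near. Qed.

(** The 2 counts the windows of [D s] and [D (s + T)]; the square is the viscous error integrated
    over a window of length [Tm]. *)
Definition Tm_factor (Tm : R) : R := 2 + (nu * twist_bound p q K * Tm) ^+ 2.

Let D (t : R) := itg P Q (fun y => uy t y ^+ 2 + vy t y ^+ 2).

Lemma tile_D_cts : continuous D.
Proof. by apply: cts_itg; rewrite /continuous2; cts. Qed.

Lemma tile_D_ge0 t : 0 <= D t.
Proof. by apply: itg_ge0 => [|y _]; [cts|rewrite addr_ge0 ?sqr_ge0]. Qed.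

Lemma tile_G_sqr_le t : G t ^+ 2 <= 2 * (Q - P) * D t.
Proof.
have PQ : P <= Q by rewrite (le_trans Pp)// (le_trans _ qQ)// ltW.
apply: le_trans (itg_sqr_le PQ _) _; first by cts.
rewrite [2 * _]mulrC -mulrA ler_wpM2l ?subr_ge0// /D -itgZ; last by cts.
apply: le_itg; [by cts|by cts|move=> y _].
rewrite -(real_normK (num_real (uy t y))) -(real_normK (num_real (vy t y))).
by have := sqr_ge0 (`|uy t y| - `|vy t y|); lra.
Qed.

(** The time [T] depends on the tile; a common bound [Tm] lets all tiles share the same windows, of
    length [2 Tm] on the right because s + T may reach that far. The 6 is 3, for the square of a sum
    of three terms, times the 2 of [tile_G_sqr_le]. *)
Lemma tile_int (s0 Tm : R) : 0 <= s0 -> T <= Tm ->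
  itg s0 (s0 + Tm) (fun s => itg P Q (fun y => u s y ^+ 2)) <=
  6 * (Q - P) ^+ 2 * Tm_factor Tm * itg s0 (s0 + 2 * Tm) D.
Proof.
move=> s00 TTm.
have PQ : P <= Q by rewrite (le_trans Pp)// (le_trans _ qQ)// ltW.
have h0 : 0 <= Q - P by rewrite subr_ge0.
have T0 := tile_T_gt0; have Tm0 : 0 < Tm by exact: lt_le_trans TTm.
have cG := tile_G_cts; have cD := tile_D_cts.
have D0 := tile_D_ge0.
set W := itg s0 (s0 + 2 * Tm) D.
set al := nu * twist_bound p q K.
have cE : continuous (fun s => itg P Q (fun y => u s y ^+ 2)).
  by apply: cts_itg; rewrite /continuous2; cts.
have subW a b : s0 <= a -> a <= b -> b <= s0 + 2 * Tm -> itg a b D <= W.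
  by move=> ? ? ?; apply: sub_itg.
have pt s : s0 < s < s0 + Tm -> itg P Q (fun y => u s y ^+ 2) <=
    6 * (Q - P) ^+ 2 * (D s + D (s + T) + al ^+ 2 * Tm * W).
  move=> /andP[s1 s2]; have sp : 0 < s by exact: le_lt_trans s1.
  have J : itg s (s + T) G ^+ 2 <= Tm * (2 * (Q - P) * W).
    have sT : s <= s + T by rewrite lerDl ltW.
    apply: le_trans (itg_sqr_le sT cG) _; rewrite addrAC subrr add0r.
    apply: ler_pM => //; [exact: ltW| |].
      by apply: itg_ge0 => [|x _]; [cts|exact: sqr_ge0].
    apply: (@le_trans _ _ (itg s (s + T) (fun t => 2 * (Q - P) * D t))).
      by apply: le_itg; [by cts|by cts|move=> x _; exact: tile_G_sqr_le].
    rewrite itgZ// ler_wpM2l ?mulr_ge0//; apply: subW => //; lra.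
  apply: (@le_trans _ _ (itg P Q (fun=> 6 * (Q - P) * (D s + D (s + T) + al ^+ 2 * Tm * W)))).
    apply: le_itg; [by cts|by cts|move=> y /andP[/ltW y1 /ltW y2]].
    have yI : P <= y <= Q by rewrite y1.
    have := tile_pointwise sp yI; rewrite -/al.
    have g1 := tile_G_sqr_le s; have g2 := tile_G_sqr_le (s + T).
    move: J; set g := itg s (s + T) G; move: (G s) (G (s + T)) g1 g2 => x1 x2 g1 g2 J.
    rewrite -(real_normK (num_real (u s y))); move: `|u s y| (normr_ge0 (u s y)) => w w0 Hw.
    apply: (@le_trans _ _ ((x1 + x2 + al * g) ^+ 2)).
      by rewrite ler_sqr ?nnegrE; [exact: Hw|exact: w0|exact: le_trans w0 Hw].
    apply: (@le_trans _ _ (3 * (x1 ^+ 2 + x2 ^+ 2 + al ^+ 2 * g ^+ 2))).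
      have := sqr_ge0 (x1 - x2); have := sqr_ge0 (x1 - al * g).
      by have := sqr_ge0 (x2 - al * g); lra.
    have := ler_wpM2l (sqr_ge0 al) J.
    lra.
  by rewrite itg_cst//; lra.
have cDT : continuous (fun s => D (s + T)) by cts.
apply: le_trans (le_itg cE _ pt) _; first by cts.
rewrite itgZ; last by cts.
rewrite -[leRHS]mulrA ler_wpM2l ?mulr_ge0 ?sqr_ge0//.
rewrite itgD; [|by cts|by cts].
rewrite itgD; [|by cts|by cts].
have sTm : s0 <= s0 + Tm by rewrite lerDl ltW.
rewrite itg_cst// itg_shift//.
have W1 : itg s0 (s0 + Tm) D <= W by apply: subW => //; lra.
have W2 : itg (s0 + T) (s0 + Tm + T) D <= W by apply: subW; lra.
by rewrite /Tm_factor -/al; lra.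
Qed.

End tile.

Section tile_estimate.
Context {R : realType}.
Variables (nu : R) (p q K P Q Tm s0 : R).
Hypotheses (nu_gt0 : 0 < nu) (pq : p < q) (P0 : 0 <= P) (Pp : P <= p)
  (qQ : q <= Q) (Q1 : Q <= 1) (s00 : 0 <= s0).

Lemma tile_estimate_pos (B B1 B2 : R -> R) (u uy uyy v vy vyy : R -> R -> R) :
  heat_pair nu B u uy uyy v vy vyy ->
  continuous B -> continuous B1 -> continuous B2 ->
  (forall y : R, p < y < q -> is_derive y 1 B (B1 y)) ->
  (forall y : R, p < y < q -> is_derive y 1 B1 (B2 y)) ->
  (forall y, p <= y <= q -> 0 < B1 y) ->
  (forall y, p <= y <= q -> `|B2 y| * (q - p) <= K * B1 y) ->
  4 * pi <= Tm * (B q - B p) ->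
  itg s0 (s0 + Tm) (fun s => itg P Q (fun y => u s y ^+ 2 + v s y ^+ 2)) <=
  12 * (Q - P) ^+ 2 * Tm_factor nu p q K Tm *
    itg s0 (s0 + 2 * Tm) (fun s => itg P Q (fun y => uy s y ^+ 2 + vy s y ^+ 2)).
Proof.
move=> H cB cB1 cB2 dB dB1 B1_gt0 B2_le hT.
have L0 := bump_L_gt0 pq cB dB B1_gt0.
have TT : 4 * pi / (B q - B p) <= Tm by rewrite ler_pdivrMr.
have cu := hp_cu H; have cv := hp_cv H.
have c1 : continuous (fun s => itg P Q (fun y => u s y ^+ 2)).
  by apply: cts_itg; rewrite /continuous2; cts.
have c2 : continuous (fun s => itg P Q (fun y => v s y ^+ 2)).
  by apply: cts_itg; rewrite /continuous2; cts.
have I1 := tile_int nu_gt0 H pq cB cB1 cB2 dB dB1 B1_gt0 B2_le P0 Pp qQ Q1 s00 TT.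
have I2 := tile_int nu_gt0 (heat_pair_rotate H) pq cB cB1 cB2 dB dB1 B1_gt0
  B2_le P0 Pp qQ Q1 s00 TT.
have E : (fun s => itg P Q (fun y => vy s y ^+ 2 + (- uy s y) ^+ 2)) =
         (fun s => itg P Q (fun y => uy s y ^+ 2 + vy s y ^+ 2)).
  by apply/funext => s; apply: eq_itg => y _; rewrite sqrrN addrC.
rewrite E in I2.
have -> : (fun s => itg P Q (fun y => u s y ^+ 2 + v s y ^+ 2)) =
  (fun s => itg P Q (fun y => u s y ^+ 2) + itg P Q (fun y => v s y ^+ 2)).
  by apply/funext => s; rewrite itgD//; cts.
have twice (x k W : R) : 12 * x * k * W = 6 * x * k * W + 6 * x * k * W by ring.
by rewrite itgD; [rewrite twice; exact: lerD I1 I2|cts|cts].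
Qed.

(** A nonvanishing continuous [B1] has constant sign; when it is negative, conjugation reduces to
    [tile_estimate_pos]. *)
Lemma tile_estimate (B B1 B2 : R -> R) (u uy uyy v vy vyy : R -> R -> R) :
  heat_pair nu B u uy uyy v vy vyy ->
  continuous B -> continuous B1 -> continuous B2 ->
  (forall y : R, p < y < q -> is_derive y 1 B (B1 y)) ->
  (forall y : R, p < y < q -> is_derive y 1 B1 (B2 y)) ->
  (forall y, p <= y <= q -> B1 y != 0) ->
  (forall y, p <= y <= q -> `|B2 y| * (q - p) <= K * `|B1 y|) ->
  4 * pi <= Tm * `|B q - B p| ->
  itg s0 (s0 + Tm) (fun s => itg P Q (fun y => u s y ^+ 2 + v s y ^+ 2)) <=
  12 * (Q - P) ^+ 2 * Tm_factor nu p q K Tm *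
    itg s0 (s0 + 2 * Tm) (fun s => itg P Q (fun y => uy s y ^+ 2 + vy s y ^+ 2)).
Proof.
move=> H cB cB1 cB2 dB dB1 B1_neq0 B2_le hT.
have pI : p <= p <= q by rewrite lexx ltW.
have sgn y : p <= y <= q -> 0 < B1 p * B1 y.
  move=> /andP[py yq]; rewrite lt_neqAle eq_sym mulf_neq0 ?B1_neq0 ?py//=.
  rewrite leNgt; apply/negP => neg.
  have [c] : exists2 c, c \in `[p, y] & B1 c = 0.
    apply: IVT => //; first exact: continuous_subspaceT.
    rewrite ge_min le_max.
    have [b1|b1|b1] := ltgtP (B1 p) 0.
    - by move: neg; rewrite nmulr_rlt0// => /ltW ->; rewrite ?(ltW b1) ?orbT.
    - by move: neg; rewrite pmulr_rlt0// => /ltW ->; rewrite ?(ltW b1) ?orbT.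
    - by rewrite b1 mul0r ltxx in neg.
  rewrite in_itv/= => /andP[c1 c2] /eqP; apply/negP/B1_neq0.
  by rewrite c1 (le_trans c2).
have [b1|b1|b1] := ltgtP (B1 p) 0; last first.
- by have := B1_neq0 p pI; rewrite b1 eqxx.
- have B1_gt0 y : p <= y <= q -> 0 < B1 y by move=> /sgn; rewrite pmulr_rgt0.
  have L0 := bump_L_gt0 pq cB dB B1_gt0.
  apply: (@tile_estimate_pos B B1 B2 u uy uyy v vy vyy) => //.
  + by move=> y yI; have := B2_le y yI; rewrite (gtr0_norm (B1_gt0 y yI)).
  + by rewrite -(gtr0_norm L0).
have B1_gt0 y : p <= y <= q -> 0 < - B1 y.
  by move=> /sgn; rewrite nmulr_rgt0 ?oppr_gt0.
have dBN (y : R) : p < y < q -> is_derive y 1 (fun y => - B y) (- B1 y).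
  by move=> yI; apply: derN; exact: dB.
have dB1N (y : R) : p < y < q -> is_derive y 1 (fun y => - B1 y) (- B2 y).
  by move=> yI; apply: derN; exact: dB1.
have cBN : continuous (fun y => - B y) by cts.
have L0 := bump_L_gt0 pq cBN dBN B1_gt0.
have := @tile_estimate_pos (fun y => - B y) (fun y => - B1 y) (fun y => - B2 y) _ _ _ _ _ _
  (heat_pair_reflect H).
have -> : (fun s => itg P Q (fun y => u s y ^+ 2 + (- v s y) ^+ 2)) =
         (fun s => itg P Q (fun y => u s y ^+ 2 + v s y ^+ 2)).
  by apply/funext => s; apply: eq_itg => y _; rewrite sqrrN.
have -> : (fun s => itg P Q (fun y => uy s y ^+ 2 + (- vy s y) ^+ 2)) =
         (fun s => itg P Q (fun y => uy s y ^+ 2 + vy s y ^+ 2)).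
  by apply/funext => s; apply: eq_itg => y _; rewrite sqrrN.
apply => //; [by cts|by cts| |].
- move=> y yI; have := B2_le y yI; have := gtr0_norm (B1_gt0 y yI).
  by rewrite !normrN => ->.
- by rewrite -(gtr0_norm L0) -opprD normrN.
Qed.

End tile_estimate.

(** * The energy identity *)

Section energy.
Context {R : realType}.
Variables (nu : R) (B : R -> R) (u uy uyy v vy vyy : R -> R -> R).
Hypotheses (nu_gt0 : 0 < nu) (H : heat_pair nu B u uy uyy v vy vyy).
Hypothesis cB : continuous B.
Hypothesis bcu : forall t, 0 < t -> u t 1 * uy t 1 = u t 0 * uy t 0.
Hypothesis bcv : forall t, 0 < t -> v t 1 * vy t 1 = v t 0 * vy t 0.

Definition energy (t : R) := itg 0 1 (fun y => u t y ^+ 2 + v t y ^+ 2).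
Definition dissipation (t : R) := itg 0 1 (fun y => uy t y ^+ 2 + vy t y ^+ 2).

Let cu := hp_cu H.
Let cuy := hp_cuy H.
Let cuyy := hp_cuyy H.
Let cv := hp_cv H.
Let cvy := hp_cvy H.
Let cvyy := hp_cvyy H.

Lemma cts_energy : continuous energy.
Proof. by apply: cts_itg; rewrite /continuous2; cts. Qed.

Lemma cts_dissipation : continuous dissipation.
Proof. by apply: cts_itg; rewrite /continuous2; cts. Qed.

Lemma dissipation_ge0 t : 0 <= dissipation t.
Proof. by apply: itg_ge0 => [|y _]; [cts|rewrite addr_ge0 ?sqr_ge0]. Qed.

Lemma energy_ge0 t : 0 <= energy t.
Proof. by apply: itg_ge0 => [|y _]; [cts|rewrite addr_ge0 ?sqr_ge0]. Qed.

(** The two terms in [B] cancel. The hypotheses [bcu] and [bcv] say exactly that the boundary terms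
    of the integration by parts cancel, which is all that is retained of the periodic, Dirichlet and
    Neumann conditions. *)
Lemma is_derive_energy (t : R) : 0 < t ->
  is_derive t 1 energy (- (2 * nu) * dissipation t).
Proof.
move=> t0.
have ibp (g g' g'' : R -> R) : continuous g -> continuous g' -> continuous g'' ->
    (forall y : R, 0 < y < 1 -> is_derive y 1 g (g' y)) ->
    (forall y : R, 0 < y < 1 -> is_derive y 1 g' (g'' y)) ->
    g 1 * g' 1 = g 0 * g' 0 ->
    itg 0 1 (fun y => g'' y * g y) = - itg 0 1 (fun y => g' y ^+ 2).
  move=> cg cg' cg'' dg dg' bc.
  have -> : itg 0 1 (fun y => g'' y * g y) =
      g' 1 * g 1 - g' 0 * g 0 - itg 0 1 (fun y => g' y * g' y).
    exact: itg_by_parts.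
  by rewrite mulrC bc mulrC subrr sub0r.
have -> : - (2 * nu) * dissipation t =
    itg 0 1 (fun y => 2 * nu * (uyy t y * u t y + vyy t y * v t y)).
  rewrite itgZ; last by cts.
  rewrite itgD; [|by cts|by cts].
  rewrite /dissipation itgD; [|by cts|by cts].
  rewrite (_ : itg 0 1 (fun y => uyy t y * u t y) = - itg 0 1 (fun y => uy t y ^+ 2)).
    rewrite (_ : itg 0 1 (fun y => vyy t y * v t y) = - itg 0 1 (fun y => vy t y ^+ 2)).
      by ring.
    apply: ibp; [by cts|by cts|by cts| | |exact: bcv].
      by move=> y; exact: (hp_vy H).
    by move=> y; exact: (hp_vyy H).
  apply: ibp; [by cts|by cts|by cts| | |exact: bcu].
    by move=> y; exact: (hp_uy H).
  by move=> y; exact: (hp_uyy H).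
rewrite [X in is_derive _ _ _ X](_ : _ = itg 0 1 (fun y =>
  2 * u t y * (nu * uyy t y + B y * v t y) +
  2 * v t y * (nu * vyy t y - B y * u t y))); last first.
  by apply: eq_itg => y _; ring.
apply: (@is_derive_itg_param R (fun t y => u t y ^+ 2 + v t y ^+ 2)
  (fun t y => 2 * u t y * (nu * uyy t y + B y * v t y) +
              2 * v t y * (nu * vyy t y - B y * u t y))).
- by rewrite /continuous2; cts.
- by rewrite /continuous2; cts.
- near=> t1; have t10 : 0 < t1 by near: t1; exact: near_pos.
  move=> y yI; have h1 := hp_ut H t10 yI; have h2 := hp_vt H t10 yI.
  derive; first by ring.
Unshelve. all: by end_near. Qed.

Lemma energy_identity s t : 0 <= s -> s <= t ->
  2 * nu * itg s t dissipation = energy s - energy t.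
Proof.
move=> s0 st; have cD := cts_dissipation; have cE := cts_energy.
have E : itg s t (fun x => - (2 * nu) * dissipation x) = energy t - energy s.
  apply: itg_FTC => //; first by cts.
  by move=> x /andP[sx _]; apply: is_derive_energy; exact: le_lt_trans sx.
by rewrite itgZ// in E; lra.
Qed.

Lemma energy_nincr s t : 0 <= s -> s <= t -> energy t <= energy s.
Proof.
move=> s0 st; rewrite -subr_ge0 -energy_identity// mulr_ge0//.
  by rewrite mulr_ge0// ltW.
by apply: itg_ge0 => [|x _]; [exact: cts_dissipation|exact: dissipation_ge0].
Qed.

End energy.

Lemma itg_tiles {R : realType} (f : R -> R) (n : nat) : continuous f ->
  itg 0 1 f = \sum_(j < n.+1) itg (j%:R / n.+1%:R) (j.+1%:R / n.+1%:R) f.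
Proof.
move=> cf.
have H m : itg 0 (m%:R / n.+1%:R) f =
    \sum_(j < m) itg (j%:R / n.+1%:R) (j.+1%:R / n.+1%:R) f.
  elim: m => [|m IH]; first by rewrite big_ord0 mul0r /itg set_itv1 Rintegral_set1.
  rewrite big_ord_recr/= -IH (@itg_cat _ f 0 (m%:R / n.+1%:R))//.
  by rewrite ler_pM2r ?invr_gt0// ler_nat.
by rewrite -H divff// pnatr_eq0.
Qed.

Section finite_sums.
Context {R : realType}.

Lemma cts_sum {T : topologicalType} {I : Type} (s : seq I) (F : I -> T -> R) :
  (forall i, continuous (F i)) -> continuous (fun x => \sum_(i <- s) F i x).
Proof.
move=> cF; elim: s => [|i s IH].
  have -> : (fun x => \sum_(j <- [::]) F j x) = (fun=> 0).
    by apply/funext => x; rewrite big_nil.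
  exact: cts_cst.
have -> : (fun x => \sum_(j <- i :: s) F j x) =
    (fun x => F i x + \sum_(j <- s) F j x).
  by apply/funext => x; rewrite big_cons.
by apply: ctsD => //; exact: cF.
Qed.

Lemma itg_bigsum {I : Type} (s : seq I) (F : I -> R -> R) (x0 x1 : R) :
  (forall i, continuous (F i)) ->
  itg x0 x1 (fun x => \sum_(i <- s) F i x) = \sum_(i <- s) itg x0 x1 (F i).
Proof.
move=> cF; elim: s => [|i s IH].
  rewrite big_nil; transitivity (itg x0 x1 (fun=> 0 * 1)).
    by apply: eq_itg => x _; rewrite big_nil mul0r.
  by rewrite (@itgZ _ 0 (fun=> 1)) ?mul0r//; cts.
rewrite big_cons -IH -itgD//; last exact: cts_sum.
by apply: eq_itg => x _; rewrite big_cons.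
Qed.

End finite_sums.

(** One bisection per point of [Z], each time keeping a half whose interior misses that point. *)
Lemma subinterval_avoiding {R : realType} (Z : seq R) (p q : R) : p < q ->
  exists p' q' : R, [/\ p <= p', q' <= q, q' - p' = (q - p) / 2 ^+ size Z &
    forall z, z \in Z -> ~~ (p' < z < q')].
Proof.
elim: Z p q => [|a Z IH] p q pq; first by exists p, q; rewrite expr0 divr1.
wlog am : p q pq / exists p0 q0, [/\ p <= p0, q0 <= q, q0 - p0 = (q - p) / 2 &
    ~~ (p0 < a < q0)] => [W|].
  apply: W => //; have [am|ma] := leP a ((p + q) / 2).
    by exists ((p + q) / 2), q; split; [lra|lra|lra|rewrite ltNge am].
  by exists p, ((p + q) / 2); split; [lra|lra|lra|rewrite andbC ltNge ltW].
have [p0 [q0 [pp0 qq0 E na]]] := am.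
have [|p1 [q1 [pp1 qq1 E1 nz]]] := IH p0 q0; first by lra.
exists p1, q1; split; [lra|lra| |].
  by rewrite E1 E exprS invfM mulrA.
move=> z; rewrite in_cons => /predU1P[->|/nz//].
apply: contra na => /andP[h1 h2]; apply/andP; split; lra.
Qed.

(* [b1] and [b2] are the first two derivatives of [b], and [Z] contains the
   critical points. *)
Record nondegenerate {R : realType} (b b1 b2 : R -> R) (N : nat) (Z : seq R)
    (c : R) : Prop := Nondegenerate {
  nd_cb : continuous b ;
  nd_cb1 : continuous b1 ;
  nd_cb2 : continuous b2 ;
  nd_db : forall y : R, 0 < y < 1 -> is_derive y 1 b (b1 y) ;
  nd_db1 : forall y : R, 0 < y < 1 -> is_derive y 1 b1 (b2 y) ;
  nd_c : 0 < c ;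
  nd_le : forall y eta : R, 0 < y < 1 -> 0 < eta <= 1 ->
    (forall z, z \in Z -> ~~ (y - eta < z < y + eta)) ->
    c * eta ^+ N <= `|b1 y| /\ c * eta * `|b2 y| <= `|b1 y| }.

(** * Exponential decay of the energy of a mode *)

Section decay.
Context {R : realType}.
Variables (b b1 b2 : R -> R) (N : nat) (Z : seq R) (c : R).
Hypothesis nd : nondegenerate b b1 b2 N Z c.

(** [rho] is the proportion of a tile that is kept: one halving per point of [Z], then a third. [K0]
    is the window length in units of l^2 / nu; [C2] is [twist_bound] without its denominator, for
    the Harnack constant 1 / c; [A] bounds the viscous factor in [Tm_factor]; [C4] collects the tile
    constants; [theta] is the contraction ratio solving K0 E' <= C4 (E - E'). *)
Let rho : R := (3 * 2 ^+ size Z)^-1.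
Let K0 : R := 4 * pi / (c * rho ^+ N.+1).
Let C2 : R := 10 * pi * expR c^-1 ^+ 2 + 2 * c^-1 * expR c^-1.
Let A : R := C2 * K0 / rho ^+ 2.
Let C4 : R := 24 * (2 + A ^+ 2).
Let theta : R := C4 / (K0 + C4).

Lemma rho_gt0 : 0 < rho.
Proof. by rewrite invr_gt0 mulr_gt0// exprn_gt0. Qed.

Lemma rho_le1 : rho <= 1.
Proof.
rewrite invf_le1 ?mulr_gt0 ?exprn_gt0//.
have : 1 <= 2 ^+ size Z :> R by rewrite exprn_ege1// ler1n.
by lra.
Qed.

Lemma K0_gt0 : 0 < K0.
Proof.
by rewrite divr_gt0 ?mulr_gt0 ?pi_gt0 ?(nd_c nd) ?exprn_gt0// rho_gt0.
Qed.

Lemma C4_gt0 : 0 < C4.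
Proof. by rewrite mulr_gt0// ltr_wpDr// sqr_ge0. Qed.

Section mode.
Variables (nu k l : R) (u uy uyy v vy vyy : R -> R -> R).
Hypotheses (nu_gt0 : 0 < nu) (k_gt0 : 0 < k) (l_gt0 : 0 < l) (l_le1 : l <= 1).
Hypothesis kl : k * l ^+ (N + 3) = nu.
Hypothesis H : heat_pair nu (fun y => k * b y) u uy uyy v vy vyy.
Hypothesis bcu : forall t, 0 < t -> u t 1 * uy t 1 = u t 0 * uy t 0.
Hypothesis bcv : forall t, 0 < t -> v t 1 * vy t 1 = v t 0 * vy t 0.

Let Tm : R := K0 * l ^+ 2 / nu.
Local Notation E := (energy u v).
Local Notation D := (dissipation uy vy).

Lemma Tm_gt0 : 0 < Tm.
Proof.
by apply: divr_gt0 => //; apply: mulr_gt0; [exact: K0_gt0|exact: exprn_gt0].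
Qed.

(** The window is the time of two turns across a segment of length [rho l] on which |b'| >= c (rho
    l)^N. This is where the choice of [l] through [kl] is used. *)
Lemma TmE : Tm = 4 * pi / (k * c * (rho * l) ^+ N.+1).
Proof.
rewrite /Tm /K0 -kl exprMn addnC exprD (exprS l N).
have := nd_c nd; move: (pi : R) rho_gt0 => P r0 c0.
have rN : 0 < rho ^+ N.+1 by rewrite exprn_gt0.
have lN : 0 < l ^+ N by rewrite exprn_gt0.
move: (l ^+ N) (rho ^+ N.+1) rN lN => x y y0 x0.
by field; rewrite !gt_eqF.
Qed.

Lemma tile_decay (s0 P Q : R) : 0 <= s0 -> 0 <= P -> Q <= 1 ->
  l <= Q - P -> Q - P <= 2 * l ->
  itg s0 (s0 + Tm) (fun s => itg P Q (fun y => u s y ^+ 2 + v s y ^+ 2)) <=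
  2 * C4 * l ^+ 2 *
    itg s0 (s0 + 2 * Tm) (fun s => itg P Q (fun y => uy s y ^+ 2 + vy s y ^+ 2)).
Proof.
move=> s00 P0 Q1 lPQ PQl.
have l0 := l_gt0; have l1 := l_le1.
have PQ : P < Q by lra.
have [p0 [q0 [Pp0 Qq0 Epq nz]]] := subinterval_avoiding Z PQ.
pose eta := (Q - P) * rho.
have r0 := rho_gt0; have r1 := rho_le1; have c0 := nd_c nd.
have eta0 : 0 < eta by rewrite mulr_gt0// subr_gt0.
have eta1 : eta <= 1 by rewrite /eta mulr_ile1//; lra.
have Eeta : q0 - p0 = 3 * eta.
  have : 2 ^+ size Z != 0 :> R by rewrite expf_neq0// pnatr_eq0.
  by rewrite Epq /eta /rho; move: (2 ^+ size Z) => X X0; field.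
(* The middle third of the subinterval stays at distance [eta] from [Z], so the lower bounds of
   [nondegenerate] hold on it. *)
pose p := p0 + eta; pose q := p + eta.
have pq : p < q by rewrite /q; lra.
have qp : q - p = eta by rewrite /q; ring.
have qq0 : q + eta = q0 by rewrite /q /p; lra.
have far y : p <= y <= q -> forall z, z \in Z -> ~~ (y - eta < z < y + eta).
  move=> /andP[py yq] z /nz; apply: contra => /andP[z1 z2].
  by apply/andP; split; lra.
have yI y : p <= y <= q -> 0 < y < 1.
  by move=> /andP[py yq]; apply/andP; split; lra.
have ndy y : p <= y <= q ->
    c * eta ^+ N <= `|b1 y| /\ c * eta * `|b2 y| <= `|b1 y|.
  move=> pyq; apply: (nd_le nd (yI y pyq)); first by rewrite eta0.
  exact: far.
have cb := nd_cb nd; have cb1 := nd_cb1 nd; have cb2 := nd_cb2 nd.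
have rl : rho * l <= eta by rewrite /eta mulrC ler_wpM2r// ltW.
have rl0 : 0 < rho * l by rewrite mulr_gt0.
have W0 : 0 <= itg s0 (s0 + 2 * Tm)
     (fun s => itg P Q (fun y => uy s y ^+ 2 + vy s y ^+ 2)).
  have [? ?] := (hp_cuy H, hp_cvy H).
  apply: itg_ge0 => [|x _]; first by apply: cts_itg; rewrite /continuous2; cts.
  by apply: itg_ge0 => [|y _]; [cts|rewrite addr_ge0 ?sqr_ge0].
apply: le_trans (@tile_estimate R nu p q c^-1 P Q Tm s0 nu_gt0 pq P0 _ _ Q1 s00
  (fun y => k * b y) (fun y => k * b1 y) (fun y => k * b2 y) _ _ _ _ _ _ H
  _ _ _ _ _ _ _ _) _.
- by rewrite /p; lra.
- by lra.
- by cts.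
- by cts.
- by cts.
- move=> y /andP[y1 y2]; have h := nd_db nd (yI y _).
  have {}h : is_derive y 1 b (b1 y) by apply: h; rewrite !ltW.
  by derive; ring.
- move=> y /andP[y1 y2]; have h := nd_db1 nd (yI y _).
  have {}h : is_derive y 1 b1 (b2 y) by apply: h; rewrite !ltW.
  by derive; ring.
- move=> y pyq; have [h _] := ndy y pyq.
  apply: mulf_neq0; first by rewrite gt_eqF.
  rewrite -normr_gt0; apply: lt_le_trans h.
  by rewrite mulr_gt0 ?exprn_gt0.
- move=> y pyq; have [_ h] := ndy y pyq.
  rewrite qp !normrM (gtr0_norm k_gt0) [leRHS]mulrCA -[leLHS]mulrA ler_pM2l//.
  rewrite ler_pdivlMl//; apply: le_trans h.
  by rewrite le_eqVlt; apply/orP; left; apply/eqP; ring.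
- have [xi /andP[x1 x2] Ex] : exists2 xi, p < xi < q & b q - b p = b1 xi * (q - p).
    have dbI x : x \in `]p, q[ -> is_derive x 1 b (b1 x).
      rewrite in_itv/= => /andP[x1 x2]; apply: (nd_db nd).
      by apply: yI; rewrite !ltW.
    have [xi] := @MVT R b b1 p q pq dbI (continuous_subspaceT cb).
    by rewrite in_itv/= => ? ?; exists xi.
  have xiI : p <= xi <= q by rewrite !ltW.
  have [h _] := ndy xi xiI.
  have X0 : 0 < k * c * (rho * l) ^+ N.+1 by rewrite !mulr_gt0// exprn_gt0.
  have XY : k * c * (rho * l) ^+ N.+1 <= k * (`|b1 xi| * eta).
    rewrite -mulrA ler_pM2l//; apply: (@le_trans _ _ (c * eta ^+ N.+1)).
      rewrite ler_pM2l// lerXn2r// nnegrE ltW//.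
    by rewrite exprSr mulrA ler_pM2r.
  rewrite -mulrBr Ex qp 2!normrM (gtr0_norm k_gt0) (gtr0_norm eta0) TmE.
  by rewrite mulrAC ler_pdivlMr// ler_pM2l// mulr_gt0// pi_gt0.
apply: ler_wpM2r => //.
have C20 : 0 <= C2.
  rewrite addr_ge0// ?mulr_ge0 ?pi_ge0 ?exprn_ge0 ?expR_ge0// ?invr_ge0 ltW//.
have nuTm : nu * twist_bound p q c^-1 * Tm <= A.
  rewrite /twist_bound qp -/C2 /Tm /A.
  have -> : nu * (C2 / eta ^+ 2) * (K0 * l ^+ 2 / nu) = C2 * K0 * (l ^+ 2 / eta ^+ 2).
    by field; rewrite !gt_eqF.
  rewrite -mulrA -[leRHS]mulrA ler_wpM2l// ler_wpM2l ?(ltW K0_gt0)//.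
  have le1 : l / eta <= rho^-1 by rewrite ler_pdivrMr// ler_pdivlMl.
  have le0 : 0 <= l / eta by apply: divr_ge0; exact: ltW.
  have le2 : 0 <= rho^-1 by rewrite invr_ge0 ltW.
  by rewrite -!exprVn -exprMn lerXn2r.
have nuTm0 : 0 <= nu * twist_bound p q c^-1 * Tm.
  apply: mulr_ge0; last exact: ltW Tm_gt0.
  apply: mulr_ge0; first exact: ltW.
  by rewrite /twist_bound qp; apply: divr_ge0 => //; exact: sqr_ge0.
have F : Tm_factor nu p q c^-1 Tm <= 2 + A ^+ 2.
  by rewrite lerD2l lerXn2r// nnegrE// (le_trans nuTm0).
have F0 : 0 <= Tm_factor nu p q c^-1 Tm by rewrite addr_ge0// sqr_ge0.
have h2 : (Q - P) ^+ 2 <= 4 * l ^+ 2.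
  have -> : 4 * l ^+ 2 = (2 * l) ^+ 2 by ring.
  by rewrite lerXn2r// nnegrE; lra.
have -> : 2 * C4 * l ^+ 2 = 12 * (4 * l ^+ 2) * (2 + A ^+ 2) by rewrite /C4; ring.
by apply: ler_pM => //; [rewrite mulr_ge0// sqr_ge0|rewrite ler_pM2l].
Qed.

(** Monotonicity bounds [Tm] times the final energy by its integral; the tiles bound this integral
    by the dissipation, which the energy identity turns into an energy drop. The final energy is
    then absorbed on the left. *)
Lemma energy_contracts s0 : 0 <= s0 -> E (s0 + 2 * Tm) <= theta * E s0.
Proof.
move=> s00; have T0 := Tm_gt0; have l0 := l_gt0; have ll1 := l_le1; have k0 := K0_gt0; have c40 := C4_gt0.
(* The number of tiles [n.+1] is the integer part of 1 / l, positive since l <= 1; tile lengths then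
   lie between [l] and [2 l]. *)
have [n [n1 n2]] : exists n : nat, l <= n.+1%:R^-1 /\ n.+1%:R^-1 <= 2 * l.
  have l1 : 1 <= l^-1 by rewrite invf_ge1.
  have li0 : 0 <= l^-1 by rewrite invr_ge0 ltW.
  have := truncn_itv li0; set m := Num.truncn _ => /andP[m1 m2].
  have m0 : (0 < m)%N by rewrite truncn_gt0.
  exists m.-1; rewrite prednK//.
  have mR : 1 <= m%:R :> R by rewrite ler1n.
  have mR0 : 0 < m%:R :> R by lra.
  split; first by rewrite -[leLHS]invrK lef_pV2 ?posrE// invr_gt0.
  rewrite -[m.+1]addn1 natrD in m2.
  have : 1 < (m%:R + 1) * l by rewrite -ltr_pdivrMr// div1r.
  by rewrite invf_ple ?posrE ?mulr_gt0// => h; rewrite -div1r ler_pdivrMr ?mulr_gt0//; nra.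
have cE : continuous E by exact: (cts_energy H).
have cD : continuous D by exact: (cts_dissipation H).
have [cu cuy cv cvy] := And4 (hp_cu H) (hp_cuy H) (hp_cv H) (hp_cvy H).
have sum_le : itg s0 (s0 + Tm) E <= 2 * C4 * l ^+ 2 * itg s0 (s0 + 2 * Tm) D.
  pose P (j : 'I_n.+1) : R := j%:R / n.+1%:R.
  pose Q (j : 'I_n.+1) : R := j.+1%:R / n.+1%:R.
  have cEj j : continuous (fun s => itg (P j) (Q j) (fun y => u s y ^+ 2 + v s y ^+ 2)).
    by apply: cts_itg; rewrite /continuous2; cts.
  have cDj j : continuous (fun s => itg (P j) (Q j) (fun y => uy s y ^+ 2 + vy s y ^+ 2)).
    by apply: cts_itg; rewrite /continuous2; cts.
  have -> : E = (fun s => \sum_(j < n.+1) itg (P j) (Q j) (fun y => u s y ^+ 2 + v s y ^+ 2)).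
    by apply/funext => s; apply: itg_tiles; cts.
  have -> : D = (fun s => \sum_(j < n.+1) itg (P j) (Q j) (fun y => uy s y ^+ 2 + vy s y ^+ 2)).
    by apply/funext => s; apply: itg_tiles; cts.
  rewrite !itg_bigsum// mulr_sumr; apply: ler_sum => j _.
  have QP : Q j - P j = n.+1%:R^-1.
    by rewrite /Q /P -mulrBl -natrB// subSnn mul1r.
  apply: tile_decay; rewrite ?QP//; first by rewrite divr_ge0.
  by rewrite ler_pdivrMr// mul1r ler_nat.
have s2 : s0 <= s0 + 2 * Tm by rewrite lerDl mulr_ge0// ltW.
have cB : continuous (fun y => k * b y) by have := nd_cb nd => ?; cts.
have EI := energy_identity H cB bcu bcv s00 s2.
have low : Tm * E (s0 + 2 * Tm) <= itg s0 (s0 + Tm) E.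
  rewrite [X in X * _ <= _](_ : Tm = s0 + Tm - s0); last by ring.
  rewrite mulrC -itg_cst; last by rewrite lerDl ltW.
  apply: le_itg; [by cts|by []|move=> x /andP[x1 x2]].
  have xT : x <= s0 + 2 * Tm.
    by apply: le_trans (ltW x2) _; rewrite lerD2l ler_peMl ?ler1n// ltW.
  exact: (energy_nincr nu_gt0 H cB bcu bcv (le_trans s00 (ltW x1)) xT).
have KC : 0 < K0 + C4 by rewrite addr_gt0.
rewrite /theta [leRHS]mulrAC ler_pdivlMr//; have := le_trans low sum_le.
have -> : itg s0 (s0 + 2 * Tm) D = (E s0 - E (s0 + 2 * Tm)) / (2 * nu).
  by rewrite -EI; field; rewrite gt_eqF.
have -> : 2 * C4 * l ^+ 2 * ((E s0 - E (s0 + 2 * Tm)) / (2 * nu)) =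
   (l ^+ 2 / nu) * (C4 * (E s0 - E (s0 + 2 * Tm))) by field; rewrite gt_eqF.
have -> : Tm * E (s0 + 2 * Tm) = (l ^+ 2 / nu) * (K0 * E (s0 + 2 * Tm)).
  by rewrite /Tm; ring.
rewrite ler_pM2l ?divr_gt0 ?exprn_gt0//.
by rewrite mulrBr lerBrDr -mulrDl mulrC.
Qed.

Lemma theta_itv : 0 < theta < 1.
Proof.
have k0 := K0_gt0; have c40 := C4_gt0.
by rewrite /theta divr_gt0 ?addr_gt0//= ltr_pdivrMr ?addr_gt0// mul1r ltrDr.
Qed.

(** The contraction is iterated as many times as whole windows [2 Tm] fit in [0, t]; rounding down
    costs the factor [theta^-1]. *)
Lemma energy_decay_aux t : 0 <= t ->
  E t <= theta^-1 * expR (ln theta / (2 * K0) * (nu / l ^+ 2) * t) * E 0.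
Proof.
move=> t0; have T0 := Tm_gt0; have /andP[th0 th1] := theta_itv.
have k0 := K0_gt0.
have T2 : 0 < 2 * Tm by rewrite pmulr_rgt0.
have cB : continuous (fun y => k * b y) by have := nd_cb nd => ?; cts.
have iter j : E (2 * Tm * j%:R) <= theta ^+ j * E 0.
  elim: j => [|j IH]; first by rewrite mulr0 expr0 mul1r.
  have -> : 2 * Tm * j.+1%:R = 2 * Tm * j%:R + 2 * Tm.
    by rewrite -[j.+1]addn1 natrD; ring.
  rewrite exprS -[leRHS]mulrA.
  have h := mulr_ge0 (ltW T2) (ler0n R j).
  apply: le_trans (energy_contracts h) _.
  by apply: ler_wpM2l => //; exact: ltW.
have x0 : 0 <= t / (2 * Tm) by apply: divr_ge0 => //; exact: ltW.
have := truncn_itv x0; set j := Num.truncn _ => /andP[j1 j2].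
have tj : 2 * Tm * j%:R <= t by rewrite mulrC -ler_pdivlMr.
have h := mulr_ge0 (ltW T2) (ler0n R j).
apply: le_trans (energy_nincr nu_gt0 H cB bcu bcv h tj) _.
apply: le_trans (iter j) _; apply: ler_wpM2r; first exact: (energy_ge0 H).
rewrite -[X in X ^+ j](lnK th0) -expRM_natl -[X in X^-1](lnK th0) -expRN -expRD ler_expR.
have -> : ln theta / (2 * K0) * (nu / l ^+ 2) * t = ln theta * (t / (2 * Tm)).
  by rewrite /Tm; field; rewrite !gt_eqF.
have : ln theta < 0 by rewrite ln_lt0// th0.
rewrite -[j.+1]addn1 natrD in j2.
by rewrite mulr_natl; nra.
Qed.

End mode.

(* With [k l ^ (N + 3) = nu], the rate [nu / l ^ 2] is
   [nu ^ ((N + 1) / (N + 3)) * k ^ (2 / (N + 3))]. *)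
Lemma energy_decay : exists C d : R, [/\ 1 <= C, 0 < d &
  forall (nu k l : R) (u uy uyy v vy vyy : R -> R -> R),
    0 < nu -> 0 < k -> 0 < l -> l <= 1 -> k * l ^+ (N + 3) = nu ->
    heat_pair nu (fun y => k * b y) u uy uyy v vy vyy ->
    (forall t : R, 0 < t -> u t 1 * uy t 1 = u t 0 * uy t 0) ->
    (forall t : R, 0 < t -> v t 1 * vy t 1 = v t 0 * vy t 0) ->
    forall t : R, 0 <= t ->
      energy u v t <= C * expR (- (d * (nu / l ^+ 2) * t)) * energy u v 0].
Proof.
have /andP[th0 th1] := theta_itv; have k0 := K0_gt0.
exists theta^-1, (- (ln theta / (2 * K0))); split.
- by rewrite invf_ge1// ltW.
- rewrite oppr_gt0 pmulr_llt0; first by rewrite ln_lt0// th0.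
  by rewrite invr_gt0; apply: mulr_gt0.
move=> nu k l u uy uyy v vy vyy nu0 kk0 l0 l1 kl H bcu bcv t t0.
rewrite 2!mulNr opprK.
exact: (energy_decay_aux nu0 kk0 l0 l1 kl H bcu bcv t0).
Qed.

End decay.

(** * The profile near its critical points *)

Section nondegeneracy.
Context {R : realType}.
Variables (h : nat -> R -> R).
Hypothesis ch : forall j, continuous (h j).
Hypothesis dh : forall j (x : R), 0 < x < 1 -> is_derive x 1 (h j) (h j.+1 x).

Lemma der_pow (w x : R) m :
  is_derive x 1 (fun z : R => (z - w) ^+ m.+1) (m.+1%:R * (x - w) ^+ m).
Proof.
have dw : is_derive x 1 (fun z : R => z - w) 1.
  exact: der_eq (derB (der_id x) (der_cst w x)) (subr0 1).
elim: m => [|m IH].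
  rewrite expr0 mulr1; have -> // : (fun z : R => (z - w) ^+ 1) = (fun z => z - w).
  by apply/funext => z; rewrite expr1.
have -> : (fun z : R => (z - w) ^+ m.+2) = (fun z => (z - w) * (z - w) ^+ m.+1).
  by apply/funext => z; rewrite -exprS.
apply: der_eq (derM dw IH) _.
by rewrite -[in RHS]addn1 natrD exprS; ring.
Qed.

(** Lagrange form of Taylor's formula at a point where the first [m] terms vanish, on either side of
    [w] and at the end points too. Induction on [m], by Rolle for h_i(x) (y - w)^(m+1) - h_i(y) (x -
    w)^(m+1), which vanishes at [w] and at [y]. *)
Lemma taylor_flat m i (w y : R) : 0 <= w <= 1 -> 0 <= y <= 1 ->
  (forall j, (j < m)%N -> h (i + j) w = 0) ->
  exists2 xi, `|xi - w| <= `|y - w| /\ 0 <= xi <= 1 &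
    h i y * m`!%:R = h (i + m) xi * (y - w) ^+ m.
Proof.
move=> wI; elim: m i y => [|m IH] i y yI hw.
  by exists y; rewrite ?lexx ?fact0 ?addn0 ?expr0.
have [->|yw] := eqVneq y w.
  exists w; first by rewrite lexx.
  by have := hw 0%N isT; rewrite addn0 => ->; rewrite subrr expr0n/= mulr0 mul0r.
pose F (x : R) : R := h i x * (y - w) ^+ m.+1 - h i y * (x - w) ^+ m.+1.
pose F' (x : R) : R := h i.+1 x * (y - w) ^+ m.+1 - h i y * (m.+1%:R * (x - w) ^+ m).
have cF : continuous F by have := @ch i => ?; rewrite /F; cts.
have dF (x : R) : 0 < x < 1 -> is_derive x 1 F (F' x).
  move=> xI; have h1 := dh i xI; have h2 := der_pow w x m.
  rewrite /F /F'; derive; by ring.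
have Fw : F w = 0.
  have := hw 0%N isT; rewrite addn0 /F => ->.
  by rewrite subrr expr0n/= mulr0 mul0r subrr.
have Fy : F y = 0 by rewrite /F subrr.
have [z [zw [zI zyw]] Fz] : exists2 z, z != w /\ (0 < z < 1 /\ `|z - w| <= `|y - w|) & F' z = 0.
  move: wI yI => /andP[w0 w1] /andP[y0 y1].
  have [lyw|lwy] : y < w \/ w < y by apply/orP; rewrite -neq_lt.
    have D x : x \in `]y, w[ -> is_derive x 1 F (F' x).
      by rewrite in_itv/= => /andP[? ?]; apply: dF; apply/andP; split; lra.
    have [z] := MVT lyw D (continuous_subspaceT cF).
    rewrite in_itv/= Fw Fy subrr => /andP[z1 z2] /esym/eqP.
    rewrite mulf_eq0 (subr_eq0 w y) (gt_eqF lyw) orbF => /eqP Fz.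
    exists z => //; split; first by rewrite lt_eqF.
    split; first by apply/andP; split; lra.
    by rewrite !ltr0_norm ?subr_lt0//; lra.
  have D x : x \in `]w, y[ -> is_derive x 1 F (F' x).
    by rewrite in_itv/= => /andP[? ?]; apply: dF; apply/andP; split; lra.
  have [z] := MVT lwy D (continuous_subspaceT cF).
  rewrite in_itv/= Fw Fy subrr => /andP[z1 z2] /esym/eqP.
  rewrite mulf_eq0 (subr_eq0 y w) (gt_eqF lwy) orbF => /eqP Fz.
  exists z => //; split; first by rewrite gt_eqF.
  split; first by apply/andP; split; lra.
  by rewrite !gtr0_norm ?subr_gt0//; lra.
have zI' : 0 <= z <= 1 by case/andP: zI => ? ?; rewrite !ltW.
have [j jm|xi [xi1 xi2] E] := IH i.+1 z zI'; first by rewrite addSnnS; apply: hw.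
exists xi; first by split => //; exact: le_trans zyw.
have zw0 : (z - w) ^+ m != 0 by rewrite expf_neq0// subr_eq0.
apply: (mulIf zw0).
move: Fz; rewrite /F' => /eqP; rewrite subr_eq0 => /eqP Fz.
rewrite addnS -addSn.
have -> : h (i.+1 + m)%N xi * (y - w) ^+ m.+1 * (z - w) ^+ m =
  (h (i.+1 + m)%N xi * (z - w) ^+ m) * (y - w) ^+ m.+1 by ring.
rewrite -E factS natrM.
have -> : h i.+1 z * m`!%:R * (y - w) ^+ m.+1 =
  (h i.+1 z * (y - w) ^+ m.+1) * m`!%:R by ring.
by rewrite Fz; ring.
Qed.

(** At a zero of order [m] > 0 of [h 1], with r = |y - w|, [taylor_flat] gives |h 1 y| of order r^m
    and |h 2 y| of order r^(m-1); as [w] is in [Z], eta <= r, and both bounds follow. [delta] keeps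
    |h (m+1)| between 1/2 and 3/2 of its value at [w], whence the 3 in [c0]. For m = 0, [h 1] stays
    away from 0 and [h 2] is bounded. *)
Lemma near_nondegenerate (N m : nat) (Z : seq R) (w : R) :
  0 <= w <= 1 -> (m <= N)%N ->
  (forall j, (1 <= j <= m)%N -> h j w = 0) -> h m.+1 w != 0 ->
  ((0 < m)%N -> w \in Z) ->
  exists delta c0 : R, [/\ 0 < delta, 0 < c0 &
    forall y c eta, `|y - w| < delta -> 0 < c <= c0 -> 0 < y < 1 -> 0 < eta <= 1 ->
    (forall z, z \in Z -> ~~ (y - eta < z < y + eta)) ->
    c * eta ^+ N <= `|h 1 y| /\ c * eta * `|h 2 y| <= `|h 1 y|].
Proof.
move=> wI mN hw hm wZ; set a := `|h m.+1 w|.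
have a0 : 0 < a by rewrite normr_gt0.
have a20 : 0 < a / 2 by rewrite divr_gt0.
have /cvgrPdist_lt/(_ _ a20)[d1 /= d10 H1] := @ch m.+1 w.
have near1 x : `|x - w| < d1 -> a / 2 <= `|h m.+1 x| <= 3 / 2 * a.
  rewrite distrC => /H1 /= H; have := ler_dist_dist (h m.+1 w) (h m.+1 x).
  by move/le_lt_trans => /(_ _ H); rewrite -/a ltr_norml => /andP[? ?]; apply/andP; split; lra.
case: m hw hm wZ mN @a a0 a20 H1 near1 => [|m] hw hm wZ mN a a0 a20 _ near1.
  have /cvgrPdist_lt/(_ _ ltr01)[d2 /= d20 H2] := @ch 2 w.
  exists (Num.min d1 d2), (a / 2 / (`|h 2 w| + 1)); split.
  - by rewrite lt_min d10.
  - by rewrite divr_gt0// ltr_wpDl.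
  move=> y c eta; rewrite lt_min => /andP[y1 y2] /andP[c0 c1] yI /andP[e0 e1] _.
  have /andP[b1 _] := near1 _ y1.
  have b2 : `|h 2 y| <= `|h 2 w| + 1.
    rewrite distrC in y2; have /= H := H2 _ y2.
    have := ler_dist_dist (h 2 w) (h 2 y); move/le_lt_trans => /(_ _ H).
    by rewrite ltr_norml => /andP[? ?]; lra.
  rewrite ler_pdivlMr ?ltr_wpDl// in c1.
  have c2 : c <= a / 2 by apply: le_trans c1; rewrite mulrDr mulr1 lerDr mulr_ge0// ltW.
  split.
    apply: le_trans b1; apply: le_trans c2; rewrite -[leRHS]mulr1 ler_pM2l//.
    by rewrite exprn_ile1// ltW.
  apply: le_trans b1; apply: le_trans c1; rewrite -mulrA ler_pM2l//.
  by rewrite -[leRHS]mul1r; apply: ler_pM => //; rewrite ltW.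
have f0 : 0 < m.+1`!%:R :> R by rewrite ltr0n fact_gt0.
exists d1, (Num.min (a / 2 / m.+1`!%:R) (3 * m.+1%:R)^-1); split => //.
  by rewrite lt_min !divr_gt0//= invr_gt0 mulr_gt0.
move=> y c eta y1 /andP[c0]; rewrite le_min => /andP[c1 c2] yI /andP[e0 e1] nz.
have yI' : 0 <= y <= 1 by case/andP: yI => ? ?; rewrite !ltW.
have eyw : eta <= `|y - w|.
  rewrite leNgt; apply/negP => ywe; have /negP := nz w (wZ isT); apply.
  by move: ywe; rewrite ltr_norml => /andP[? ?]; apply/andP; split; lra.
have [j jm|x1 [x1w _] E1] := @taylor_flat m.+1 1 w y wI yI'.
  by apply: hw; rewrite add1n ltnS.
have [j jm|x2 [x2w _] E2] := @taylor_flat m 2 w y wI yI'.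
  by apply: hw; rewrite addSn add1n ltnS.
rewrite add1n in E1; rewrite !addSn add0n in E2.
have /andP[l1 _] := near1 x1 (le_lt_trans x1w y1).
have /andP[_ l2] := near1 x2 (le_lt_trans x2w y1).
move: E1 E2 => /(congr1 Num.norm) + /(congr1 Num.norm).
rewrite !normrM !normrX !(ger0_norm (ler0n _ _)).
set r := `|y - w| in eyw *; set n1 := `|h 1 y|; set n2 := `|h 2 y| => E1 E2.
have r0 : 0 < r by exact: lt_le_trans eyw.
have rm0 : 0 < r ^+ m by rewrite exprn_gt0.
have low : a / 2 * r ^+ m.+1 <= n1 * m.+1`!%:R.
  by rewrite E1 ler_pM2r ?exprn_gt0.
split.
  rewrite -(ler_pM2r f0); apply: le_trans low; rewrite mulrAC; apply: ler_pM => //.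
  - by rewrite mulr_ge0// ltW.
  - by rewrite exprn_ge0// ltW.
  - by rewrite -ler_pdivlMr.
  - apply: (@le_trans _ _ (eta ^+ m.+1)).
      by apply: ler_wiXn2l => //; rewrite ltW.
    by apply: lerXn2r => //; rewrite nnegrE ltW.
have fm0 : 0 < m`!%:R :> R by rewrite ltr0n fact_gt0.
have n2le : n2 * m`!%:R <= 3 / 2 * a * r ^+ m by rewrite E2 ler_pM2r.
rewrite -(ler_pM2r f0); apply: le_trans low; rewrite factS natrM.
have -> : c * eta * n2 * (m.+1%:R * m`!%:R) = c * m.+1%:R * (eta * (n2 * m`!%:R)) by ring.
have -> : a / 2 * r ^+ m.+1 = 3^-1 * (r * (3 / 2 * a * r ^+ m)).
  by rewrite exprS; field.
have n20 : 0 <= n2 by exact: normr_ge0.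
have c3 : c * m.+1%:R <= 3^-1.
  by move: c2; rewrite invfM -ler_pdivrMr ?invr_gt0// invrK.
apply: ler_pM => //; [by rewrite mulr_ge0// ltW|by rewrite !mulr_ge0// ltW|].
by apply: ler_pM => //; [rewrite ltW|rewrite mulr_ge0// ltW].
Qed.

(** The local bounds survive a decrease of [c], so they hold for all small [c] > 0 near each point,
    and compactness of [0, 1] yields one [c] for all. *)
Lemma finite_type_nondegenerate (N : nat) (Z : seq R) :
  (forall w : R, 0 <= w <= 1 -> exists m, [/\ (m <= N)%N,
     forall j, (1 <= j <= m)%N -> h j w = 0, h m.+1 w != 0 & (0 < m)%N -> w \in Z]) ->
  exists c, nondegenerate (h 0) (h 1) (h 2) N Z c.
Proof.
move=> HZ.
pose P (c y : R) := forall eta : R, 0 < y < 1 -> 0 < eta <= 1 ->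
    (forall z, z \in Z -> ~~ (y - eta < z < y + eta)) ->
    c * eta ^+ N <= `|h 1 y| /\ c * eta * `|h 2 y| <= `|h 1 y|.
have K := (@compact_near_coveringP R `[0, 1]).1 (@segment_compact R 0 1).
have {K} : \forall c \near (0 : R)^'+, `[0, 1] `<=` P c.
  apply: K => w; rewrite /= in_itv/= => wI.
  have [m [mN hw hm wZ]] := HZ w wI.
  have [de [c0 [de0 c00 H]]] := near_nondegenerate wI mN hw hm wZ.
  exists ([set y | `|y - w| < de], [set c | 0 < c <= c0]) => /=.
    split; first by exists de => //= y /=; rewrite distrC.
    exists c0 => //= c /=; rewrite sub0r normrN => cc0 c1.
    by rewrite c1 ltW//; apply: le_lt_trans cc0; exact: ler_norm.
  move=> [y c] [/= yw cI] eta yI eI nz; exact: H.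
move=> nearP.
have : \forall c \near (0 : R)^'+, 0 < c by exact: nbhs_right_gt.
move=> posP; have FF : \forall c \near (0 : R)^'+, `[0, 1] `<=` P c /\ 0 < c.
  exact: filterS2 nearP posP.
have [c [Pc c0]] := @filter_ex _ _ (at_right_proper_filter (0 : R)) _ FF.
exists c; split => //; try exact: ch.
- by move=> y; exact: dh.
- by move=> y; exact: dh.
- move=> y eta yI eI nz; apply: Pc => //.
  by rewrite /= in_itv/=; case/andP: yI => ? ?; rewrite !ltW.
Qed.

End nondegeneracy.

(** * Extension of the profile to the whole line *)

Section clamp.
Context {R : realType}.

(** The retraction of the line onto [0, 1]: composing with it makes a function continuous on the
    segment continuous everywhere, as the calculus above requires. *)
Definition clamp (y : R) : R := Num.max 0 (Num.min 1 y).

Lemma clamp_itv y : 0 <= clamp y <= 1.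
Proof. by rewrite /clamp le_max lexx/= ge_max ler01 ge_min lexx. Qed.

Lemma clamp_id y : 0 <= y <= 1 -> clamp y = y.
Proof. by move=> /andP[y0 y1]; rewrite /clamp min_r// max_r. Qed.

Lemma cts_clamp : continuous clamp.
Proof.
move=> y; apply: continuous_max; first exact: cst_continuous.
by apply: continuous_min; [exact: cst_continuous|exact: cvg_id].
Qed.

Lemma within_comp {U V W : topologicalType} (A : set V) (g : V -> W) (f : U -> V) :
  {within A, continuous g} -> continuous f -> (forall x, A (f x)) ->
  continuous (fun x => g (f x)).
Proof.
move=> /subspace_continuousP cg cf Af x.
apply: (@cvg_comp _ _ _ f g (nbhs x) (within A (nbhs (f x)))); last exact: cg.
move=> S /= HS.
have HS' : nbhs x (fun z => A (f z) -> S (f z)) := cf x _ HS.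
change (nbhs x (f @^-1` S)); apply: filterS HS' => z Hz; exact: Hz (Af z).
Qed.

Lemma near_interior (x : R) : 0 < x < 1 -> \forall z \near x, 0 < z < 1.
Proof.
move=> xI; have xI' : x \in `]0, 1[ by rewrite in_itv.
by have := near_in_itvoo xI'; apply: filterS => z; rewrite in_itv.
Qed.

End clamp.

Section profile.
Context {R : realType}.
Variables (d : ydomain) (b : R -> R).
Hypothesis hb : smooth_profile d b.

Lemma ydom_itv (y : R) : 0 < y < 1 -> ydom d y.
Proof. by rewrite /ydom; case: d => //= yI; rewrite in_itv. Qed.

Lemma ydom_closed_itv (y : R) : 0 <= y <= 1 -> ydom_closed d y.
Proof. by rewrite /ydom_closed; case: d => //= yI; rewrite in_itv. Qed.

Lemma ydom_subset : @ydom R d `<=` ydom_closed d.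
Proof. by rewrite /ydom /ydom_closed; case: d => //=; exact: subset_itv_oo_cc. Qed.

Lemma iter_derive_nseq k : iter_derive (nseq k (1 : R)) b = derive1n k b.
Proof. by elim: k => //= k ->; apply/funext => x; rewrite derive1E. Qed.

Lemma derive1n_periodic k y : d = Circle -> derive1n k b (y + 1) = derive1n k b y.
Proof.
move=> dC; have [_ /(_ dC) per] := hb.
elim: k y => [|k IH] y; first exact: per.
rewrite /derive1n !iterS -/(derive1n k b) !derive1E /derive.
rewrite IH; suff -> : derive1n k b \o shift (y + 1) = derive1n k b \o shift y by [].
by apply/funext => z /=; rewrite addrA IH.
Qed.

Lemma within_ydom_proper w : 0 <= w <= 1 -> ProperFilter (within (ydom d) (nbhs (w : R))).
Proof.
move=> /andP[w0 w1]; apply: Build_ProperFilter_ex => S [e /= e0 eS].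
(* Moving from [w] towards the midpoint 1/2 by a small proportion [t] lands in the open interval,
   even from an end point. *)
pose t := Num.min (1 / 2) (e / 2).
have t0 : 0 < t by rewrite lt_min !divr_gt0.
have t1 : t <= 1 / 2 by rewrite /t ge_min lexx.
have te : t <= e / 2 by rewrite /t ge_min lexx orbT.
exists ((1 - t) * w + t / 2); apply: eS => /=; last first.
  by apply: ydom_itv; apply/andP; split; nra.
by rewrite ltr_norml; apply/andP; split; nra.
Qed.

(** Each derivative is extended separately up to the end points and then frozen outside [0, 1], so
    [h j] has derivative [h j.+1] in the interior only. The last clause glues the two ends of the
    chart of the circle. *)
Lemma profile_extension : exists h : nat -> R -> R,
  [/\ forall j, continuous (h j),
      forall j (x : R), 0 < x < 1 -> is_derive x 1 (h j) (h j.+1 x),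
      forall y, 0 < y < 1 -> h 0 y = b y,
      forall j w, 0 <= w <= 1 -> profile_derive d b j w = h j w &
      d = Circle -> forall j, h j 1 = h j 0].
Proof.
have [[cb sb] per] := hb.
have /choice[g Hg] : forall k : nat, exists g : R -> R,
    {within ydom_closed d, continuous g} /\
    forall z, ydom d z -> g z = derive1n k b z.
  by move=> k; have [_ [g cg Eg]] := sb (nseq k (1 : R)); exists g; rewrite -iter_derive_nseq.
exists (fun k y => g k (clamp y)); split.
- move=> k; apply: (within_comp (A := ydom_closed d)).
  + exact: (Hg k).1.
  + exact: cts_clamp.
  + by move=> x; apply: ydom_closed_itv; exact: clamp_itv.
- move=> k x xI.
  have xU := ydom_itv xI.
  have xI' : 0 <= x <= 1 by case/andP: xI => ? ?; rewrite !ltW.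
  rewrite clamp_id// (Hg k.+1).2//.
  apply: (@near_eq_is_derive _ _ _ (derive1n k b)).
    have := near_interior xI; apply: filterS => z zI.
    rewrite clamp_id; last by case/andP: zI => ? ?; rewrite !ltW.
    by rewrite (Hg k).2//; exact: ydom_itv.
  have [/(_ x xU) df _] := sb (nseq k (1 : R)).
  rewrite iter_derive_nseq in df.
  apply: DeriveDef; first exact: diff_derivable.
  by rewrite /derive1n iterS derive1E.
- move=> y yI; rewrite clamp_id; last by case/andP: yI => ? ?; rewrite !ltW.
  by rewrite (Hg 0%N).2//; exact: ydom_itv.
- move=> k w wI; rewrite clamp_id// /profile_derive /extend_from.
  have PF := within_ydom_proper wI.
  apply: cvg_lim => //.
  have /subspace_continuousP/(_ w (ydom_closed_itv wI)) cg := (Hg k).1.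
  apply: cvg_trans; last first.
    apply: cvg_trans cg; apply: cvg_app.
    by apply: within_subset; exact: ydom_subset.
  by apply: fmap_within_eq => z /set_mem zU; rewrite -(Hg k).2.
- move=> dC k; have UT z : ydom d z by rewrite dC.
  rewrite !clamp_id ?lexx ?ler01//.
  by rewrite !(Hg k).2// -(derive1n_periodic k 0 dC) add0r.
Qed.

(** On the circle a critical point at 0 has a second copy at 1 in the closed segment, which
    [critical_points] does not list; this is why 1 is added to [Z]. *)
Lemma profile_nondegenerate M (y : 'I_M -> R) (n : 'I_M -> nat) :
  critical_points d b y n ->
  exists (b0 b1 b2 : R -> R) (Z : seq R) (c : R),
    nondegenerate b0 b1 b2 (\max_(i < M) n i) Z c /\
    forall y, 0 < y < 1 -> b0 y = b y.
Proof.
move=> [_ yD yP nP]; have [h [ch dh h0 hE hper]] := profile_extension.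
suff H w : 0 <= w <= 1 -> exists m, [/\ (m <= \max_(i < M) n i)%N,
     forall j, (1 <= j <= m)%N -> h j w = 0, h m.+1 w != 0 &
     (0 < m)%N -> w \in 1 :: codom y].
  have [c nd] := finite_type_nondegenerate ch dh H.
  by exists (h 0), (h 1), (h 2), (1 :: codom y), c.
have main z : ydom_points d z -> 0 <= z <= 1 -> exists m, [/\ (m <= \max_(i < M) n i)%N,
     forall j, (1 <= j <= m)%N -> h j z = 0, h m.+1 z != 0 &
     (0 < m)%N -> z \in codom y].
  move=> zD zI; have [h1|h1] := eqVneq (h 1 z) 0; last first.
    by exists 0; split => // j; case: j.
  have [|i zi] := (yP z zD).1; first by rewrite hE.
  have [n1 nz nnz] := nP i.
  exists (n i); split.
  - exact: leq_bigmax.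
  - by move=> j jn; rewrite -hE// zi nz.
  - rewrite -(hE _ _ zI) zi; exact: nnz.
  - by rewrite zi codom_f.
move=> wI; have [wD|] := pselect (ydom_points d w).
  have [m [? ? ? wy]] := main w wD wI; exists m; split => // /wy wZ.
  by rewrite in_cons wZ orbT.
case: d hper main => [hper main|]; last by rewrite /= in_itv/= wI.
rewrite /= in_itv/= => w1.
have {w1}-> : w = 1.
  by case/andP: wI => w0 w1'; apply/eqP; rewrite eq_le w1'/= leNgt; apply/negP => w1''; apply: w1; rewrite w0.
have [||m [? hz hnz _]] := main 0.
- by rewrite /= in_itv/= lexx ltr01.
- by rewrite lexx ler01.
exists m; split => //.
- by move=> j jm; rewrite hper// hz.
- by rewrite hper.
- by rewrite in_cons eqxx.
Qed.

End profile.

(** * Fourier modes of a solution *)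

(** Conditions on the edges of [0, 1] alone: periodicity becomes the matching of values and of
    normal derivatives. *)
Variant strip_bc := StripPeriodic | StripDirichlet | StripNeumann.

(* A real solution of [P_t + b P_x = nu P_yy]; the arguments are [t], [y], [x]. *)
Record strip_solution {R : realType} (nu : R) (b : R -> R) (bc : strip_bc)
    (P Py Pyy Px : R -> R -> R -> R) : Prop := StripSolution {
  ss_c : continuous3 P ;
  ss_cy : continuous3 Py ;
  ss_cyy : continuous3 Pyy ;
  ss_cx : continuous3 Px ;
  ss_y : forall t y x : R, 0 < t -> 0 < y < 1 ->
    is_derive y 1 (fun y => P t y x) (Py t y x) ;
  ss_yy : forall t y x : R, 0 < t -> 0 < y < 1 ->
    is_derive y 1 (fun y => Py t y x) (Pyy t y x) ;
  ss_x : forall t y x : R, 0 < t -> 0 < y < 1 ->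
    is_derive x 1 (P t y) (Px t y x) ;
  ss_t : forall t y x : R, 0 < t -> 0 < y < 1 ->
    is_derive t 1 (fun t => P t y x) (nu * Pyy t y x - b y * Px t y x) ;
  ss_per : forall t y : R, 0 < t -> 0 < y < 1 -> P t y 1 = P t y 0 ;
  ss_bc : forall t x : R, 0 < t -> match bc with
    | StripPeriodic => P t 1 x = P t 0 x /\ Py t 1 x = Py t 0 x
    | StripDirichlet => P t 1 x = 0 /\ P t 0 x = 0
    | StripNeumann => Py t 1 x = 0 /\ Py t 0 x = 0
    end }.

Section modes.
Context {R : realType}.
Variables (nu : R) (b : R -> R) (bc : strip_bc).
Hypothesis cb : continuous b.

Lemma strip_solutionN P Py Pyy Px : strip_solution nu b bc P Py Pyy Px ->
  strip_solution nu b bc (fun t y x => - P t y x) (fun t y x => - Py t y x)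
    (fun t y x => - Pyy t y x) (fun t y x => - Px t y x).
Proof.
case=> c1 c2 c3 c4 h1 h2 h3 h4 h5 h6; split.
- by rewrite /continuous3; cts.
- by rewrite /continuous3; cts.
- by rewrite /continuous3; cts.
- by rewrite /continuous3; cts.
- by move=> t y x t0 yI; apply: derN; exact: h1.
- by move=> t y x t0 yI; apply: derN; exact: h2.
- by move=> t y x t0 yI; apply: derN; exact: h3.
- move=> t y x t0 yI; apply: der_eq (derN (h4 t y x t0 yI)) _; ring.
- by move=> t y t0 yI; rewrite h5.
- by move=> t x t0; case: bc (h6 t x t0) => [] [-> ->]; rewrite ?oppr0.
Qed.

(* Real part of the Fourier coefficient of [P + i Q] at frequency [k]; the
   imaginary part is [fmode Q (- P) k]. *)
Definition fmode (P Q : R -> R -> R -> R) (k t y : R) : R :=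
  itg 0 1 (fun x => P t y x * cos (k * x) + Q t y x * sin (k * x)).

Lemma cts_fmode P Q k : continuous3 P -> continuous3 Q -> continuous2 (fmode P Q k).
Proof.
move=> cP cQ; rewrite /continuous2 /fmode.
apply: (@cts_itg R _ (fun (z : R * R) x => P z.1 z.2 x * cos (k * x) + Q z.1 z.2 x * sin (k * x))).
by rewrite /continuous2; cts.
Qed.

Lemma is_derive_fmode_y P Py Q Qy (k t y : R) : continuous3 P -> continuous3 Q ->
  continuous3 Py -> continuous3 Qy -> 0 < y < 1 ->
  (forall y x : R, 0 < y < 1 -> is_derive y 1 (fun y => P t y x) (Py t y x)) ->
  (forall y x : R, 0 < y < 1 -> is_derive y 1 (fun y => Q t y x) (Qy t y x)) ->
  is_derive y 1 (fmode P Q k t) (fmode Py Qy k t y).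
Proof.
move=> cP cQ cPy cQy yI dP dQ.
apply: (@is_derive_itg_param R
  (fun y x => P t y x * cos (k * x) + Q t y x * sin (k * x))
  (fun y x => Py t y x * cos (k * x) + Qy t y x * sin (k * x))).
- by rewrite /continuous2; cts.
- by rewrite /continuous2; cts.
have := near_interior yI; apply: filterS => z zI x _.
have h1 := dP z x zI; have h2 := dQ z x zI.
by derive; ring.
Qed.

Lemma is_derive_fmode_t P Pt Q Qt (k t y : R) : continuous3 P -> continuous3 Q ->
  continuous3 Pt -> continuous3 Qt -> 0 < t ->
  (forall t x : R, 0 < t -> is_derive t 1 (fun t => P t y x) (Pt t y x)) ->
  (forall t x : R, 0 < t -> is_derive t 1 (fun t => Q t y x) (Qt t y x)) ->
  is_derive t 1 (fun t => fmode P Q k t y) (fmode Pt Qt k t y).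
Proof.
move=> cP cQ cPy cQy t0 dP dQ.
apply: (@is_derive_itg_param R
  (fun t x => P t y x * cos (k * x) + Q t y x * sin (k * x))
  (fun t x => Pt t y x * cos (k * x) + Qt t y x * sin (k * x))).
- by rewrite /continuous2; cts.
- by rewrite /continuous2; cts.
have := near_pos t0; apply: filterS => z zI x _.
have h1 := dP z x zI; have h2 := dQ z x zI.
by derive; ring.
Qed.

Section pair.
Variables (P Py Pyy Px Q Qy Qyy Qx : R -> R -> R -> R) (k : R).
Hypotheses (SP : strip_solution nu b bc P Py Pyy Px)
  (SQ : strip_solution nu b bc Q Qy Qyy Qx).
Hypotheses (cosk : cos k = 1) (sink : sin k = 0).

Let NP t y x := - P t y x.

(** Integration by parts in x: at a frequency with e^(i k) = 1 the boundary terms cancel by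
    periodicity, so d/dx acts as i k. *)
Lemma fmode_x (t y : R) : 0 < t -> 0 < y < 1 ->
  fmode Px Qx k t y = - k * fmode Q NP k t y.
Proof.
move=> t0 yI; have [cP cPx cQ cQx] := And4 (ss_c SP) (ss_cx SP) (ss_c SQ) (ss_cx SQ).
rewrite /fmode; apply/eqP; rewrite -subr_eq0 mulNr opprK -itgZ; last first.
  by rewrite /NP; cts.
rewrite -itgD; [|by cts|by rewrite /NP; cts].
pose F x := P t y x * cos (k * x) + Q t y x * sin (k * x).
have -> : itg 0 1 (fun x => Px t y x * cos (k * x) + Qx t y x * sin (k * x) +
   k * (Q t y x * cos (k * x) + NP t y x * sin (k * x))) = F 1 - F 0.
  apply: itg_FTC => //.
  - by rewrite /F; cts.
  - by rewrite /NP; cts.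
  - move=> x _; have h1 := ss_x SP x t0 yI; have h2 := ss_x SQ x t0 yI.
    by rewrite /F; derive; rewrite /NP; ring.
rewrite /F !mulr1 !mulr0 cosk sink cos0 sin0 (ss_per SP)// (ss_per SQ)//.
by rewrite subrr.
Qed.

Lemma fmodeN F G t y : continuous3 F -> continuous3 G ->
  fmode (fun t y x => - F t y x) (fun t y x => - G t y x) k t y = - fmode F G k t y.
Proof.
move=> cF cG; rewrite /fmode -[RHS]mulN1r -itgZ; last by cts.
by apply: eq_itg => x _; ring.
Qed.

End pair.

Lemma fmode_t P Py Pyy Px Q Qy Qyy Qx (k t y : R) :
  strip_solution nu b bc P Py Pyy Px -> strip_solution nu b bc Q Qy Qyy Qx ->
  cos k = 1 -> sin k = 0 -> 0 < t -> 0 < y < 1 ->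
  is_derive t 1 (fun t => fmode P Q k t y)
    (nu * fmode Pyy Qyy k t y + k * b y * fmode Q (fun t y x => - P t y x) k t y).
Proof.
move=> SP SQ ck sk t0 yI.
have [cP cPx cQ cQx] := And4 (ss_c SP) (ss_cx SP) (ss_c SQ) (ss_cx SQ).
have [cPyy cQyy] := (ss_cyy SP, ss_cyy SQ).
pose Pt t y x := nu * Pyy t y x - b y * Px t y x.
pose Qt t y x := nu * Qyy t y x - b y * Qx t y x.
have D : is_derive t 1 (fun t => fmode P Q k t y) (fmode Pt Qt k t y).
  apply: is_derive_fmode_t => //.
  - by rewrite /continuous3 /Pt; cts.
  - by rewrite /continuous3 /Qt; cts.
  - by move=> s x s0; exact: (ss_t SP).
  - by move=> s x s0; exact: (ss_t SQ).
apply: der_eq D _.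
have -> : k * b y * fmode Q (fun t y x => - P t y x) k t y = - b y * fmode Px Qx k t y.
  by rewrite (fmode_x SP SQ)//; ring.
rewrite /fmode -!itgZ; [|by cts|by cts].
rewrite -itgD; [|by cts|by cts].
by apply: eq_itg => x _; rewrite /Pt /Qt; ring.
Qed.

(** Both components are instances of [fmode]: the imaginary part replaces (P, Q) by (Q, -P), so the
    same derivative lemmas serve twice. *)
Lemma heat_pair_fmode P Py Pyy Px Q Qy Qyy Qx (k : R) :
  strip_solution nu b bc P Py Pyy Px -> strip_solution nu b bc Q Qy Qyy Qx ->
  cos k = 1 -> sin k = 0 ->
  heat_pair nu (fun y => k * b y)
    (fmode P Q k) (fmode Py Qy k) (fmode Pyy Qyy k)
    (fmode Q (fun t y x => - P t y x) k) (fmode Qy (fun t y x => - Py t y x) k)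
    (fmode Qyy (fun t y x => - Pyy t y x) k).
Proof.
move=> SP SQ ck sk; have SN := strip_solutionN SP.
have [cP cQ cN] := And3 (ss_c SP) (ss_c SQ) (ss_c SN).
have [cPy cQy cNy] := And3 (ss_cy SP) (ss_cy SQ) (ss_cy SN).
have [cPyy cQyy cNyy] := And3 (ss_cyy SP) (ss_cyy SQ) (ss_cyy SN).
split.
- exact: cts_fmode.
- exact: cts_fmode.
- exact: cts_fmode.
- exact: cts_fmode.
- exact: cts_fmode.
- exact: cts_fmode.
- move=> t y t0 yI; apply: is_derive_fmode_y => //.
    by move=> z x zI; exact: (ss_y SP).
  by move=> z x zI; exact: (ss_y SQ).
- move=> t y t0 yI; apply: is_derive_fmode_y => //.
    by move=> z x zI; exact: (ss_yy SP).
  by move=> z x zI; exact: (ss_yy SQ).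
- move=> t y t0 yI; apply: is_derive_fmode_y => //.
    by move=> z x zI; exact: (ss_y SQ).
  by move=> z x zI; exact: (ss_y SN).
- move=> t y t0 yI; apply: is_derive_fmode_y => //.
    by move=> z x zI; exact: (ss_yy SQ).
  by move=> z x zI; exact: (ss_yy SN).
- by move=> t y t0 yI; exact: (fmode_t SP SQ).
- move=> t y t0 yI; apply: der_eq (fmode_t SQ SN ck sk t0 yI) _.
  by rewrite (fmodeN k t y cP cQ) mulrN.
Qed.

(** Dirichlet kills the first factor at both edges, Neumann the second, and in the periodic case
    both factors match. *)
Lemma fmode_bc P Py Pyy Px Q Qy Qyy Qx (k t : R) :
  strip_solution nu b bc P Py Pyy Px -> strip_solution nu b bc Q Qy Qyy Qx ->
  0 < t -> fmode P Q k t 1 * fmode Py Qy k t 1 = fmode P Q k t 0 * fmode Py Qy k t 0.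
Proof.
move=> SP SQ t0; have [hP hQ] := (ss_bc SP, ss_bc SQ).
have Z (F G : R -> R -> R -> R) y : (forall x, F t y x = 0) -> (forall x, G t y x = 0) ->
    fmode F G k t y = 0.
  move=> F0 G0; rewrite /fmode; transitivity (itg 0 1 (fun=> 0 : R)).
    by apply: eq_itg => x _; rewrite F0 G0 !mul0r addr0.
  by rewrite itg_cst// mul0r.
case: bc hP hQ => hP hQ.
- congr (_ * _); apply: eq_itg => x _.
    by rewrite (hP t x t0).1 (hQ t x t0).1.
  by rewrite (hP t x t0).2 (hQ t x t0).2.
- have h1 := Z P Q 1 (fun x => (hP t x t0).1) (fun x => (hQ t x t0).1).
  have h0 := Z P Q 0 (fun x => (hP t x t0).2) (fun x => (hQ t x t0).2).
  by rewrite h1 h0 !mul0r.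
- have h1 := Z Py Qy 1 (fun x => (hP t x t0).1) (fun x => (hQ t x t0).1).
  have h0 := Z Py Qy 0 (fun x => (hP t x t0).2) (fun x => (hQ t x t0).2).
  by rewrite h1 h0 !mulr0.
Qed.

End modes.

(** * From space-time smoothness to functions on the strip *)

Section directional.
Context {R : realType} {V1 V : normedModType R}.

(** Along an affine path the two difference quotients are the same function, so no chain rule and no
    differentiability is involved. *)
Lemma derive_along (F : V -> R) (g : V1 -> V) (v1 : V1) (v : V) (z : V1) :
  (forall h : R, g (h *: v1 + z) = h *: v + g z) ->
  'D_v1 (F \o g) z = 'D_v F (g z).
Proof.
move=> gE; rewrite /derive.
suff -> : (fun h : R => h^-1 *: ((F \o shift (g z)) (h *: v) - F (g z))) =
       (fun h : R => h^-1 *: (((F \o g) \o shift z) (h *: v1) - (F \o g) z)) by [].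
by apply/funext => h /=; rewrite gE.
Qed.

Lemma derivable_along (F : V -> R) (g : V1 -> V) (v1 : V1) (v : V) (z : V1) :
  (forall h : R, g (h *: v1 + z) = h *: v + g z) ->
  derivable F (g z) v -> derivable (F \o g) z v1.
Proof.
move=> gE; rewrite /derivable.
suff -> : (fun h : R => h^-1 *: ((F \o shift (g z)) (h *: v) - F (g z))) =
       (fun h : R => h^-1 *: (((F \o g) \o shift z) (h *: v1) - (F \o g) z)) by [].
by apply/funext => h /=; rewrite gE.
Qed.

End directional.

Section solution_to_strip.
Context {R : realType}.
Variables (nu : R) (b b0 : R -> R) (d : ydomain) (s0 : R).
Hypotheses (b0E : forall y, 0 < y < 1 -> b0 y = b y) (s0_gt0 : 0 < s0).

Let V := (R * (R * R))%type.
Let vt : V := (1, (0, 0)).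
Let vx : V := (0, (1, 0)).
Let vy : V := (0, (0, 1)).

(** Time starts at [s0] and both t and y are clamped, so every point lands in the closed space-time
    domain, where [F] is continuous: this gives continuity in all real arguments. *)
Definition strip_point (t y x : R) : V := (s0 + Num.max 0 t, (x, clamp y)).

Lemma strip_point_closed t y x : spacetime_closed d (strip_point t y x).
Proof.
split; first by rewrite /= ltr_wpDr// le_max lexx.
by rewrite /Omega_closed /=; apply: ydom_closed_itv; exact: clamp_itv.
Qed.

Lemma strip_pointE t y x : 0 <= t -> 0 <= y <= 1 ->
  strip_point t y x = (s0 + t, (x, y)).
Proof. by move=> t0 yI; rewrite /strip_point clamp_id// max_r. Qed.

Lemma strip_pointE_oo t y x : 0 < t -> 0 < y < 1 ->
  strip_point t y x = (s0 + t, (x, y)).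
Proof.
move=> t0 /andP[y0 y1]; apply: strip_pointE; first exact: ltW.
by rewrite !ltW.
Qed.

Lemma spacetime_oo (t y x : R) : 0 < t -> 0 < y < 1 -> spacetime d (s0 + t, (x, y)).
Proof. by move=> t0 yI; split; [rewrite /= addr_gt0|exact: ydom_itv]. Qed.

Lemma cts_strip (g : V -> R) : {within spacetime_closed d, continuous g} ->
  continuous3 (fun t y x => g (strip_point t y x)).
Proof.
move=> cg; rewrite /continuous3.
apply: (within_comp (f := fun z : R * R * R => strip_point z.1.1 z.1.2 z.2) cg);
  last by move=> z; exact: strip_point_closed.
have cm : continuous (fun t : R => Num.max 0 t).
  by move=> t; apply: continuous_max; [exact: cst_continuous|exact: cvg_id].
have cc := @cts_clamp R.
have H1 : continuous (fun z : R * R * R => s0 + Num.max 0 z.1.1).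
  apply: ctsD; first exact: cts_cst.
  by apply: (@cts_comp _ _ (fun t : R => Num.max 0 t) (fun z : R * R * R => z.1.1) cm); cts.
have H2 : continuous (fun z : R * R * R => z.2) by cts.
have H3 : continuous (fun z : R * R * R => clamp z.1.2).
  by apply: (@cts_comp _ _ clamp (fun z : R * R * R => z.1.2) cc); cts.
by move=> z; exact: (cvg_pair (H1 z) (cvg_pair (H2 z) (H3 z))).
Qed.

Variable F : V -> R.
Hypothesis sF : smooth_up_to (spacetime d) (spacetime_closed d) F.
Hypothesis eqF : forall z, spacetime d z ->
  'D_vt F z + b z.2.2 * 'D_vx F z - nu * 'D_vy ('D_vy F) z = 0.
Hypothesis perF : forall t x y : R, 0 < t -> ydom_closed d y ->
  F (t, (x + 1, y)) = F (t, (x, y)).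

Definition scalar_bc (bc : boundary_condition) : Prop :=
  forall t x : R, 0 < t -> match bc with
  | Periodic => forall y, F (t, (x, y + 1)) = F (t, (x, y))
  | Dirichlet => F (t, (x, 0)) = 0 /\ F (t, (x, 1)) = 0
  | Neumann =>
    extend_from (Omega UnitInterval) ('D_(ey : R * R) (fun w => F (t, w))) (x, 0) = 0 /\
    extend_from (Omega UnitInterval) ('D_(ey : R * R) (fun w => F (t, w))) (x, 1) = 0
  end.

Definition strip_bc_of (bc : boundary_condition) : strip_bc :=
  match bc with
  | Periodic => StripPeriodic | Dirichlet => StripDirichlet | Neumann => StripNeumann
  end.

Lemma path_y (G : V -> R) (t x y : R) : differentiable G (t, (x, y)) ->
  is_derive y 1 (fun y => G (t, (x, y))) ('D_vy G (t, (x, y))).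
Proof.
move=> dG; pose g (y : R) : V := (t, (x, y)).
have gE h : g (h *: 1 + y) = h *: vy + g y.
  rewrite /g /vy; congr (_, (_, _)) => /=; rewrite ?scaler0 ?add0r//.
apply: DeriveDef; last by rewrite -(derive_along G gE).
by apply: (derivable_along gE); exact: diff_derivable.
Qed.

Lemma path_x (G : V -> R) (t x y : R) : differentiable G (t, (x, y)) ->
  is_derive x 1 (fun x => G (t, (x, y))) ('D_vx G (t, (x, y))).
Proof.
move=> dG; pose g (x : R) : V := (t, (x, y)).
have gE h : g (h *: 1 + x) = h *: vx + g x.
  rewrite /g /vx; congr (_, (_, _)) => /=; rewrite ?scaler0 ?add0r//.
apply: DeriveDef; last by rewrite -(derive_along G gE).
by apply: (derivable_along gE); exact: diff_derivable.
Qed.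

Lemma path_t (G : V -> R) (t x y : R) : differentiable G (s0 + t, (x, y)) ->
  is_derive t 1 (fun t => G (s0 + t, (x, y))) ('D_vt G (s0 + t, (x, y))).
Proof.
move=> dG; pose g (t : R) : V := (s0 + t, (x, y)).
have gE h : g (h *: 1 + t) = h *: vt + g t.
  by rewrite /g /vt; congr (_, (_, _)) => /=; rewrite ?scaler0 ?add0r// addrCA.
apply: DeriveDef; last by rewrite -(derive_along G gE).
by apply: (derivable_along gE); exact: diff_derivable.
Qed.

Lemma within_Omega_proper (x y : R) : 0 <= y <= 1 ->
  ProperFilter (within (Omega UnitInterval) (nbhs ((x, y) : R * R))).
Proof.
move=> yI; apply: Build_ProperFilter_ex => S [[A B] /= [Ax By] AB].
have PF := within_ydom_proper UnitInterval yI.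
have [z [zU zB]] := @filter_ex _ _ PF (fun z => ydom UnitInterval z /\ B z)
  (filterS (fun z Bz zU => conj zU Bz) By).
by exists (x, z); apply: (AB (x, z)) => //; split => //=; exact: nbhs_singleton.
Qed.

(** The Neumann condition speaks of a limit at fixed time, whereas [gY] is a limit in space-time;
    restricting the latter to the slice at time t identifies them. *)
Lemma neumann_extension (gY : V -> R) (t x y : R) : d = UnitInterval ->
  {within spacetime_closed d, continuous gY} ->
  (forall z, spacetime d z -> gY z = 'D_vy F z) -> 0 < t -> 0 <= y <= 1 ->
  extend_from (Omega UnitInterval) ('D_(ey : R * R) (fun w => F (t, w))) (x, y) =
  gY (t, (x, y)).
Proof.
move=> dU cg gE t0 yI; have PF := within_Omega_proper x yI.
rewrite /extend_from; apply: cvg_lim => //.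
have Az : spacetime_closed d (t, (x, y)).
  by split => //; exact: ydom_closed_itv.
move/subspace_continuousP: cg => /(_ _ Az) cg.
have E w : Omega UnitInterval w -> 'D_(ey : R * R) (fun w => F (t, w)) w = gY (t, w).
  move=> wO; rewrite gE; last by split => //; rewrite dU.
  apply: (@derive_along R _ _ F (fun w : R * R => (t, w))) => h.
  by rewrite /vy; congr (_, _) => /=; rewrite ?scaler0 ?add0r.
move=> S /= HS; have [[A B] /= [At Bz] AB] := cg S HS.
have : nbhs ((x, y) : R * R) B by [].
apply: filterS => w Bw wO; rewrite /= E//.
apply: (AB (t, w)); first by split => //=; exact: nbhs_singleton.
split => //; rewrite dU; move: wO; rewrite /Omega /Omega_closed /=.
exact: subset_itv_oo_cc.
Qed.

Lemma strip_of_solution (bc : boundary_condition) :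
  ydomain_of bc = d -> scalar_bc bc ->
  exists Py Pyy Px, strip_solution nu b0 (strip_bc_of bc)
    (fun t y x => F (strip_point t y x)) Py Pyy Px.
Proof.
move=> dE Fbc; have [cF dF] := sF.
have [_ [gY cY EY]] := dF [:: vy].
have [_ [gYY cYY EYY]] := dF [:: vy; vy].
have [_ [gX cX EX]] := dF [:: vx].
have dF0 z : spacetime d z -> differentiable F z by exact: (dF [::]).1.
have dFy z : spacetime d z -> differentiable ('D_vy F) z by exact: (dF [:: vy]).1.
have {}EY z : spacetime d z -> gY z = 'D_vy F z by exact: EY.
have {}EYY z : spacetime d z -> gYY z = 'D_vy ('D_vy F) z by exact: EYY.
have {}EX z : spacetime d z -> gX z = 'D_vx F z by exact: EX.
exists (fun t y x => gY (strip_point t y x)), (fun t y x => gYY (strip_point t y x)),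
  (fun t y x => gX (strip_point t y x)).
have near_y (t y : R) : 0 < t -> 0 < y < 1 -> \forall z \near y, forall x,
    strip_point t z x = (s0 + t, (x, z)).
  by move=> t0 yI; have := near_interior yI; apply: filterS => z zI x; exact: strip_pointE_oo.
split.
- exact: cts_strip.
- exact: cts_strip.
- exact: cts_strip.
- exact: cts_strip.
- move=> t y x t0 yI; have zU := spacetime_oo x t0 yI.
  apply: (@near_eq_is_derive _ _ _ (fun y => F (s0 + t, (x, y)))).
    by have := near_y t y t0 yI; apply: filterS => z ->.
  by have D := path_y (dF0 _ zU); rewrite strip_pointE_oo// EY.
- move=> t y x t0 yI; have zU := spacetime_oo x t0 yI.
  apply: (@near_eq_is_derive _ _ _ (fun y => ('D_vy F) (s0 + t, (x, y)))).
    have := near_interior yI; apply: filterS => z zI.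
    by rewrite strip_pointE_oo// EY//; exact: spacetime_oo.
  by have D := path_y (dFy _ zU); rewrite strip_pointE_oo// EYY.
- move=> t y x t0 yI; have zU := spacetime_oo x t0 yI.
  rewrite strip_pointE_oo// EX// (_ : (fun _ => _) = (fun x => F (s0 + t, (x, y)))).
    exact: (path_x (dF0 _ zU)).
  by apply/funext => z; rewrite strip_pointE_oo.
- move=> t y x t0 yI; have zU := spacetime_oo x t0 yI.
  rewrite !strip_pointE_oo// EX// EYY// b0E//.
  have := eqF zU; rewrite /= => /eqP; rewrite -addrA addr_eq0 opprB => /eqP <-.
  apply: (@near_eq_is_derive _ _ _ (fun t => F (s0 + t, (x, y)))).
    by have := near_pos t0; apply: filterS => z z0; rewrite strip_pointE_oo.
  exact: (path_t (dF0 _ zU)).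
- move=> t y t0 yI; rewrite !strip_pointE_oo//.
  have yA : ydom_closed d y.
    by apply: ydom_closed_itv; case/andP: yI => ? ?; rewrite !ltW.
  by have := perF 0 (addr_gt0 s0_gt0 t0) yA; rewrite add0r.
move=> t x t0; have st0 : 0 < s0 + t by rewrite addr_gt0.
rewrite !strip_pointE ?(ltW t0) ?lexx ?ler01//.
case: bc dE Fbc => dE Fbc; have /= := Fbc (s0 + t) x st0.
- move=> per; split; first by have := per 0; rewrite add0r.
  have U y : spacetime d (s0 + t, (x, y)) by split => //; rewrite -dE.
  rewrite !EY//=.
  have Y y := path_y (dF0 _ (U y)).
  have [_ <-] := Y 1; have [_ <-] := Y 0.
  pose G (y : R) := F (s0 + t, (x, y)).
  rewrite -[RHS](_ : 'D_1 (G \o (fun y : R => y + 1)) (0 : R) = _); last first.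
    by have -> : G \o (fun y => y + 1) = G by apply/funext => y; rewrite /G /= per.
  rewrite (@derive_along R R R G (fun y => y + 1) 1 1 0) ?add0r//.
  by move=> h; rewrite -addrA ?add0r.
- by move=> [-> ->].
move=> [n0 n1]; have NE y0 := @neumann_extension gY (s0 + t) x y0 (esym dE) cY EY st0.
have I1 : 0 <= (1 : R) <= 1 by rewrite ler01 lexx.
have I0 : 0 <= (0 : R) <= 1 by rewrite lexx ler01.
by split; [exact: etrans (esym (NE 1 I1)) n1|exact: etrans (esym (NE 0 I0)) n0].
Qed.

End solution_to_strip.

(** * Trigonometric sums and the L2 norm *)

Section trigonometric_polynomials.
Context {R : realType}.
Implicit Types (P Q : R -> R) (s : seq int) (a c : int -> R).

Lemma cos_sin_freq (n : int) : cos (freq n : R) = 1 /\ sin (freq n : R) = 0.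
Proof.
have N (m : nat) : cos (2 * pi * m%:R : R) = 1 /\ sin (2 * pi * m%:R : R) = 0.
  elim: m => [|m [IH1 IH2]]; first by rewrite mulr0 cos0 sin0.
  rewrite -[m.+1]addn1 natrD mulrDr mulr1 cosD sinD IH1 IH2 cos_2pi sin_2pi.
  by split; ring.
rewrite /freq; case: n => n; first exact: N.
rewrite NegzE mulrNz mulrN cosN sinN; have [-> ->] := N n.+1.
by rewrite oppr0.
Qed.

Lemma freqB m n : freq (m - n) = freq m - freq n :> R.
Proof. by rewrite /freq rmorphB mulrBr. Qed.

Lemma itg_cos_freq n : itg 0 1 (fun x => cos (freq n * x)) = (n == 0)%:R :> R.
Proof.
have [->|n0] := eqVneq n 0.
  transitivity (itg 0 1 (fun=> 1 : R)); last by rewrite itg_cst// subr0 mulr1.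
  by apply: eq_itg => x _; rewrite /freq mulr0 mul0r cos0.
have k0 : (freq n : R) != 0.
  by rewrite /freq !mulf_neq0 ?intr_eq0// gt_eqF// pi_gt0.
have [cn sn] := cos_sin_freq n; move: (freq n) k0 cn sn => k k0 cn sn.
have -> : itg 0 1 (fun x => cos (k * x)) = sin (k * 1) / k - sin (k * 0) / k.
  apply: (@itg_FTC _ (fun x => sin (k * x) / k)) => //; [by cts|by cts|].
  by move=> x _; derive; field.
by rewrite mulr1 mulr0 sn sin0 mul0r subrr.
Qed.

Lemma itg_sin_freq n : itg 0 1 (fun x => sin (freq n * x)) = 0 :> R.
Proof.
have [->|n0] := eqVneq n 0.
  transitivity (itg 0 1 (fun=> 0 : R)); last by rewrite itg_cst// mul0r.
  by apply: eq_itg => x _; rewrite /freq mulr0 mul0r sin0.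
have k0 : (freq n : R) != 0.
  by rewrite /freq !mulf_neq0 ?intr_eq0// gt_eqF// pi_gt0.
have [cn sn] := cos_sin_freq n; move: (freq n) k0 cn sn => k k0 cn sn.
have -> : itg 0 1 (fun x => sin (k * x)) = - cos (k * 1) / k - - cos (k * 0) / k.
  apply: (@itg_FTC _ (fun x => - cos (k * x) / k)) => //; [by cts|by cts|].
  by move=> x _; derive; field.
by rewrite mulr1 mulr0 cn cos0 subrr.
Qed.

(* [coefR P Q k] and [coefR Q (- P) k] are the real and imaginary parts of the
   Fourier coefficient of [P + i Q] at frequency [k]. *)
Definition coefR P Q (k : R) : R :=
  itg 0 1 (fun x => P x * cos (k * x) + Q x * sin (k * x)).

Definition trig_re s a c (x : R) : R :=
  \sum_(n <- s) (a n * cos (freq n * x) - c n * sin (freq n * x)).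

Definition trig_im s a c (x : R) : R :=
  \sum_(n <- s) (a n * sin (freq n * x) + c n * cos (freq n * x)).

Lemma cts_trig_re s a c : continuous (trig_re s a c).
Proof. by apply: cts_sum => n; cts. Qed.

Lemma cts_trig_im s a c : continuous (trig_im s a c).
Proof. by apply: cts_sum => n; cts. Qed.

Lemma itg_cosB (m n : int) : itg 0 1 (fun x => cos ((freq m - freq n) * x)) = (m == n)%:R :> R.
Proof.
rewrite -subr_eq0 -itg_cos_freq; apply: eq_itg => x _; by rewrite freqB.
Qed.

Lemma itg_sinB (m n : int) : itg 0 1 (fun x => sin ((freq m - freq n) * x)) = 0 :> R.
Proof.
rewrite -[RHS](itg_sin_freq (m - n)); apply: eq_itg => x _; by rewrite freqB.
Qed.

Lemma coefR_trig s a c m : coefR (trig_re s a c) (trig_im s a c) (freq m) =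
  \sum_(n <- s) a n * (n == m)%:R.
Proof.
rewrite /coefR; transitivity (itg 0 1 (fun x => \sum_(n <- s)
   (a n * cos ((freq n - freq m) * x) - c n * sin ((freq n - freq m) * x)))).
  apply: eq_itg => x _; rewrite /trig_re /trig_im !mulr_suml -big_split/=.
  by apply: eq_bigr => n _; rewrite (mulrBl x) cosB sinB; ring.
rewrite itg_bigsum; last by move=> n; cts.
apply: eq_bigr => n _; rewrite itgB; [|by cts|by cts].
rewrite !itgZ; [|by cts|by cts].
by rewrite itg_cosB itg_sinB mulr0 subr0.
Qed.

Lemma coefI_trig s a c m :
  coefR (trig_im s a c) (fun x => - trig_re s a c x) (freq m) =
  \sum_(n <- s) c n * (n == m)%:R.
Proof.
rewrite /coefR; transitivity (itg 0 1 (fun x => \sum_(n <- s)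
   (a n * sin ((freq n - freq m) * x) + c n * cos ((freq n - freq m) * x)))).
  apply: eq_itg => x _; rewrite /trig_re /trig_im mulNr !mulr_suml -sumrN -big_split/=.
  by apply: eq_bigr => n _; rewrite (mulrBl x) cosB sinB; ring.
rewrite itg_bigsum; last by move=> n; cts.
apply: eq_bigr => n _; rewrite itgD; [|by cts|by cts].
rewrite !itgZ; [|by cts|by cts].
by rewrite itg_cosB itg_sinB mulr0 add0r.
Qed.

Lemma sum_delta s (F : int -> R) m : uniq s ->
  \sum_(n <- s) F n * (n == m)%:R = if m \in s then F m else 0.
Proof.
move=> us; case: ifPn => ms.
  rewrite (bigD1_seq m)//= eqxx mulr1 big1 ?addr0// => n /negPf ->.
  by rewrite mulr0.
rewrite big_seq big1// => n ns; have [nm|] := eqVneq n m; last by rewrite mulr0.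
by move: ms; rewrite -nm ns.
Qed.

Lemma trig_pairing P Q s a c : continuous P -> continuous Q ->
  itg 0 1 (fun x => P x * trig_re s a c x + Q x * trig_im s a c x) =
  \sum_(n <- s) (a n * coefR P Q (freq n) + c n * coefR Q (fun x => - P x) (freq n)).
Proof.
move=> cP cQ; transitivity (itg 0 1 (fun x => \sum_(n <- s)
    (a n * (P x * cos (freq n * x) + Q x * sin (freq n * x)) +
     c n * (Q x * cos (freq n * x) + - P x * sin (freq n * x))))).
  apply: eq_itg => x _; rewrite /trig_re /trig_im !mulr_sumr -big_split/=.
  by apply: eq_bigr => n _; ring.
rewrite itg_bigsum; last by move=> n; cts.
apply: eq_bigr => n _; rewrite itgD; [|by cts|by cts].
by rewrite !itgZ; [|by cts|by cts].
Qed.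

Lemma parseval_trig s a c : uniq s ->
  itg 0 1 (fun x => trig_re s a c x ^+ 2 + trig_im s a c x ^+ 2) =
  \sum_(n <- s) (a n ^+ 2 + c n ^+ 2).
Proof.
move=> us; have := trig_pairing s a c (@cts_trig_re s a c) (@cts_trig_im s a c).
under eq_itg do rewrite -!expr2; move=> ->.
rewrite big_seq [RHS]big_seq; apply: eq_bigr => n ns.
by rewrite coefR_trig coefI_trig !sum_delta// ns !expr2.
Qed.

(** Expand the nonnegative squared distance to the trigonometric sum whose coefficients are those of
    P + i Q. *)
Lemma bessel P Q s : uniq s -> continuous P -> continuous Q ->
  \sum_(n <- s) (coefR P Q (freq n) ^+ 2 + coefR Q (fun x => - P x) (freq n) ^+ 2) <=
  itg 0 1 (fun x => P x ^+ 2 + Q x ^+ 2).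
Proof.
move=> us cP cQ; pose a n := coefR P Q (freq n).
pose c n := coefR Q (fun x => - P x) (freq n).
have c1 := @cts_trig_re s a c; have c2 := @cts_trig_im s a c.
have pos : 0 <= itg 0 1 (fun x => (P x - trig_re s a c x) ^+ 2 +
                            (Q x - trig_im s a c x) ^+ 2).
  by apply: itg_ge0 => [|x _]; [cts|rewrite addr_ge0 ?sqr_ge0].
have E : itg 0 1 (fun x => (P x - trig_re s a c x) ^+ 2 +
                      (Q x - trig_im s a c x) ^+ 2) =
  itg 0 1 (fun x => P x ^+ 2 + Q x ^+ 2) -
  2 * itg 0 1 (fun x => P x * trig_re s a c x + Q x * trig_im s a c x) +
  itg 0 1 (fun x => trig_re s a c x ^+ 2 + trig_im s a c x ^+ 2).
  rewrite -itgZ; last by cts.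
  rewrite -itgB; [|by cts|by cts].
  rewrite -itgD; [|by cts|by cts].
  by apply: eq_itg => x _; ring.
move: pos; rewrite E parseval_trig// trig_pairing//.
have -> : \sum_(n <- s) (a n * coefR P Q (freq n) + c n * coefR Q (fun x => - P x) (freq n)) =
    \sum_(n <- s) (a n ^+ 2 + c n ^+ 2) by apply: eq_bigr => n _; rewrite !expr2.
by move: (itg _ _ _) (\sum_(n <- s) _) => I S; lra.
Qed.

End trigonometric_polynomials.

(** * The L2 norm as an iterated integral *)

Section square_norm.
Context {R : realType}.
Local Notation mR := (measurableTypeR R).
Local Notation mu := (@lebesgue_measure R).

Lemma rational_box (W : set (R * R)) (z : R * R) : nbhs z W ->
  exists p q r s : rat, [/\ ratr p < z.1 < ratr q, ratr r < z.2 < ratr s &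
    forall w : R * R, ratr p < w.1 < ratr q -> ratr r < w.2 < ratr s -> W w].
Proof.
case: z => x y [[A B] /= [[e /= e0 Ae] [e' /= e'0 Be]] AB].
have [p] := @rat_in_itvoo R (x - e) x (ltac:(by rewrite ltrBlDr ltrDl)).
have [q] := @rat_in_itvoo R x (x + e) (ltac:(by rewrite ltrDl)).
have [r] := @rat_in_itvoo R (y - e') y (ltac:(by rewrite ltrBlDr ltrDl)).
have [s] := @rat_in_itvoo R y (y + e') (ltac:(by rewrite ltrDl)).
rewrite !in_itv/= => /andP[s1 s2] /andP[r1 r2] /andP[q1 q2] /andP[p1 p2].
exists p, q, r, s; split; [by rewrite p2|by rewrite r2|].
move=> [w1 w2] /= /andP[a1 a2] /andP[b1 b2]; apply: AB; split => /=.
  by apply: Ae => /=; rewrite ltr_norml; apply/andP; split; lra.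
by apply: Be => /=; rewrite ltr_norml; apply/andP; split; lra.
Qed.

(** Measurability is for the product sigma-algebra; an open set belongs to it as a countable union
    of rational boxes. *)
Lemma continuous_measurable_prod (F : R * R -> R) : continuous F ->
  measurable_fun [set: mR * mR] (F : mR * mR -> mR).
Proof.
move=> cF mD; apply: (measurability _ (RGenOInfty.measurableE R)) => //.
move=> /= _ [_ [a ->] <-]; rewrite setTI preimage_itvoy.
pose W := [set z : R * R | a < F z].
pose box (p q r s : rat) : set (mR * mR) :=
  `]ratr p, ratr q[%classic `*` `]ratr r, ratr s[%classic.
pose piece p q r s := if pselect (box p q r s `<=` W) then box p q r s else set0.
suff -> : [set x | a < F x] = \bigcup_(p : rat) \bigcup_(q : rat) \bigcup_(r : rat) \bigcup_(s : rat)
    piece p q r s.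
  have meas (H : rat -> set (mR * mR)) : (forall p, measurable (H p)) ->
    measurable (\bigcup_p H p) by exact: bigcupT_measurable_rat.
  apply: (meas) => p; apply: (meas) => q; apply: (meas) => r; apply: (meas) => s.
  rewrite /piece; case: (pselect (box p q r s `<=` W)) => [sub|nsub];
    last exact: measurable0.
  by apply: measurableX; exact: measurable_itv.
apply/seteqP; split => [z Wz|z [p _ [q _ [r _ [s _]]]]]; last first.
  by rewrite /piece; case: (pselect (box p q r s `<=` W)) => [sub /sub|].
have nW : nbhs z W.
  have oW : open W by apply: open_comp (@open_gt R a) => w _; exact: cF.
  exact: open_nbhs_nbhs.
have [p [q [r [s [h1 h2 h3]]]]] := rational_box nW.
exists p => //; exists q => //; exists r => //; exists s => //.
rewrite /piece; case: (pselect (box p q r s `<=` W)) => [sub|]; first by split; rewrite /= in_itv.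
by case=> w [/=]; rewrite !in_itv => w1 w2; exact: h3.
Qed.

Lemma itg_EFin (f : R -> R) : continuous f ->
  (\int[mu]_(x in `[0%R, 1%R]) (f x)%:E)%E = (itg 0 1 f)%:E.
Proof.
move=> cf; rewrite /itg /Rintegral fineK//.
exact: (integrable_fin_num _ (continuous_integrable 0 1 cf)).
Qed.

Lemma itg_mkcond (f : R -> R) : continuous f ->
  (\int[mu]_x (\1_(`[0, 1]%classic : set R) x * f x)%:E)%E = (itg 0 1 f)%:E.
Proof.
move=> cf; rewrite -itg_EFin// [RHS]integral_mkcond; apply: eq_integral => x _.
by rewrite patchE indicE; case: ifPn => xI; rewrite ?mul1r ?mul0r.
Qed.

Definition sqnorm (P Q : R -> R -> R) : R :=
  itg 0 1 (fun y => itg 0 1 (fun x => P y x ^+ 2 + Q y x ^+ 2)).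

Lemma sqnorm_ge0 P Q : continuous2 P -> continuous2 Q -> 0 <= sqnorm P Q.
Proof.
move=> cP cQ; apply: itg_ge0 => [|y _].
  by apply: cts_itg; rewrite /continuous2; cts.
by apply: itg_ge0 => [|x _]; [cts|rewrite addr_ge0 ?sqr_ge0].
Qed.

Lemma indic0 (A : set R) (x : R) : ~ A x -> \1_A x = 0 :> R.
Proof. by move=> Ax; rewrite indicE memNset. Qed.

Lemma measurable_cell : measurable (cell : set (mR * mR)).
Proof. by apply: measurableX; exact: measurable_itv. Qed.

(** Tonelli on the unit cell. [P] and [Q] are continuous everywhere and need to agree with [h] on
    the cell only, so clamped extensions are admissible. *)
Lemma L2normE (h : R * R -> R[i]) (P Q : R -> R -> R) :
  continuous2 P -> continuous2 Q ->
  (forall x y, 0 <= x <= 1 -> 0 <= y <= 1 ->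
     complex.Re (h (x, y)) = P y x /\ complex.Im (h (x, y)) = Q y x) ->
  L2norm h = (Num.sqrt (sqnorm P Q))%:E.
Proof.
move=> cP cQ hE; rewrite /L2norm unlock.
pose S y x := P y x ^+ 2 + Q y x ^+ 2.
have cS : continuous2 S by rewrite /continuous2 /S; cts.
have S0 y x : 0 <= S y x by rewrite addr_ge0 ?sqr_ge0.
pose I01 := `[0, 1]%classic : set R.
pose G (z : R * R) : \bar R := ((\1_I01 z.2 : R) * ((\1_I01 z.1 : R) * S z.2 z.1))%:E.
transitivity (poweR (\int[(leb \x leb)%E]_z G z)%E 2^-1).
  congr (poweR _ _); apply: eq_integral => -[x y] _ /=.
  rewrite /G /=; have [xyI|xyI] := pselect (cell (x, y)); last first.
    rewrite (_ : \1_cell (x, y) = 0); last by rewrite indicE memNset.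
    rewrite mul0r normr0 powR0 ?pnatr_eq0//; congr (_%:E).
    have [yI|yI] := pselect (I01 y); last by rewrite (indic0 yI) mul0r.
    have [xI|xI] := pselect (I01 x); last by rewrite (indic0 xI) mul0r mulr0.
    by exfalso; apply: xyI; split.
  have [/= xI yI] := xyI.
  rewrite !indicE !mem_set// !mul1r powR_mulrn ?normr_ge0//.
  rewrite real_normK ?num_real//.
  rewrite /= in_itv/= in xI; rewrite /= in_itv/= in yI.
  have [hx hy] := hE x y xI yI.
  rewrite /normc; case: (h (x, y)) hx hy => re im /= -> ->.
  by rewrite sqr_sqrtr// addr_ge0 ?sqr_ge0.
rewrite fubini_tonelli2; last 2 first.
- apply/measurable_EFinP; apply: measurable_funM.
    apply: (@measurableT_comp _ _ _ _ _ _ (\1_I01 : mR -> mR) _ snd) => //.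
    by apply: measurable_indic; exact: measurable_itv.
  apply: measurable_funM.
    apply: (@measurableT_comp _ _ _ _ _ _ (\1_I01 : mR -> mR) _ fst) => //.
    by apply: measurable_indic; exact: measurable_itv.
  apply: (@continuous_measurable_prod (fun z => S z.2 z.1)).
  by cts.
- by move=> z; rewrite lee_fin !mulr_ge0.
have -> : (\int[leb]_y fubini_G leb G y =
    \int[mu]_y (\1_I01 y * itg 0 1 (S y))%:E)%E.
  apply: eq_integral => y _; rewrite /fubini_G /G /=.
  have cSy : continuous (S y) by exact: cts_section.
  under eq_integral do rewrite EFinM.
  rewrite ge0_integralZl//.
  + by rewrite itg_mkcond// -EFinM.
  + apply/measurable_EFinP; apply: measurable_funM.
      by apply: measurable_indic; exact: measurable_itv.
    by apply: continuous_measurable_fun.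
  + by move=> x _; rewrite lee_fin mulr_ge0.
rewrite itg_mkcond; last exact: cts_itg.
by rewrite poweR_EFin powR12_sqrt// sqnorm_ge0.
Qed.

End square_norm.

(** * Uniform limits and pointwise bounds *)

Section uniform_limits.
Context {R : realType}.

(** The telescoping bound gives S_L - w_L <= S_K + w_K for all K and L, so the infimum of the upper
    ends lies in every interval [S_K - w_K, S_K + w_K]. *)
Lemma uniform_limit {T : topologicalType} (S : nat -> T -> R) (w : nat -> R) :
  (forall K, 0 <= w K) -> (forall e, 0 < e -> exists K, w K < e) ->
  (forall K, continuous (S K)) ->
  (forall K z, `|S K.+1 z - S K z| <= w K - w K.+1) ->
  exists g : T -> R, continuous g /\ forall K z, `|g z - S K z| <= w K.
Proof.
move=> w0 wlim cS dS.
have mono (K L : nat) z : (K <= L)%N -> `|S L z - S K z| <= w K - w L.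
  move=> /subnK <-; elim: (L - K)%N => [|m IH]; first by rewrite add0n !subrr normr0.
  rewrite addSn; have := dS (m + K)%N z => D.
  rewrite (_ : S (m + K).+1 z - S K z =
    (S (m + K).+1 z - S (m + K)%N z) + (S (m + K)%N z - S K z)); last by ring.
  by apply: le_trans (ler_normD _ _) _; lra.
pose A z : set R := [set r | exists K : nat, r = S K z + w K].
have lbA z K : lbound (A z) (S K z - w K).
  move=> _ [L ->]; have [KL|/ltnW LK] := leqP K L.
    have := mono K L z KL; rewrite ler_norml => /andP[h _].
    by have := w0 L; lra.
  have := mono L K z LK; rewrite ler_norml => /andP[_ h].
  by have := w0 K; lra.
pose g z := inf (A z).
have gS K z : `|g z - S K z| <= w K.
  have h1 : S K z - w K <= g z.
    by apply: lb_le_inf; [exists (S 0%N z + w 0%N), 0%N|exact: lbA].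
  have h2 : g z <= S K z + w K.
    by apply: ge_inf; [exists (S 0%N z - w 0%N); exact: (lbA z 0%N)|exists K].
  by rewrite ler_norml; apply/andP; split; lra.
exists g; split => // z; apply/cvgrPdist_lt => e e0.
have e30 : 0 < e / 3 by rewrite divr_gt0.
have [K HK] := wlim _ e30.
have /cvgrPdist_lt/(_ _ e30) := cS K z; apply: filterS => y Hy.
rewrite (_ : g z - g y = (g z - S K z) + (S K z - S K y) + - (g y - S K y)); last by ring.
apply: le_lt_trans (ler_normD _ _) _; rewrite normrN.
have := ler_normD (g z - S K z) (S K z - S K y).
by have := gS K z; have := gS K y; lra.
Qed.

Lemma inv_succ_lt (M e : R) : 0 <= M -> 0 < e -> exists K : nat, M / K.+1%:R < e.
Proof.
move=> M0 e0; exists (Num.truncn (M / e)).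
rewrite ltr_pdivrMr// mulrC -ltr_pdivrMr//.
by have /andP[_] := truncn_itv (divr_ge0 M0 (ltW e0)).
Qed.

(** Enumerates the integers in pairs: as [Negz j] is -(j + 1), level j adds j and -(j + 1), and
    every integer occurs exactly once. *)
Fixpoint idx (K : nat) : seq int :=
  if K is K'.+1 then [:: Posz K', Negz K' & idx K'] else [::].

Lemma mem_idx K n : (n \in idx K) = (match n with Posz j => j < K | Negz j => j < K end)%N.
Proof.
elim: K => [|K IH]; first by case: n.
rewrite /= !in_cons IH; case: n {IH} => j; rewrite ltnS [in RHS]leq_eqVlt.
  by rewrite (_ : (Posz j == Negz K) = false).
by rewrite (_ : (Negz j == Posz K) = false).
Qed.

Lemma uniq_idx K : uniq (idx K).
Proof.
by elim: K => //= K IH; rewrite IH in_cons !mem_idx !ltnn.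
Qed.

(** The m-th power of x / m <= e^(x / m). *)
Lemma pow_le_expR (m : nat) (x : R) : (0 < m)%N -> 0 <= x ->
  x ^+ m <= m%:R ^+ m * expR x.
Proof.
move=> m0 x0; have m0' : 0 < m%:R :> R by rewrite ltr0n.
have -> : expR x = expR (x / m%:R) ^+ m.
  by rewrite -expRM_natl mulrC divfK// gt_eqF.
have y0 : 0 <= m%:R * expR (x / m%:R) by rewrite mulr_ge0 ?expR_ge0.
rewrite -exprMn; apply: lerXn2r => //; rewrite mulrC -ler_pdivrMr//.
by apply: le_trans (expR_ge1Dx _); rewrite lerDr.
Qed.

End uniform_limits.

Section pointwise_bound.
Context {R : realType}.

(** The oscillation of u^2 + v^2 is at most the integral of 2 |u u'| + 2 |v v'|, split by the
    weighted inequality 2 |p q| <= p^2 / eps + eps q^2; averaging over the comparison point [z]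
    gives the first term. *)
Lemma pointwise_le (u u' v v' : R -> R) (eps y : R) : 0 < eps -> 0 <= y <= 1 ->
  continuous u -> continuous u' -> continuous v -> continuous v' ->
  (forall y : R, 0 < y < 1 -> is_derive y 1 u (u' y)) ->
  (forall y : R, 0 < y < 1 -> is_derive y 1 v (v' y)) ->
  u y ^+ 2 + v y ^+ 2 <= itg 0 1 (fun y => u y ^+ 2 + v y ^+ 2) +
    itg 0 1 (fun y => u y ^+ 2 + v y ^+ 2) / eps +
    eps * itg 0 1 (fun y => u' y ^+ 2 + v' y ^+ 2).
Proof.
move=> e0 yI cu cu' cv cv' du dv.
pose E := itg 0 1 (fun y => u y ^+ 2 + v y ^+ 2).
pose D := itg 0 1 (fun y => u' y ^+ 2 + v' y ^+ 2).
rewrite -/E -/D.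
pose w y := u y ^+ 2 + v y ^+ 2.
pose w' y := 2 * (u y * u' y + v y * v' y).
have cw : continuous w by rewrite /w; cts.
have cw' : continuous w' by rewrite /w'; cts.
have osc z : 0 <= z <= 1 -> w y <= w z + (E / eps + eps * D).
  move=> zI; rewrite -lerBlDl; apply: le_trans (ler_norm _) _.
  apply: le_trans (@osc_le R 0 1 (lexx 0) (lexx 1) w w' y z cw cw' _ yI zI) _.
    move=> x xI; have h1 := du x xI; have h2 := dv x xI.
    by rewrite /w /w'; derive; ring.
  have -> : E / eps + eps * D = itg 0 1 (fun y =>
      eps^-1 * (u y ^+ 2 + v y ^+ 2) + eps * (u' y ^+ 2 + v' y ^+ 2)).
    by rewrite itgD; [rewrite !itgZ; [rewrite mulrC|cts|cts]|cts|cts].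
  apply: le_itg; [by cts|by cts|move=> x _].
  have amgm (p q : R) : `|2 * (p * q)| <= eps^-1 * p ^+ 2 + eps * q ^+ 2.
    rewrite -subr_ge0.
    have ei : 0 < eps^-1 by rewrite invr_gt0.
    rewrite normrM (ger0_norm (ler0n _ 2)) normrM.
    have -> : eps^-1 * p ^+ 2 + eps * q ^+ 2 - 2 * (`|p| * `|q|) =
       eps^-1 * (`|p| - eps * `|q|) ^+ 2.
      rewrite -[p ^+ 2](real_normK (num_real p)) -[q ^+ 2](real_normK (num_real q)).
      by field; rewrite gt_eqF.
    by rewrite mulr_ge0 ?sqr_ge0// ltW.
  rewrite /w' mulrDr; apply: le_trans (ler_normD _ _) _.
  by have := amgm (u x) (u' x); have := amgm (v x) (v' x); lra.
rewrite -addrA -lerBlDr.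
have -> : w y - (E / eps + eps * D) = itg 0 1 (fun=> w y - (E / eps + eps * D)).
  by rewrite itg_cst// subr0 mulr1.
apply: le_itg; [by cts|exact: cw|move=> z /andP[z0 z1]].
by rewrite lerBlDr; apply: osc; rewrite !ltW.
Qed.

End pointwise_bound.

Section L2_triangle.
Context {R : realType}.
Local Notation mR := (measurableTypeR R).
Implicit Types h : R * R -> R[i].

Definition cell_measurable h :=
  measurable_fun (cell : set (mR * mR)) (fun z => complex.Re (h z)) /\
  measurable_fun (cell : set (mR * mR)) (fun z => complex.Im (h z)).

Lemma cell_measurableB h1 h2 : cell_measurable h1 -> cell_measurable h2 ->
  cell_measurable (fun z => h1 z - h2 z).
Proof.
move=> [r1 i1] [r2 i2]; split.
- rewrite (_ : (fun z => _) = (fun z => complex.Re (h1 z) - complex.Re (h2 z))).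
    exact: measurable_funB.
  by apply/funext => z; case: (h1 z) (h2 z) => ? ? [].
- rewrite (_ : (fun z => _) = (fun z => complex.Im (h1 z) - complex.Im (h2 z))).
    exact: measurable_funB.
  by apply/funext => z; case: (h1 z) (h2 z) => ? ? [].
Qed.

Lemma cell_measurable_norm h : cell_measurable h ->
  measurable_fun [set: mR * mR] (fun z => \1_cell z * normc (h z) : mR).
Proof.
move=> [mr mi].
have -> : (fun z => \1_cell z * normc (h z)) = (fun z => normc (h z)) \_ (cell : set (mR * mR)).
  by apply/funext => z; rewrite patchE indicE; case: ifP => zc; rewrite ?mul1r ?mul0r.
apply/(measurable_restrictT _ measurable_cell).
rewrite (_ : (fun z => normc _) =
  (fun z => Num.sqrt (complex.Re (h z) ^+ 2 + complex.Im (h z) ^+ 2))); last first.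
  by apply/funext => z; rewrite /normc; case: (h z).
apply: (@measurableT_comp _ _ _ _ _ _ (@Num.sqrt R : mR -> mR)).
  by apply: continuous_measurable_fun; exact: sqrt_continuous.
by apply: measurable_funD; exact: measurable_funX.
Qed.

(** Minkowski for the moduli, combined with |h1| <= |h1 - h2| + |h2|. It is what allows comparison
    with a merely square-integrable state at time 0. *)
Lemma L2norm_le_add h1 h2 : cell_measurable h1 -> cell_measurable h2 ->
  (L2norm h1 <= L2norm (fun z => h1 z - h2 z)%R + L2norm h2)%E.
Proof.
move=> m1 m2; have m12 := cell_measurableB m1 m2.
have n1 := cell_measurable_norm m1; have n2 := cell_measurable_norm m2.
have n12 := cell_measurable_norm m12.
have one2 : 1 <= 2 :> R by rewrite ler1n.
have := minkowski_EFin (leb \x leb)%E n12 n2 one2.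
apply: le_trans; rewrite /L2norm unlock.
have P (w : mR * mR -> mR) : measurable_fun [set: mR * mR] w ->
    measurable_fun [set: mR * mR] (fun z => poweR (`|(w z)%:E|)%E 2).
  move=> mw.
  rewrite (_ : (fun z => _) = (fun z => (`|w z| `^ 2)%:E))//.
  apply/measurable_EFinP.
  apply: (@measurableT_comp _ _ _ _ _ _ (@powR R ^~ 2 : mR -> mR)) => //.
  exact: measurableT_comp.
apply: gt0_ler_poweR; rewrite ?invr_ge0 ?in_itv/= ?leey ?andbT ?integral_ge0//.
apply: ge0_le_integral => //.
- exact: P.
- by apply: P; exact: measurable_funD.
- move=> z _ /=; rewrite lee_fin; apply: ge0_ler_powR; rewrite ?nnegrE//.
  have normc0 (c : R[i]) : 0 <= normc c by case: c => a b; exact: sqrtr_ge0.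
  have i0 : 0 <= \1_(cell : set (R * R)) z :> R by rewrite indicE ler0n.
  rewrite !ger0_norm ?addr_ge0 ?mulr_ge0// -mulrDr ler_wpM2l//.
  rewrite -[X in normc X](subrK (h2 z)); exact: le_normcD.
Qed.

End L2_triangle.

(** * The multiplier *)

Section mode_decay.
Context {R : realType}.

Definition rate (N : nat) (nu k : R) : R :=
  nu `^ ((N%:R + 1) / (N%:R + 3)) * k `^ (2 / (N%:R + 3)).

Lemma rate_ge0 N nu k : 0 <= rate N nu k.
Proof. by rewrite mulr_ge0 ?powR_ge0. Qed.

(** l^2 = (nu / k)^(2/(N+3)), and 1 - 2/(N+3) = (N+1)/(N+3). *)
Lemma rate_scale (N : nat) (nu k : R) : 0 < nu -> 0 < k ->
  let l := (nu / k) `^ (N%:R + 3)^-1 in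
  k * l ^+ (N + 3) = nu /\ nu / l ^+ 2 = rate N nu k.
Proof.
move=> nu0 k0 l; have N0 : N%:R + 3 != 0 :> R by rewrite gt_eqF// ltr_wpDl.
have q0 : 0 < nu / k by rewrite divr_gt0.
split.
  rewrite /l -powR_mulrn ?powR_ge0// -powRrM natrD mulVf// powRr1 ?ltW//.
  by field; rewrite gt_eqF.
rewrite /l -powR_mulrn ?powR_ge0// -powRrM mulrC -powRN.
rewrite (mulrC _ 2%:R) powRM ?invr_ge0 ?ltW//.
rewrite -(powR_inv1 (ltW k0)) -powRrM mulN1r opprK mulrAC -{2}(powRr1 (ltW nu0)).
rewrite -powRD; last by apply/implyP => _; rewrite gt_eqF.
by rewrite /rate; congr (_ `^ _ * _); field.
Qed.

Lemma freq_neq0 (n : int) : n != 0 -> (freq n : R) != 0.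
Proof. by move=> n0; rewrite /freq !mulf_neq0 ?intr_eq0// gt_eqF// pi_gt0. Qed.

Lemma norm_freq (n : int) : `|freq n : R| = 2 * pi * `|n|%N%:R.
Proof.
rewrite /freq normrM ger0_norm ?mulr_ge0 ?pi_ge0//; congr (_ * _).
by rewrite natr_absz intr_norm.
Qed.

Lemma norm_freq_ge (n : int) : `|n|%N%:R <= `|freq n : R|.
Proof.
rewrite norm_freq ler_peMl ?ler0n//.
by have := @pi_ge2 R; lra.
Qed.

Lemma norm_freq_ge1 (n : int) : n != 0 -> 1 <= `|freq n : R|.
Proof.
by move=> n0; apply: le_trans (norm_freq_ge n); rewrite ler1n absz_gt0.
Qed.

Definition mode_energy (P Q : R -> R -> R -> R) (n : int) (t : R) : R :=
  energy (fmode P Q (freq n)) (fmode Q (fun t y x => - P t y x) (freq n)) t.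

(** Nonzero frequencies satisfy k >= 1, so nu < 1 gives l <= 1; negative ones are conjugated. At
    frequency 0 the rate is 0 and the claim is monotonicity of the energy. *)
Lemma strip_mode_decay (b b1 b2 : R -> R) N Z c : nondegenerate b b1 b2 N Z c ->
  exists C d : R, [/\ 1 <= C, 0 < d &
  forall nu bc P Py Pyy Px Q Qy Qyy Qx, 0 < nu < 1 ->
    strip_solution nu b bc P Py Pyy Px -> strip_solution nu b bc Q Qy Qyy Qx ->
  forall (n : int) (t : R), 0 <= t ->
    mode_energy P Q n t <=
    C * expR (- (d * rate N nu `|freq n| * t)) * mode_energy P Q n 0].
Proof.
move=> nd; have [C [d [C1 d0 H]]] := energy_decay nd.
exists C, d; split => // nu bc P Py Pyy Px Q Qy Qyy Qx /andP[nu0 nu1] SP SQ n t t0.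
have cb := nd_cb nd.
have [cn sn] := @cos_sin_freq R n.
have HP := heat_pair_fmode cb SP SQ cn sn.
have bcu s := @fmode_bc R nu b bc P Py Pyy Px Q Qy Qyy Qx (freq n) s SP SQ.
have bcv s := @fmode_bc R nu b bc _ _ _ _ _ _ _ _ (freq n) s SQ (strip_solutionN SP).
have E0 := energy_ge0 HP.
have [n0|n0] := eqVneq n 0.
  rewrite /rate n0 /freq mulr0 normr0 powR0; last first.
    by rewrite mulf_neq0 ?invr_eq0// gt_eqF// ltr_wpDl.
  rewrite !mulr0 mul0r oppr0 expR0 mulr1.
  apply: le_trans (_ : mode_energy P Q 0 0 <= _); last first.
    by rewrite ler_peMl//; move: (E0 0); rewrite n0.
  move: HP bcu bcv; rewrite n0 => HP bcu bcv.
  apply: (energy_nincr nu0 HP _ bcu bcv) => //.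
  by cts.
have k0 : 0 < `|freq n : R| by rewrite normr_gt0 freq_neq0.
have [kl lE] := rate_scale N nu0 k0.
have k1 := @norm_freq_ge1 n n0.
set l := _ `^ _ in kl lE.
have l0 : 0 < l by rewrite powR_gt0// divr_gt0.
have l1 : l <= 1.
  apply: le_trans (_ : 1 `^ (N%:R + 3)^-1 <= _); last by rewrite powR1.
  apply: ge0_ler_powR; rewrite ?nnegrE ?ler01//.
  - by rewrite divr_ge0// ltW.
  - by rewrite ler_pdivrMr// mul1r; apply: ltW; exact: lt_le_trans k1.
rewrite -lE; have [kp|kn] := leP 0 (freq n : R).
  have kE : `|freq n| = freq n :> R by exact: ger0_norm.
  rewrite kE in kl k0.
  exact: (H nu (freq n) l _ _ _ _ _ _ nu0 k0 l0 l1 kl HP bcu bcv t t0).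
have kE : `|freq n| = - freq n :> R by exact: ltr0_norm.
rewrite kE in kl k0.
have HR := heat_pair_reflect HP.
have BE : (fun y => - (freq n * b y)) = (fun y => - freq n * b y).
  by apply/funext => y; rewrite mulNr.
rewrite BE in HR.
have EE s : energy (fmode P Q (freq n))
    (fun t y => - fmode Q (fun t y x => - P t y x) (freq n) t y) s = mode_energy P Q n s.
  by apply: eq_itg => y _; rewrite sqrrN.
have HH := H nu (- freq n) l _ _ _ _ _ _ nu0 k0 l0 l1 kl HR bcu.
rewrite -!EE; apply: HH => // s s0.
by rewrite !mulrNN bcv.
Qed.

End mode_decay.

Section strip_modes.
Context {R : realType}.
Implicit Types P Q : R -> R -> R -> R.

Lemma cts_section3 P (t y : R) : continuous3 P -> continuous (P t y).
Proof.
move=> cP; apply: (cts_triple (f := fun=> t) (g := fun=> y) (h := fun x => x) cP); cts.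
Qed.

Lemma mode_bessel P Q (s : seq int) t : uniq s -> continuous3 P -> continuous3 Q ->
  \sum_(n <- s) mode_energy P Q n t <= sqnorm (P t) (Q t).
Proof.
move=> us cP cQ; rewrite /mode_energy /energy.
have cf n : continuous (fun y => fmode P Q (freq n) t y ^+ 2 +
    fmode Q (fun t y x => - P t y x) (freq n) t y ^+ 2).
  have c1 := @cts_fmode R P Q (freq n) cP cQ.
  have cN : continuous3 (fun t y x => - P t y x) by rewrite /continuous3; cts.
  have c2 := @cts_fmode R Q _ (freq n) cQ cN.
  by cts.
rewrite -itg_bigsum//; apply: le_itg => [|| y _].
- exact: cts_sum.
- by apply: cts_itg; rewrite /continuous2; cts.
- by apply: (bessel us); exact: cts_section3.
Qed.

Lemma mode_energy_le P Q n t : continuous3 P -> continuous3 Q ->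
  mode_energy P Q n t <= sqnorm (P t) (Q t).
Proof. by move=> cP cQ; have := @mode_bessel P Q [:: n] t isT cP cQ; rewrite big_seq1. Qed.

Variables (nu : R) (b : R -> R) (bc : strip_bc).
Variables (P Py Pyy Px Q Qy Qyy Qx : R -> R -> R -> R).
Hypotheses (SP : strip_solution nu b bc P Py Pyy Px)
  (SQ : strip_solution nu b bc Q Qy Qyy Qx).

(* Energy decay is upgraded to pointwise decay by interpolation with the
   dissipation, which Bessel's inequality bounds uniformly in the frequency. *)
Lemma mode_pointwise (C t : R) (a : int -> R) : continuous b -> 0 <= C -> 0 < t ->
  (forall n, 0 <= a n) ->
  (forall n, mode_energy P Q n t <= C * expR (- a n) * mode_energy P Q n 0) ->
  exists K, 0 <= K /\ forall n y, 0 <= y <= 1 ->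
    fmode P Q (freq n) t y ^+ 2 + fmode Q (fun t y x => - P t y x) (freq n) t y ^+ 2 <=
    K * expR (- (a n / 2)).
Proof.
move=> cb C0 t0 a0 dec.
have [cP cQ cPy cQy] := And4 (ss_c SP) (ss_c SQ) (ss_cy SP) (ss_cy SQ).
pose S0 := sqnorm (P 0) (Q 0); pose S1 := sqnorm (Py t) (Qy t).
have S00 : 0 <= S0 by apply: sqnorm_ge0; rewrite /continuous2; cts.
have S10 : 0 <= S1 by apply: sqnorm_ge0; rewrite /continuous2; cts.
have CS : 0 <= C * S0 := mulr_ge0 C0 S00.
exists (C * S0 + C * S0 + S1); split; first exact: addr_ge0 (addr_ge0 CS CS) S10.
move=> n y yI; have [cn sn] := @cos_sin_freq R n.
have HP := heat_pair_fmode cb SP SQ cn sn.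
(* This interpolation parameter balances the terms: the energy is of order e^2 and the dissipation
   bounded, so E / e and e D are both of order [e]. *)
set e := expR (- (a n / 2)); have e0 : 0 < e by exact: expR_gt0.
have e1 : e <= 1 by rewrite /e expR_le1 oppr_le0 divr_ge0.
have E2 : expR (- a n) = e * e by rewrite /e -expRD; congr expR; field.
have := @pointwise_le R (fmode P Q (freq n) t) (fmode Py Qy (freq n) t)
  (fmode Q (fun t y x => - P t y x) (freq n) t)
  (fmode Qy (fun t y x => - Py t y x) (freq n) t) e y e0 yI
  (cts_section (t := t) (hp_cu HP)) (cts_section (t := t) (hp_cuy HP))
  (cts_section (t := t) (hp_cv HP)) (cts_section (t := t) (hp_cvy HP))
  (fun y yI => hp_uy HP t0 yI) (fun y yI => hp_vy HP t0 yI).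
set lhs := _ + _; set E := itg _ _ _; set D := itg _ _ _ => h.
have hE : E <= C * S0 * (e * e).
  apply: le_trans (dec n) _; rewrite E2 mulrAC; apply: ler_wpM2r.
    exact: mulr_ge0 (ltW e0) (ltW e0).
  exact: ler_wpM2l C0 _ _ (@mode_energy_le P Q n 0 cP cQ).
have hD : D <= S1 by exact: (@mode_energy_le Py Qy n t).
have hE1 : E <= C * S0 * e.
  by apply: le_trans hE _; apply: ler_wpM2l => //; rewrite ler_piMl// ltW.
have hE2 : E / e <= C * S0 * e by rewrite ler_pdivrMr//; have -> : C * S0 * e * e = C * S0 * (e * e) by ring.
have hD2 : e * D <= S1 * e by rewrite mulrC; apply: ler_wpM2r => //; exact: ltW.
have -> : (C * S0 + C * S0 + S1) * e = C * S0 * e + C * S0 * e + S1 * e by ring.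
by apply: le_trans h _; apply: lerD => //; exact: lerD.
Qed.

End strip_modes.

(** * Sums of trigonometric series *)

Section trigonometric_series.
Context {R : realType}.

Lemma coefR_close (P Q P' Q' : R -> R) (k w : R) : continuous P -> continuous Q ->
  continuous P' -> continuous Q' ->
  (forall x, `|P x - P' x| <= w) -> (forall x, `|Q x - Q' x| <= w) ->
  `|coefR P Q k - coefR P' Q' k| <= 2 * w.
Proof.
move=> cP cQ cP' cQ' hP hQ; rewrite /coefR -itgB; [|by cts|by cts].
set F := (F in itg 0 1 F).
have cF : continuous F by rewrite /F; cts.
apply: le_trans (le_norm_itg _ _ _) _ => //.
have -> : 2 * w = itg 0 1 (fun=> 2 * w) by rewrite itg_cst// subr0 mulr1.
apply: le_itg; [by cts|exact: cts_cst|move=> x _].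
have -> : F x = (P x - P' x) * cos (k * x) + (Q x - Q' x) * sin (k * x).
  by rewrite /F; ring.
apply: le_trans (ler_normD _ _) _; rewrite !normrM mulr_natl mulr2n.
have c1 : `|cos (k * x)| <= 1 by rewrite ler_norml cos_geN1 cos_le1.
have s1 : `|sin (k * x)| <= 1 by rewrite ler_norml sin_geN1 sin_le1.
have mul_le (p q : R) : `|p| <= w -> `|q| <= 1 -> `|p| * `|q| <= w.
  by move=> pw q1; apply: le_trans pw; rewrite ler_piMr.
by apply: lerD; apply: mul_le.
Qed.

Lemma eq_of_small_dist (p q w : R) : (forall K : nat, `|p - q| <= w / K.+1%:R) -> p = q.
Proof.
move=> H; apply/eqP; rewrite -subr_eq0 -normr_le0 leNgt; apply/negP => pq0.
have w0 : 0 <= w by have := H 0%N; rewrite divr1; exact: le_trans.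
have [K] := inv_succ_lt w0 pq0.
by rewrite ltNge H.
Qed.

Variables (a c : int -> R -> R) (M : R).
Hypotheses (M0 : 0 <= M) (ca : forall n, continuous (a n)) (cc : forall n, continuous (c n)).
Hypothesis bound : forall (K : nat) n y, n \in [:: Posz K; Negz K] ->
  `|a n y| <= M / K.+1%:R - M / K.+2%:R /\ `|c n y| <= M / K.+1%:R - M / K.+2%:R.

(** Level K adds two frequencies, each contributing at most 2 (M / (K+1) - M / (K+2)); the 4 makes
    these increments telescope to the tail bound [w K]. *)
Let w (K : nat) := 4 * M / K.+1%:R.

Let w_ge0 K : 0 <= w K.
Proof. by rewrite divr_ge0 ?mulr_ge0. Qed.

Let w_sub K : w K - w K.+1 =
  2 * (M / K.+1%:R - M / K.+2%:R) + 2 * (M / K.+1%:R - M / K.+2%:R).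
Proof. by rewrite /w; ring. Qed.

Let w_lim e : 0 < e -> exists K, w K < e.
Proof. by move=> e0; apply: inv_succ_lt => //; rewrite mulr_ge0. Qed.

Let term_le (p q x D : R) : `|p| <= D -> `|q| <= D ->
  `|p * cos x - q * sin x| <= 2 * D /\ `|p * sin x + q * cos x| <= 2 * D.
Proof.
move=> pD qD.
have c1 : `|cos x| <= 1 by rewrite ler_norml cos_geN1 cos_le1.
have s1 : `|sin x| <= 1 by rewrite ler_norml sin_geN1 sin_le1.
have mul_le (r s : R) : `|r| <= D -> `|s| <= 1 -> `|r * s| <= D.
  by move=> rD s_1; rewrite normrM; apply: le_trans rD; rewrite ler_piMr.
split.
  apply: le_trans (ler_normB _ _) _.
  by have := mul_le p _ pD c1; have := mul_le q _ qD s1; lra.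
apply: le_trans (ler_normD _ _) _.
by have := mul_le p _ pD s1; have := mul_le q _ qD c1; lra.
Qed.

Lemma trig_limit : exists GR GI : R -> R -> R,
  [/\ continuous2 GR, continuous2 GI,
    forall y x K, `|GR y x - trig_re (idx K) (a^~ y) (c^~ y) x| <= 4 * M / K.+1%:R &
    forall y x K, `|GI y x - trig_im (idx K) (a^~ y) (c^~ y) x| <= 4 * M / K.+1%:R].
Proof.
have two K y : `|a (Posz K) y| <= M / K.+1%:R - M / K.+2%:R /\
    `|c (Posz K) y| <= M / K.+1%:R - M / K.+2%:R.
  by apply: bound; rewrite mem_head.
have two' K y : `|a (Negz K) y| <= M / K.+1%:R - M / K.+2%:R /\
    `|c (Negz K) y| <= M / K.+1%:R - M / K.+2%:R.
  by apply: bound; rewrite !in_cons eqxx orbT.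
have [GR [cR hR]] : exists g : R * R -> R, continuous g /\
    forall K z, `|g z - trig_re (idx K) (a^~ z.1) (c^~ z.1) z.2| <= w K.
  apply: (@uniform_limit R _ (fun K z => trig_re (idx K) (a^~ z.1) (c^~ z.1) z.2)) => //.
    by move=> K; apply: cts_sum => n; have can := @ca n; have ccn := @cc n; cts.
  move=> K [y x]; rewrite /trig_re /= !big_cons addrA addrK.
  apply: le_trans (ler_normD _ _) _.
  have [a1 c1] := two K y; have [a2 c2] := two' K y.
  have [h1 _] := term_le (freq (Posz K) * x) a1 c1.
  have [h2 _] := term_le (freq (Negz K) * x) a2 c2.
  by rewrite w_sub; exact: lerD.
have [GI [cI hI]] : exists g : R * R -> R, continuous g /\
    forall K z, `|g z - trig_im (idx K) (a^~ z.1) (c^~ z.1) z.2| <= w K.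
  apply: (@uniform_limit R _ (fun K z => trig_im (idx K) (a^~ z.1) (c^~ z.1) z.2)) => //.
    by move=> K; apply: cts_sum => n; have can := @ca n; have ccn := @cc n; cts.
  move=> K [y x]; rewrite /trig_im /= !big_cons addrA addrK.
  apply: le_trans (ler_normD _ _) _.
  have [a1 c1] := two K y; have [a2 c2] := two' K y.
  have [_ h1] := term_le (freq (Posz K) * x) a1 c1.
  have [_ h2] := term_le (freq (Negz K) * x) a2 c2.
  by rewrite w_sub; exact: lerD.
exists (fun y x => GR (y, x)), (fun y x => GI (y, x)); split.
- by rewrite /continuous2 (_ : (fun z => _) = GR)//; apply/funext => -[].
- by rewrite /continuous2 (_ : (fun z => _) = GI)//; apply/funext => -[].
- by move=> y x K; exact: (hR K (y, x)).
- by move=> y x K; exact: (hI K (y, x)).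
Qed.

Variables (GR GI : R -> R -> R).
Hypotheses (cGR : continuous2 GR) (cGI : continuous2 GI).
Hypothesis hR : forall y x K,
  `|GR y x - trig_re (idx K) (a^~ y) (c^~ y) x| <= 4 * M / K.+1%:R.
Hypothesis hI : forall y x K,
  `|GI y x - trig_im (idx K) (a^~ y) (c^~ y) x| <= 4 * M / K.+1%:R.

Let mem_idx_big m K : m \in idx (`|m|.+1 + K).
Proof. by rewrite mem_idx; case: m => j /=; rewrite ?addSn ltnS ?leq_addr// -addSn leqW ?leq_addr. Qed.

Let w_decr j K : w (j + K) <= w K.
Proof.
rewrite /w; apply: ler_wpM2l; first by rewrite mulr_ge0.
by rewrite lef_pV2 ?posrE ?ltr0n// ler_nat ltnS leq_addl.
Qed.

(** Once [m] is among the indices, partial sums have exactly the coefficient prescribed at [m]; the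
    limit differs from it by at most twice the tail bound, which tends to 0. *)
Lemma coef_trig_limit m y : coefR (GR y) (GI y) (freq m) = a m y /\
  coefR (GI y) (fun x => - GR y x) (freq m) = c m y.
Proof.
have cRy : continuous (GR y) by exact: cts_section.
have cIy : continuous (GI y) by exact: cts_section.
have c1 K := @cts_trig_re R (idx K) (a^~ y) (c^~ y).
have c2 K := @cts_trig_im R (idx K) (a^~ y) (c^~ y).
split; apply: (@eq_of_small_dist _ _ (2 * (4 * M))) => K.
- have -> : a m y = coefR (trig_re (idx (`|m|.+1 + K)) (a^~ y) (c^~ y))
      (trig_im (idx (`|m|.+1 + K)) (a^~ y) (c^~ y)) (freq m).
    by rewrite coefR_trig sum_delta ?uniq_idx// mem_idx_big.
  rewrite -mulrA; apply: coefR_close => //.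
  + by move=> x; apply: le_trans (w_decr _ _); exact: hR.
  + by move=> x; apply: le_trans (w_decr _ _); exact: hI.
- have -> : c m y = coefR (trig_im (idx (`|m|.+1 + K)) (a^~ y) (c^~ y))
      (fun x => - trig_re (idx (`|m|.+1 + K)) (a^~ y) (c^~ y) x) (freq m).
    by rewrite coefI_trig sum_delta ?uniq_idx// mem_idx_big.
  rewrite -mulrA; apply: coefR_close => //.
  + by cts.
  + by have c1K := c1 (`|m|.+1 + K)%N; cts.
  + by move=> x; apply: le_trans (w_decr _ _); exact: hI.
  + move=> x; apply: le_trans (w_decr _ _); rewrite opprK addrC distrC.
    exact: hR.
Qed.

(** Being bounded by W = 4 M (the tail bound of the empty sum) and within [w K] of the partial sum
    S_K, the limit satisfies |G|^2 <= |S_K|^2 + 4 W w K pointwise. Parseval integrates S_K, and a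
    large K contradicts any excess over [B]. *)
Lemma sqnorm_trig_limit B :
  (forall K, \sum_(n <- idx K) itg 0 1 (fun y => a n y ^+ 2 + c n y ^+ 2) <= B) ->
  sqnorm GR GI <= B.
Proof.
move=> HB; rewrite -subr_le0 leNgt; apply/negP => d0.
pose W := 4 * M; have W0 : 0 <= W by rewrite mulr_ge0.
have WW : 0 <= 4 * W * W by apply: mulr_ge0 => //; exact: mulr_ge0.
have [K] := inv_succ_lt WW d0.
rewrite ltNge => /negP; apply; rewrite lerBlDr.
have b1 y x : `|GR y x| <= W.
  by have := hR y x 0; rewrite /trig_re big_nil subr0 divr1.
have b2 y x : `|GI y x| <= W.
  by have := hI y x 0; rewrite /trig_im big_nil subr0 divr1.
have sq (g s : R) : `|g| <= W -> `|g - s| <= w K -> g ^+ 2 <= s ^+ 2 + 2 * W * w K.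
  move=> gW gs.
  have -> : s ^+ 2 + 2 * W * w K = g ^+ 2 + (2 * (W * w K - g * (g - s)) + (g - s) ^+ 2).
    by ring.
  rewrite lerDl addr_ge0 ?sqr_ge0// mulr_ge0// subr_ge0.
  by apply: le_trans (ler_norm _) _; rewrite normrM; apply: ler_pM.
apply: le_trans (_ : itg 0 1 (fun y => \sum_(n <- idx K) (a n y ^+ 2 + c n y ^+ 2) +
    4 * W * w K) <= _).
  apply: le_itg => [|| y _].
  - by apply: cts_itg; rewrite /continuous2; cts.
  - apply: ctsD; last exact: cts_cst.
    by apply: cts_sum => n; have can := @ca n; have ccn := @cc n; cts.
  have c1 := @cts_trig_re R (idx K) (a^~ y) (c^~ y).
  have c2 := @cts_trig_im R (idx K) (a^~ y) (c^~ y).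
  rewrite -(parseval_trig _ _ (uniq_idx K)).
  have -> : 4 * W * w K = itg 0 1 (fun=> 4 * W * w K) by rewrite itg_cst// subr0 mulr1.
  rewrite -itgD; [|by cts|exact: cts_cst].
  apply: le_itg => [|| x _]; [by cts| |].
    by apply: ctsD; [cts|exact: cts_cst].
  have := sq _ _ (b1 y x) (hR y x K); have := sq _ _ (b2 y x) (hI y x K).
  by lra.
rewrite itgD; last 2 first.
- by apply: cts_sum => n; have can := @ca n; have ccn := @cc n; cts.
- exact: cts_cst.
rewrite itg_bigsum; last by move=> n; have can := @ca n; have ccn := @cc n; cts.
rewrite itg_cst// subr0 mulr1 addrC lerD//.
by rewrite /w /W !mulrA.
Qed.

End trigonometric_series.

(** * The image under the multiplier *)

Section multiplier.
Context {R : realType}.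

(** A stretched exponential beats j^(-2): the (N+3)-th power of A j^(2/(N+3)) is A^(N+3) j^2, to
    which [pow_le_expR] applies. The bound is put in telescoping form; the 2 covers n = 0, and the 6
    comes from (k+1)(k+2) <= 6 j^2. *)
Lemma rate_weight (N : nat) (A : R) : 0 < A -> exists M, 0 <= M /\
  forall K n, n \in [:: Posz K; Negz K] ->
    expR (- (A * `|freq n : R| `^ (2 / (N%:R + 3)))) <= M / K.+1%:R - M / K.+2%:R.
Proof.
move=> A0; pose q : R := (N + 3)%:R ^+ (N + 3) / A ^+ (N + 3).
have q0 : 0 <= q by rewrite divr_ge0// exprn_ge0 ?ler0n ?(ltW A0).
exists (2 + 6 * q); split; first by lra.
have N3 : 0 < N%:R + 3 :> R by rewrite ltr_wpDl.
move=> K n nK; pose j : R := `|n|%N%:R; pose k : R := K%:R.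
have k0 : 0 <= k by exact: ler0n.
have dE : (2 + 6 * q) / K.+1%:R - (2 + 6 * q) / K.+2%:R = (2 + 6 * q) / ((k + 1) * (k + 2)).
  rewrite -[K.+2]addn1 -[K.+1]addn1 !natrD -/k.
  by field; rewrite !gt_eqF//; lra.
have kk0 : 0 < (k + 1) * (k + 2) by rewrite mulr_gt0//; lra.
rewrite dE ler_pdivlMr//; set f := `|freq n|.
have f0 : 0 <= f by exact: normr_ge0.
have [n0|n0] := eqVneq n 0.
  have -> : k = 0.
    by move: nK; rewrite /k n0 !inE => /orP[/eqP[<-]|].
  have e1 : expR (- (A * f `^ (2 / (N%:R + 3)))) <= 1.
    by rewrite expR_le1 oppr_le0 mulr_ge0 ?powR_ge0 ?ltW.
  by move: e1; move: (expR _) => e e1; lra.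
have j1 : 1 <= j by rewrite ler1n absz_gt0.
have kj : k <= j.
  by move: nK; rewrite !inE /k /j => /orP[/eqP ->|/eqP ->]; rewrite ler_nat//=.
have j0 : 0 <= j by lra.
pose z := A * j `^ (2 / (N%:R + 3)).
have z0 : 0 <= z by rewrite mulr_ge0 ?powR_ge0 ?ltW.
have zf : z <= A * f `^ (2 / (N%:R + 3)).
  apply: ler_wpM2l; first exact: ltW.
  apply: ge0_ler_powR; rewrite ?nnegrE//; exact: norm_freq_ge.
have zE : z ^+ (N + 3) = A ^+ (N + 3) * j ^+ 2.
  rewrite exprMn; congr (_ * _); rewrite -!powR_mulrn ?powR_ge0// -powRrM natrD.
  by rewrite divfK// gt_eqF.
have h1 : expR (- (A * f `^ (2 / (N%:R + 3)))) * j ^+ 2 <= q.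
  apply: (@le_trans _ _ (expR (- z) * j ^+ 2)).
    by apply: ler_wpM2r; [exact: sqr_ge0|rewrite ler_expR lerN2].
  rewrite /q ler_pdivlMr ?exprn_gt0// -mulrA mulrC (mulrC (j ^+ 2)) -zE expRN.
  rewrite ler_pdivrMr ?expR_gt0//; apply: pow_le_expR => //.
  by rewrite addn_gt0 orbT.
have h2 : (k + 1) * (k + 2) <= 6 * j ^+ 2 by nra.
have e0 : 0 <= expR (- (A * f `^ (2 / (N%:R + 3)))) by exact: expR_ge0.
move: (expR _) e0 h1 => e e0 h1.
have := ler_wpM2l e0 h2.
by move=> h; apply: le_trans h _; rewrite mulrCA; lra.
Qed.

Variables (N : nat) (C d nu p T t : R).
Hypotheses (C0 : 0 <= C) (d0 : 0 < d) (nu0 : 0 < nu) (t0 : 0 < t) (Tt : 0 <= T <= 2 * t).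
Hypothesis pN : (N%:R + 3) / 2 < p.

(** [T] is the time in the multiplier and [t] the time elapsed since the base time, at least half of
    [T]. Of the 1/16, a factor 2 pays for T <= 2 t; the 1/8 left gives a squared multiplier of at
    most e^(r/4), where energies decay like e^(-r). *)
Definition multiplier (k : R) : R :=
  expR (d / 16 * nu `^ ((N%:R + 1) / (N%:R + 3)) * k `^ p^-1 * T).

(** A nonzero frequency is at least 1 in modulus, so the smaller exponent 1/p gives the smaller
    power; at frequency 0 both powers vanish. *)
Lemma multiplier_le n : multiplier `|freq n| <= expR (d / 8 * rate N nu `|freq n| * t).
Proof.
have N3 : 0 < N%:R + 3 :> R by rewrite ltr_wpDl.
have p0 : 0 < p by apply: lt_trans pN; rewrite divr_gt0.
have [T0 T2] := andP Tt.
have le_pow : `|freq n : R| `^ p^-1 <= `|freq n| `^ (2 / (N%:R + 3)).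
  have [->|n0] := eqVneq n 0.
    rewrite /freq mulr0 normr0 !powR0//.
    by rewrite invr_eq0 gt_eqF.
  rewrite ler_powR//; first exact: norm_freq_ge1.
  by rewrite -[2 / _]invf_div lef_pV2 ?posrE ?divr_gt0// ltW.
rewrite /multiplier ler_expR /rate.
set a := nu `^ _; set x := _ `^ p^-1; set z := _ `^ _.
have a0 : 0 <= a by exact: powR_ge0.
have z0 : 0 <= z by exact: powR_ge0.
have -> : d / 16 * a * x * T = (d / 16 * a) * (x * T) by ring.
have -> : d / 8 * (a * z) * t = (d / 16 * a) * (z * (2 * t)) by field.
apply: ler_wpM2l; first by rewrite mulr_ge0// divr_ge0// ltW.
by apply: ler_pM => //; exact: powR_ge0.
Qed.

Let decay_rate_ge0 (n : int) : 0 <= d * rate N nu `|freq n| * t.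
Proof.
by apply: mulr_ge0; [apply: mulr_ge0; [exact: ltW|exact: rate_ge0]|exact: ltW].
Qed.

Lemma multiplier_gt0 k : 0 < multiplier k.
Proof. exact: expR_gt0. Qed.

Lemma multiplier_sqr_le n :
  multiplier `|freq n| ^+ 2 <= expR (d * rate N nu `|freq n| * t / 4).
Proof.
have -> : expR (d * rate N nu `|freq n : R| * t / 4) =
    expR (d / 8 * rate N nu `|freq n| * t) ^+ 2.
  by rewrite expr2 -expRD; congr expR; field.
have m0 := ltW (multiplier_gt0 `|freq n|).
by rewrite ler_sqr ?nnegrE ?expR_ge0//; exact: multiplier_le.
Qed.

Variables (b : R -> R) (bc : strip_bc).
Variables (P Py Pyy Px Q Qy Qyy Qx : R -> R -> R -> R).
Hypotheses (cb : continuous b) (SP : strip_solution nu b bc P Py Pyy Px)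
  (SQ : strip_solution nu b bc Q Qy Qyy Qx).
Hypothesis decay : forall n, mode_energy P Q n t <=
  C * expR (- (d * rate N nu `|freq n| * t)) * mode_energy P Q n 0.

(** The decay e^(-r) outweighs the squared multiplier e^(r/4) mode by mode; Bessel then sums the
    energies at the base time. *)
Lemma multiplier_sum (s : seq int) : uniq s ->
  \sum_(n <- s) multiplier `|freq n| ^+ 2 * mode_energy P Q n t <=
  C * sqnorm (P 0) (Q 0).
Proof.
move=> us.
apply: (@le_trans _ _ (\sum_(n <- s) C * mode_energy P Q n 0)); last first.
  rewrite -mulr_sumr; apply: ler_wpM2l => //.
  by apply: mode_bessel => //; [exact: ss_c SP|exact: ss_c SQ].
apply: ler_sum => n _; have HP := heat_pair_fmode cb SP SQ (cos_sin_freq n).1 (cos_sin_freq n).2.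
have E0 : 0 <= mode_energy P Q n 0 by exact: (energy_ge0 HP).
have Et : 0 <= mode_energy P Q n t by exact: (energy_ge0 HP).
apply: le_trans (_ : expR (d * rate N nu `|freq n| * t / 4) *
  (C * expR (- (d * rate N nu `|freq n| * t)) * mode_energy P Q n 0) <= _).
  by apply: ler_pM => //; [exact: sqr_ge0|exact: multiplier_sqr_le].
have -> : forall x y z : R, x * (C * y * z) = x * y * (C * z) by move=> *; ring.
rewrite -expRD; apply: ler_piMl; first exact: mulr_ge0 C0 E0.
rewrite expR_le1; have := decay_rate_ge0 n.
by move: (d * rate _ _ _ * t) => r r0; rewrite subr_le0 ler_pdivrMr// ler_peMr ?ler1n.
Qed.

(** The decay r = d rate t is shared out: squared modes are pointwise at most K e^(-r/2), the
    squared multiplier at most e^(r/4), and e^(-r/4) remains for summability. [B] is left free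
    because the sum will be bounded from other base times. *)
Lemma multiplier_series : exists GR GI : R -> R -> R,
  [/\ continuous2 GR, continuous2 GI,
    forall n y, 0 <= y <= 1 ->
      coefR (GR y) (GI y) (freq n) = multiplier `|freq n| * fmode P Q (freq n) t y /\
      coefR (GI y) (fun x => - GR y x) (freq n) =
        multiplier `|freq n| * fmode Q (fun t y x => - P t y x) (freq n) t y &
    forall B, (forall K,
        \sum_(n <- idx K) multiplier `|freq n| ^+ 2 * mode_energy P Q n t <= B) ->
      sqnorm GR GI <= B].
Proof.
pose a n y := multiplier `|freq n| * fmode P Q (freq n) t (clamp y).
pose c n y := multiplier `|freq n| * fmode Q (fun t y x => - P t y x) (freq n) t (clamp y).
have [cP cQ] := (ss_c SP, ss_c SQ); have cc := @cts_clamp R.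
have cN : continuous3 (fun t y x => - P t y x) by rewrite /continuous3; cts.
have ca n : continuous (a n).
  by have h := @cts_fmode R P Q (freq n) cP cQ; rewrite /a; cts.
have ccn n : continuous (c n).
  by have h := @cts_fmode R Q _ (freq n) cQ cN; rewrite /c; cts.
have [K [K0 HK]] := mode_pointwise SP SQ cb C0 t0 decay_rate_ge0 decay.
(* Square root of the remaining e^(-r/4): A |freq n|^(2/(N+3)) equals r / 8. *)
pose A := d * nu `^ ((N%:R + 1) / (N%:R + 3)) * t / 8.
have A0 : 0 < A by rewrite divr_gt0// !mulr_gt0// powR_gt0.
have [M [M0 HM]] := rate_weight N A0.
have sqr_bound n y : a n y ^+ 2 + c n y ^+ 2 <=
    (Num.sqrt K * expR (- (A * `|freq n| `^ (2 / (N%:R + 3))))) ^+ 2.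
  rewrite /a /c !exprMn -mulrDr sqr_sqrtr//.
  apply: le_trans (ler_pM (sqr_ge0 _) _ (multiplier_sqr_le n) (HK n (clamp y) (clamp_itv y))) _.
    by rewrite addr_ge0 ?sqr_ge0.
  have -> : A * `|freq n| `^ (2 / (N%:R + 3)) = d * rate N nu `|freq n| * t / 8.
    by rewrite /A /rate; ring.
  rewrite mulrCA; apply: ler_wpM2l => //.
  rewrite [leRHS]expr2 -!expRD ler_expR.
  by move: (d * rate _ _ _ * t) => r; lra.
have abs_bound n y : `|a n y| <= Num.sqrt K * expR (- (A * `|freq n| `^ (2 / (N%:R + 3)))) /\
    `|c n y| <= Num.sqrt K * expR (- (A * `|freq n| `^ (2 / (N%:R + 3)))).
  have := sqr_bound n y; set r := Num.sqrt K * _ => h.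
  have r0 : 0 <= r by rewrite mulr_ge0 ?sqrtr_ge0 ?expR_ge0.
  have sq (x : R) : x ^+ 2 <= r ^+ 2 -> `|x| <= r.
    by move=> xr; rewrite -(ger0_norm r0) -ler_sqr ?nnegrE// !real_normK ?num_real.
  by split; apply: sq; apply: le_trans h; rewrite ?lerDl ?lerDr sqr_ge0.
have M'0 : 0 <= Num.sqrt K * M by rewrite mulr_ge0 ?sqrtr_ge0.
have bound (k : nat) n y : n \in [:: Posz k; Negz k] ->
    `|a n y| <= Num.sqrt K * M / k.+1%:R - Num.sqrt K * M / k.+2%:R /\
    `|c n y| <= Num.sqrt K * M / k.+1%:R - Num.sqrt K * M / k.+2%:R.
  move=> nk; have h := ler_wpM2l (sqrtr_ge0 K) (HM k n nk).
  rewrite mulrBr !mulrA in h; have [h1 h2] := abs_bound n y.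
  by split; [exact: le_trans h1 h|exact: le_trans h2 h].
have [GR [GI [cR cI hR hI]]] := trig_limit M'0 ca ccn bound.
exists GR, GI; split => //.
  move=> n y yI; have [-> ->] := coef_trig_limit M'0 cR cI hR hI n y.
  by rewrite /a /c clamp_id.
move=> B HB; apply: (sqnorm_trig_limit M'0 ca ccn cR cI hR hI) => k.
apply: le_trans (HB k); apply: ler_sum => n _.
have h1 := @cts_fmode R P Q (freq n) cP cQ; have h2 := @cts_fmode R Q _ (freq n) cQ cN.
rewrite /mode_energy /energy -itgZ; last by cts.
have -> // : itg 0 1 (fun y => a n y ^+ 2 + c n y ^+ 2) = itg 0 1 (fun y =>
    multiplier `|freq n| ^+ 2 * (fmode P Q (freq n) t y ^+ 2 +
      fmode Q (fun t y x => - P t y x) (freq n) t y ^+ 2)).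
by apply: eq_itg => y yI; rewrite /a /c clamp_id// !exprMn mulrDr.
Qed.

End multiplier.

Section continuous_representatives.
Context {R : realType}.
Local Notation mR := (measurableTypeR R).

Lemma fourier_coefE (h : R * R -> R[i]) (P Q : R -> R) n y :
  (forall x, 0 <= x <= 1 -> complex.Re (h (x, y)) = P x /\ complex.Im (h (x, y)) = Q x) ->
  fourier_coef h n y =
    (coefR P Q (freq n) +i* coefR Q (fun x => - P x) (freq n))%C.
Proof.
move=> hE; rewrite /fourier_coef /integral_circle; congr (_ +i* _)%C.
- apply: (@eq_itg R _ (fun x => P x * cos (freq n * x) + Q x * sin (freq n * x))) => x xI.
  have [<- <-] := hE x xI; case: (h (x, y)) => p q /=.
  by rewrite cosN sinN; ring.
- apply: (@eq_itg R _ (fun x => Q x * cos (freq n * x) + - P x * sin (freq n * x))) => x xI.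
  have [<- <-] := hE x xI; case: (h (x, y)) => p q /=.
  by rewrite cosN sinN; ring.
Qed.

Lemma continuous_cell_measurable (h : R * R -> R[i]) (P Q : R -> R -> R) :
  continuous2 P -> continuous2 Q ->
  (forall x y, 0 <= x <= 1 -> 0 <= y <= 1 ->
     complex.Re (h (x, y)) = P y x /\ complex.Im (h (x, y)) = Q y x) ->
  cell_measurable h.
Proof.
move=> cP cQ hE.
have mF (F : R -> R -> R) (H : R * R -> R) : continuous2 F ->
    (forall x y, 0 <= x <= 1 -> 0 <= y <= 1 -> H (x, y) = F y x) ->
    measurable_fun (cell : set (mR * mR)) (H : mR * mR -> mR).
  move=> cF HE; apply: (@eq_measurable_fun _ _ _ _ _ (fun z : mR * mR => F z.2 z.1)).
    move=> [x y]; rewrite inE => -[/=]; rewrite !in_itv/= => xI yI.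
    by rewrite HE.
  apply: measurable_funTS; apply: (@continuous_measurable_prod R (fun z => F z.2 z.1)).
  by cts.
by split; [apply: (mF P) => // x y xI yI; rewrite (hE x y xI yI).1
  |apply: (mF Q) => // x y xI yI; rewrite (hE x y xI yI).2].
Qed.

End continuous_representatives.

(** * Solutions seen from a positive base time *)

Section solution_modes.
Context {R : realType}.
Variables (bc : boundary_condition) (b b0 : R -> R) (nu : R)
  (fin : R * R -> R[i]) (f : R -> R * R -> R[i]).
Hypotheses (b0E : forall y, 0 < y < 1 -> b0 y = b y) (S : solution bc b nu fin f).

Let d := ydomain_of bc.

Definition re_part (z : R * (R * R)) : R := complex.Re (f z.1 z.2).
Definition im_part (z : R * (R * R)) : R := complex.Im (f z.1 z.2).

(** The equation differentiates slices, with t or the space point fixed, while smoothness is stated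
    on space-time; the difference quotients agree. A general [h] serves both the real and the
    imaginary part. *)
Let pde (h : R[i] -> R) (hf := fun z : R * (R * R) => h (f z.1 z.2)) (t : R) (w : R * R) :
  ('D_1 (fun s => h (f s w)) t = 'D_((1, (0, 0)) : R * (R * R)) hf (t, w)) *
  ('D_(ex : R * R) (fun w => h (f t w)) w = 'D_((0, (1, 0)) : R * (R * R)) hf (t, w)) *
  ('D_(ey : R * R) ('D_(ey : R * R) (fun w => h (f t w))) w =
   'D_((0, (0, 1)) : R * (R * R)) ('D_((0, (0, 1)) : R * (R * R)) hf) (t, w)).
Proof.
have ey1 (G : R * (R * R) -> R) w' : 'D_(ey : R * R) (fun w => G (t, w)) w' =
    'D_((0, (0, 1)) : R * (R * R)) G (t, w').
  apply: (@derive_along R _ _ G (fun w : R * R => (t, w))) => k.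
  by congr (_, _) => /=; rewrite ?scaler0 ?add0r.
split; [split|].
- apply: (@derive_along R _ _ hf (fun s : R => (s, w))) => k.
  case: w => w1 w2; congr (_, (_, _)) => /=; rewrite ?scaler0 ?add0r//.
- apply: (@derive_along R _ _ hf (fun w : R * R => (t, w))) => k.
  by congr (_, _) => /=; rewrite ?scaler0 ?add0r.
have E : 'D_(ey : R * R) (fun w => h (f t w)) =
    (fun w' => 'D_((0, (0, 1)) : R * (R * R)) hf (t, w')).
  by apply/funext => w'; exact: (ey1 hf).
rewrite E; exact: (ey1 ('D_((0, (0, 1)) : R * (R * R)) hf) w).
Qed.

Let pde_parts (a c e : R[i]) (r s : R) : a + r%:C%C * c - s%:C%C * e = 0 ->
  complex.Re a + r * complex.Re c - s * complex.Re e = 0 /\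
  complex.Im a + r * complex.Im c - s * complex.Im e = 0.
Proof.
case: a c e => [a1 a2] [c1 c2] [e1 e2] /eqP; rewrite eq_complex /=.
by move=> /andP[/eqP h1 /eqP h2]; split; lra.
Qed.

Definition solution_re (s t y x : R) : R := re_part (strip_point s t y x).
Definition solution_im (s t y x : R) : R := im_part (strip_point s t y x).

Lemma solution_strip_re s : 0 < s -> exists Py Pyy Px,
  strip_solution nu b0 (strip_bc_of bc) (solution_re s) Py Pyy Px.
Proof.
move=> s0; apply: (@strip_of_solution R nu b b0 d s b0E s0 re_part (sol_smooth S).1) => //.
- move=> [t w] [t0 wU].
  have [+ _] := pde_parts (sol_equation S t0 wU).
  by rewrite /cderive /= !(pde (@complex.Re R)).
- by move=> t x y t0 yU; rewrite /re_part /= (sol_xperiodic S t0).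
- move=> t x t0; have := sol_bc S t0; case: (bc) => /= H.
  + by move=> y; rewrite /re_part /= H.
  + by rewrite /re_part /= (H x).1 (H x).2.
  + have E z : extend_from (Omega UnitInterval) ('D_(ey : R * R) (fun w => re_part (t, w))) z =
        complex.Re (cextend_from (Omega UnitInterval) (cderive ey (f t)) z) by reflexivity.
    by rewrite !E (H x).1 (H x).2.
Qed.

Lemma solution_strip_im s : 0 < s -> exists Py Pyy Px,
  strip_solution nu b0 (strip_bc_of bc) (solution_im s) Py Pyy Px.
Proof.
move=> s0; apply: (@strip_of_solution R nu b b0 d s b0E s0 im_part (sol_smooth S).2) => //.
- move=> [t w] [t0 wU].
  have [_ +] := pde_parts (sol_equation S t0 wU).
  by rewrite /cderive /= !(pde (@complex.Im R)).
- by move=> t x y t0 yU; rewrite /im_part /= (sol_xperiodic S t0).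
- move=> t x t0; have := sol_bc S t0; case: (bc) => /= H.
  + by move=> y; rewrite /im_part /= H.
  + by rewrite /im_part /= (H x).1 (H x).2.
  + have E z : extend_from (Omega UnitInterval) ('D_(ey : R * R) (fun w => im_part (t, w))) z =
        complex.Im (cextend_from (Omega UnitInterval) (cderive ey (f t)) z) by reflexivity.
    by rewrite !E (H x).1 (H x).2.
Qed.

Lemma solution_partsE s t y x : 0 <= t -> 0 <= y <= 1 ->
  solution_re s t y x = complex.Re (f (s + t) (x, y)) /\
  solution_im s t y x = complex.Im (f (s + t) (x, y)).
Proof.
move=> t0 yI; rewrite /solution_re /solution_im (strip_pointE s x t0 yI).
by split; reflexivity.
Qed.

(** Both sides are the energy of the mode at the same absolute time; this lets the base time vary
    while the image stays fixed. *)
Lemma solution_mode_energy s1 s2 t1 t2 n : 0 <= t1 -> 0 <= t2 -> s1 + t1 = s2 + t2 ->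
  mode_energy (solution_re s1) (solution_im s1) n t1 =
  mode_energy (solution_re s2) (solution_im s2) n t2.
Proof.
move=> t10 t20 E; apply: eq_itg => y yI.
have h x : solution_re s1 t1 y x = solution_re s2 t2 y x /\
    solution_im s1 t1 y x = solution_im s2 t2 y x.
  have [-> ->] := @solution_partsE s1 t1 y x t10 yI.
  by have [-> ->] := @solution_partsE s2 t2 y x t20 yI; rewrite E.
congr (_ ^+ 2 + _ ^+ 2); apply: eq_itg => x _; have [-> ->] := h x.
  by [].
by [].
Qed.

Lemma solution_fourier s t n y : 0 <= t -> 0 <= y <= 1 ->
  fourier_coef (f (s + t)) n y =
    (fmode (solution_re s) (solution_im s) (freq n) t y +i*
     fmode (solution_im s) (fun t y x => - solution_re s t y x) (freq n) t y)%C.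
Proof.
move=> t0 yI; apply: fourier_coefE => x _.
by have [-> ->] := @solution_partsE s t y x t0 yI.
Qed.

Lemma solution_cts s : 0 < s ->
  continuous3 (solution_re s) /\ continuous3 (solution_im s).
Proof.
move=> s0; have [? [? [? SP]]] := solution_strip_re s0.
have [? [? [? SQ]]] := solution_strip_im s0.
by split; [exact: ss_c SP|exact: ss_c SQ].
Qed.

Lemma solution_L2norm s : 0 < s ->
  L2norm (f s) = (Num.sqrt (sqnorm (solution_re s 0) (solution_im s 0)))%:E.
Proof.
move=> s0; have [cP cQ] := solution_cts s0.
apply: L2normE => [||x y xI yI]; [by rewrite /continuous2; cts|by rewrite /continuous2; cts|].
by have [-> ->] := @solution_partsE s 0 y x (lexx 0) yI; rewrite addr0.
Qed.

(* Near [t = 0] the solution is only known through its convergence in [L^2]. *)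
Lemma solution_norm_near0 (r e T : R) : cell_measurable fin -> L2norm fin = r%:E ->
  0 < e -> 0 < T ->
  exists s, 0 < s <= T /\
    Num.sqrt (sqnorm (solution_re s 0) (solution_im s 0)) <= r + e.
Proof.
move=> mfin finE e0 T0.
have e0' : (0 < e%:E)%E by rewrite lte_fin.
have [u /= u0 Hu] := sol_continuous S (lexx 0) (open_ereal_lt' e0').
pose s := Num.min (u / 2) T.
have s0 : 0 < s by rewrite lt_min T0 divr_gt0.
have su : s <= u / 2 by rewrite ge_min lexx.
exists s; split; first by rewrite s0 ge_min lexx orbT.
have near_s : (L2norm (fun z => f s z - f 0 z)%R < e%:E)%E.
  apply: Hu; last by rewrite /= in_itv/= andbT ltW.
  by rewrite /= sub0r normrN gtr0_norm//; lra.
have m0 : cell_measurable (f 0) by have [m1 m2 _] := sol_in_L2 S (lexx 0).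
have ms : cell_measurable (f s) by have [m1 m2 _] := sol_in_L2 S (ltW s0).
rewrite -lee_fin -solution_L2norm//.
apply: le_trans (L2norm_le_add ms m0) _.
rewrite addrC EFinD; apply: leeD; last exact: ltW.
by apply: le_trans (L2norm_le_add m0 mfin) _; rewrite (sol_initial S) add0e finE.
Qed.

End solution_modes.

(** * Assembly of the estimate *)

Theorem theorem1p2 (R : realType) (d : ydomain) (b : R -> R)
    (M : nat) (y : 'I_M -> R) (n : 'I_M -> nat)
    (hb : smooth_profile d b) (hcrit : critical_points d b y n) :
  let N : R := (\max_(i < M) n i)%:R in
  exists d0 nu0 : R, 0 < d0 /\ 0 < nu0 /\
  forall p : R, (N + 3) / 2 < p ->
  exists C : R,
  forall nu : R, 0 < nu < nu0 ->
  forall bc : boundary_condition, ydomain_of bc = d ->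
  forall fin : R * R -> R[i], initial_datum bc fin ->
    (forall y0, ydom_closed d y0 ->
       integral_circle (fun x => fin (x, y0)) = 0) ->
  forall f : R -> R * R -> R[i], solution bc b nu fin f ->
  forall t : R, 0 < t ->
  exists g : R * R -> R[i],
    [/\ in_L2 g,
        is_fourier_multiplier
          (fun k => expR (d0 * nu `^ ((N + 1) / (N + 3)) * k `^ p^-1 * t))
          (f t) g &
        (L2norm g <= C%:E * L2norm fin)%E].
Proof.
move=> N; have [b0 [b1 [b2 [Z [c [nd b0E]]]]]] := profile_nondegenerate hb hcrit.
have cb := nd_cb nd.
have [C [e [C1 e0 dec]]] := strip_mode_decay nd.
have C0 : 0 <= C by lra.
(* [nu0 = 1] keeps the tile length (nu / k)^(1/(N+3)) at most 1 at every nonzero frequency; 1/16 is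
   the share of the decay rate that [multiplier] spends. *)
exists (e / 16), 1; split; first by rewrite divr_gt0.
split => // p pN; exists (Num.sqrt C) => nu nuI bc dE fin [fin_s _ _] _ f S t t0.
have /andP[nu0 _] := nuI.
have t20 : 0 < t / 2 by rewrite divr_gt0.
(* A base time [s <= t / 2] leaves an elapsed time [t - s] of at least half of [t], as
   [multiplier_le] requires. *)
have split_time s : 0 < s <= t / 2 ->
    [/\ 0 < t - s, 0 <= t <= 2 * (t - s) & t / 2 + t / 2 = s + (t - s)].
  by move=> /andP[s0 s2]; split; [lra|rewrite ltW//=; lra|field].
have strip s : 0 < s <= t / 2 -> exists Py Pyy Px Qy Qyy Qx,
    strip_solution nu b0 (strip_bc_of bc) (solution_re f s) Py Pyy Px /\
    strip_solution nu b0 (strip_bc_of bc) (solution_im f s) Qy Qyy Qx.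
  move=> /andP[s0 _]; have [Py [Pyy [Px SP]]] := solution_strip_re b0E S s0.
  have [Qy [Qyy [Qx SQ]]] := solution_strip_im b0E S s0.
  by exists Py, Pyy, Px, Qy, Qyy, Qx.
have t2I : 0 < t / 2 <= t / 2 by rewrite t20 lexx.
have [Py [Pyy [Px [Qy [Qyy [Qx [SP SQ]]]]]]] := strip _ t2I.
have Tt : 0 <= t <= 2 * (t / 2) by rewrite ltW//=; lra.
have tE : t / 2 + t / 2 = t by field.
(* The image is fixed here, from the base time t / 2; smaller base times serve only to bound its
   norm. *)
have [GR [GI [cR cI coef norm_le]]] := multiplier_series C0 e0 nu0 t20 Tt pN cb SP SQ
  (fun n => dec _ _ _ _ _ _ _ _ _ _ nuI SP SQ n _ (ltW t20)).
pose fr (y x : R) := complex.Re (fin (x, clamp y)).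
pose fi (y x : R) := complex.Im (fin (x, clamp y)).
have cclamp : continuous (fun z : R * R => (z.2, clamp z.1)).
  have cc := @cts_clamp R.
  have h1 : continuous (fun z : R * R => z.2) by cts.
  have h2 : continuous (fun z : R * R => clamp z.1) by cts.
  by move=> z; exact: (cvg_pair (h1 z) (h2 z)).
have clampU (z : R * R) : Omega_closed (ydomain_of bc) (z.2, clamp z.1).
  by apply: ydom_closed_itv; exact: clamp_itv.
have cfr : continuous2 fr by exact: within_comp fin_s.1.1 cclamp clampU.
have cfi : continuous2 fi by exact: within_comp fin_s.2.1 cclamp clampU.
have finE x y0 : 0 <= x <= 1 -> 0 <= y0 <= 1 ->
    complex.Re (fin (x, y0)) = fr y0 x /\ complex.Im (fin (x, y0)) = fi y0 x.
  by move=> _ yI; rewrite /fr /fi clamp_id.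
have mfin := continuous_cell_measurable cfr cfi finE.
set g := fun z : R * R => (GR z.2 z.1 +i* GI z.2 z.1)%C.
have gE x y0 : 0 <= x <= 1 -> 0 <= y0 <= 1 ->
  complex.Re (g (x, y0)) = GR y0 x /\ complex.Im (g (x, y0)) = GI y0 x by [].
have ng := L2normE cR cI gE.
exists g; split.
- have [m1 m2] := continuous_cell_measurable cR cI gE.
  by split => //; rewrite ng ltry.
- apply: aeW => y0; rewrite in_itv/= => yI m.
  rewrite (@fourier_coefE R g (GR y0) (GI y0)) => [|x xI]; last exact: gE.
  have := @solution_fourier R f (t / 2) (t / 2) m y0 (ltW t20) yI; rewrite tE => ->.
  have [-> ->] := coef m y0 yI.
  by rewrite /multiplier; simpc.
have nfin := L2normE cfr cfi finE.
rewrite ng nfin -EFinM lee_fin; set r := Num.sqrt (sqnorm fr fi).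
have r0 : 0 <= r by exact: sqrtr_ge0.
(* [multiplier_sum] from a small base time [s] bounds the squared norm of the image by [C] times
   that of the solution at time [s], which is within [eta] of the norm of [fin]; the constant does
   not depend on [s]. *)
have close eta : 0 < eta -> Num.sqrt (sqnorm GR GI) <= Num.sqrt C * (r + eta).
  move=> eta0; have [s [sI hs]] := solution_norm_near0 b0E S mfin nfin eta0 t20.
  have [Py' [Pyy' [Px' [Qy' [Qyy' [Qx' [SP' SQ']]]]]]] := strip _ sI.
  have [ts0 Ts tsE] := split_time s sI.
  have := multiplier_sum C0 e0 ts0 Ts pN cb SP' SQ'
    (fun n => dec _ _ _ _ _ _ _ _ _ _ nuI SP' SQ' n _ (ltW ts0)) (uniq_idx _) => hsum.
  set q := sqnorm (solution_re f s 0) _ in hs hsum.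
  have q0 : 0 <= q.
    have [cP cQ] := (ss_c SP', ss_c SQ').
    by apply: sqnorm_ge0; rewrite /continuous2; cts.
  apply: (@le_trans _ _ (Num.sqrt (C * q))).
    rewrite ler_sqrt ?mulr_ge0//; apply: norm_le => K.
    apply: le_trans (hsum K); apply: ler_sum => n0 _.
    by rewrite (solution_mode_energy f n0 (ltW t20) (ltW ts0) tsE).
  by rewrite sqrtrM//; apply: ler_wpM2l => //; exact: sqrtr_ge0.
apply/ler_addgt0Pr => eta eta0.
have sC : 0 < Num.sqrt C by rewrite sqrtr_gt0; lra.
have := close (eta / Num.sqrt C) (divr_gt0 eta0 sC).
by rewrite mulrDr mulrCA divff ?gt_eqF// mulr1.
Qed.
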